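(* There exist $\mathbb{Z}^2$ shifts of finite type with arbitrarily large topological entropy for which every factor with positive topological entropy is intrinsically ergodic. That is, for every real number $M$ there is a $\mathbb{Z}^2$ shift of finite type $X$ with $h(X) > M$ such that, for every factor map $\phi$ from $X$ onto a $\mathbb{Z}^2$ subshift $\phi(X)$ with $h(\phi(X))>0$, the subshift $\phi(X)$ is intrinsically ergodic.
   Context: For a finite alphabet $A$, $A^{\mathbb{Z}^2}$ carries the product of discrete topologies and the shift action $(\sigma_t x)(s) = x(s+t)$. A $\mathbb{Z}^2$ subshift is a closed shift-invariant subset of $A^{\mathbb{Z}^2}$. A $\mathbb{Z}^2$ shift of finite type (SFT) is a subshift consisting of all points of $A^{\mathbb{Z}^2}$ in which no pattern from some fixed finite set of finite patterns appears (patterns being considered up to translation). A factor map is a continuous shift-commuting map from a subshift onto a subshift; the image is called a factor. $L_S(X)$ is the set of patterns with finite shape $S$ appearing in points of $X$; topological entropy is $h(X)=\lim_{n_1,n_2\to\infty}\frac{1}{n_1n_2}\log|L_{[1,n_1]\times[1,n_2]}(X)|$. For a shift-invariant Borel probability measure $\mu$ on $X$, $h(\mu)=\lim_{N\to\infty}\frac{1}{N^2}\sum_{w\in L_{[1,N]^2}(X)}-\mu([w])\log\mu([w])$. A measure of maximal entropy is a shift-invariant Borel probability measure with $h(\mu)=h(X)$, and $X$ is intrinsically ergodic if it has exactly one measure of maximal entropy. *)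

(* Defs.v *)
From HB Require Import structures.
From mathcomp Require Import all_boot all_order all_algebra finmap.
From mathcomp Require Import all_classical all_reals all_analysis.

Set Implicit Arguments.
Unset Strict Implicit.
Unset Printing Implicit Defensive.

Import Order.TTheory GRing.Theory Num.Theory.
Import numFieldNormedType.Exports.

Local Open Scope classical_set_scope.
Local Open Scope ring_scope.

(* Alphabets are finite and nonempty: measurable types are pointed in the
   library.  The base point plays no role in any definition below. *)
#[short(type="alphabetType")]
HB.structure Definition Alphabet := {T of Finite T & Pointed T}.

Notation Z2 := (int * int)%type.

Definition config (A : alphabetType) : Type :=
  {ptws Z2 -> discrete_topology A}.

HB.instance Definition _ (A : alphabetType) := Pointed.on (config A).
HB.instance Definition _ (A : alphabetType) := Topological.on (config A).

Notation borel_config A := (g_sigma_algebraType (@open (config A))).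

Section Dynamics.
Context {A : alphabetType}.
Implicit Types (X : set (config A)) (S : {fset Z2}) (x : config A) (t : Z2).

Definition shift t x : config A := fun s => x (s + t).

Definition is_subshift X : Prop :=
  closed X /\ forall t x, X x -> X (shift t x).

Definition restr S x : {ffun S -> A} := [ffun s => x (val s)].

Definition pattern : Type := {S : {fset Z2} & {ffun S -> A}}.

Definition appears (p : pattern) x : Prop :=
  exists t, restr (tag p) (shift t x) = tagged p.

Definition is_sft X : Prop :=
  is_subshift X /\
  exists2 F : set pattern, finite_set F &
    X = [set x | forall p, F p -> ~ appears p x].

Definition language X S : {set {ffun S -> A}} :=
  finset (fun w => `[< exists2 x, X x & restr S x = w >]).

Definition cylinder X S (w : {ffun S -> A}) : set (config A) :=
  [set x | X x /\ restr S x = w].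

End Dynamics.

Arguments pattern : clear implicits.

(* [1, n1] x [1, n2] *)
Definition rect (n1 n2 : nat) : {fset Z2} :=
  [fset (i%:Z, j%:Z) | i in iota 1 n1, j in iota 1 n2]%fset.

Definition factor_map (A B : alphabetType) (X : set (config A))
    (Y : set (config B)) (phi : config A -> config B) : Prop :=
  [/\ is_subshift X, is_subshift Y,
      {within X, continuous phi},
      (forall t x, X x -> phi (shift t x) = shift t (phi x)) &
      phi @` X = Y].

Section Entropy.
Context (R : realType) {A : alphabetType}.
Implicit Types (X : set (config A)) (mu : probability (borel_config A) R).

(* The limit is the joint one, n1 and n2 tending to infinity independently. *)
Definition entropy X : R :=
  lim ((fun n : nat * nat =>
          (n.1%:R * n.2%:R)^-1 * ln #|language X (rect n.1 n.2)|%:R : R)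
       @ filter_prod \oo \oo).

(* Borel probability measures on X are represented by Borel probability
   measures on the full shift that give mass 1 to X. *)
Definition invariant_on X mu : Prop :=
  mu X = 1%E /\
  forall t (E : set (borel_config A)), measurable E ->
    mu (shift t @^-1` E) = mu E.

(* The library has ln 0 = 0, so null cylinders contribute 0. *)
Definition measure_entropy X mu : R :=
  limn (fun N : nat =>
    (N%:R ^+ 2)^-1 *
    \sum_(w in language X (rect N N))
       - (fine (mu (cylinder X w)) * ln (fine (mu (cylinder X w)))) : R).

Definition max_entropy_measure X mu : Prop :=
  invariant_on X mu /\ measure_entropy X mu = entropy X.

(* Uniqueness is equality on Borel sets: the library's measures are functions
   on all sets, unconstrained on the nonmeasurable ones. *)
Definition intrinsically_ergodic X : Prop :=
  exists2 mu, max_entropy_measure X mu &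
    forall nu, max_entropy_measure X nu ->
      forall E : set (borel_config A), measurable E -> nu E = mu E.

End Entropy.

(* Main.v *)
(** A square of level 0 is a single cell, called a unit, and a square of level
    [n + 1] is a frame of width one around four squares of level [n].  Nearest
    neighbour rules force every unit to lie in a square of every level, and then
    at depth at least [n] in its square of level [n].  The layer of tiles has zero
    entropy; every unit carries in addition a free symbol among [q + 1], whence
    an entropy of at least [ln (q + 1) / 9].

    Let [phi] be a factor map of radius [r] onto [Y], and let [n] be large.
    Refilling the units of a square of level [n] changes the image only in a core
    of that square, and the set of possible contents of the core is the same for
    all squares.  Up to o(N^2) bits, an N-window of a point of [Y] is therefore an
    arbitrary choice of contents for at most [K] squares.  For a pattern [u] this
    bounds the sum of [exp (t * #occurrences of u)] over the N-windows by
    [Z(t) ^ K], where [Z] is the partition function of a single core, up to a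
    factor [exp (eps |t| N^2)] with [eps] tending to 0 as [n] grows.  Applying
    Gibbs' inequality to two measures of maximal entropy, with [t] and [-t], and
    dividing by [t N^2] shows that they give the same mass to [u]: positive entropy
    makes the set of contents nontrivial, and [ln Z(t) + ln Z(-t)] exceeds
    [2 ln Z(0)] by a term quadratic in [t]. *)
From HB Require Import structures.
Require Import Defs.
From mathcomp Require Import all_boot all_order all_algebra finmap.
From mathcomp Require Import all_classical all_reals all_analysis.
From mathcomp Require Import zify ring lra.

Set Implicit Arguments.
Unset Strict Implicit.
Unset Printing Implicit Defensive.

Import Order.TTheory GRing.Theory Num.Theory.
Import numFieldNormedType.Exports.

Local Open Scope classical_set_scope.
Local Open Scope ring_scope.

(** A factor may blur the tiles, so squares cannot be located in a point of [Y]. Points of [Y] are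
    therefore lifted to the system, and the window of the image is recovered from data on the lift:
    a code for the tiles, the symbols along the border, the contents of the squares in the window.
    Once [n >= 2 * r + 2], the image at a site of the window outside their cores reads no unit of
    these squares.

    The entropy of [Y] is never computed. With [K] the largest number of squares in a window,
    independence of the contents gives [K * ln Z(0) <= lnL], while Gibbs' inequality produces
    [K * (ln Z(t) + ln Z(-t))]; the main terms cancel against the two maximal entropies.

    The parameters are chosen in the order [n], [t], [N]. Large [n] makes the cores cover almost all
    positions. The quadratic error is at most [2 * t ^ 2 * core * N ^ 2], with [core] the number of
    positions in a core, so [t * core] must be small. The tiles and the border cost [o(N ^ 2)],
    which is made small against [t * N ^ 2]. *)

Local Notation shift := Defs.shift.

(** * Tiles and squares *)

(* A cell has a kind in each direction, recording whether it is the first, resp.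
   the last, of its square in that direction.  A tile consists of the horizontal
   kind, the vertical kind, and the role of the square whose frame contains the
   cell: whether that square is the right, resp. top, one among its siblings. *)
Definition kind : Type := (bool * bool)%type.
Definition tile : Type := (kind * kind * kind)%type.

Local Notation Lo := (true, false).
Local Notation Mid := (false, false).
Local Notation Hi := (false, true).
Local Notation One := (true, true).

(** The cell lies on the frame of its square, so it is not in the middle in both directions; a
    square has width one exactly when it has height one. *)
Definition tile_ok (t : tile) : bool :=
  ((t.1.1 == One) == (t.1.2 == One)) && (t.1 != (Mid, Mid)).

(* [t] may stand to the left of [u].  If [t] ends a square, then either it is a
   left square and [u] starts its right sibling at the same height, or it
   is a right square and [u] is on the right side of the parent.  If [t] is on the
   left side of a frame, then [u] starts a left child.  Otherwise both belong to
   the same horizontal side of a frame. *)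
Definition hok (t u : tile) : bool :=
  let: (kx, ky, (i, j)) := t in let: (kx', ky', (i', j')) := u in
  let inner' := (kx' == Hi) && (ky' == Mid) in
  if kx.2 then
    if kx'.1 then [&& ~~ i, i', j == j' & ky == ky'] else inner' && i
  else if (kx == Lo) && (ky == Mid) then kx'.1 && ~~ i'
  else [&& ~~ kx'.1, ~~ inner', (i, j) == (i', j'), ky == ky'
         & (kx, kx') != (Lo, Hi)].

(** The rules are invariant under transposition and under reflection of the first coordinate. This
    reduces columns to rows, and the four positions of a child in its parent to one. *)
Definition swap (p : kind) : kind := (p.2, p.1).
Definition tile_tr (t : tile) : tile := (t.1.2, t.1.1, swap t.2).
Definition tile_flip (t : tile) : tile := (swap t.1.1, t.1.2, (~~ t.2.1, t.2.2)).
Definition vok (t u : tile) : bool := hok (tile_tr t) (tile_tr u).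

Definition plane := int -> int -> tile.
Definition valid (s : plane) : Prop := forall x y,
  [/\ tile_ok (s x y), hok (s x y) (s (x + 1) y) & vok (s x y) (s x (y + 1))].

Definition plane_tr (s : plane) : plane := fun x y => tile_tr (s y x).
Definition plane_flip (s : plane) : plane := fun x y => tile_flip (s (- x) y).

Lemma tile_trK : involutive tile_tr. Proof. by case=> [[[? ?] [? ?]] [? ?]]. Qed.
Lemma tile_flipK : involutive tile_flip. Proof. by case=> [[[? ?] [? ?]] [[] ?]]. Qed.
Lemma hok_tile_flip t u : hok (tile_flip u) (tile_flip t) = hok t u.
Proof.
case: t => [[[a b] k] [i j]]; case: u => [[[a' b'] k'] [i' j']].
rewrite /hok /tile_flip /= !xpair_eqE (eq_sym k' k) (eq_sym j' j).
by case: a; case: b; case: a'; case: b'; case: i; case: i';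
   rewrite /= ?(andbF, andbT); case: (j == j'); case: (k == k');
   case: (k == _); case: (k' == _).
Qed.
Lemma vok_tile_flip t u : vok (tile_flip t) (tile_flip u) = vok t u.
Proof.
case: t => [[k [c e]] [i j]]; case: u => [[k' [c' e']] [i' j']].
rewrite /vok /hok /= !xpair_eqE (inj_eq negb_inj).
by case: k => [[] []]; case: k' => [[] []].
Qed.
Lemma tile_ok_tile_flip t : tile_ok (tile_flip t) = tile_ok t.
Proof. by case: t => [[[[] []] [[] []]] [i j]]. Qed.
Lemma tile_ok_tile_tr t : tile_ok (tile_tr t) = tile_ok t.
Proof. by case: t => [[[[] []] [[] []]] [i j]]. Qed.

Lemma valid_plane_tr s : valid s -> valid (plane_tr s).
Proof.
move=> vs x y; have [h1 h2 h3] := vs y x.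
by rewrite /plane_tr tile_ok_tile_tr /vok !tile_trK.
Qed.
Lemma valid_plane_flip s : valid s -> valid (plane_flip s).
Proof.
move=> vs x y; have [h1 _ h3] := vs (- x) y; have [_ h2 _] := vs (- (x + 1)) y.
rewrite /plane_flip tile_ok_tile_flip vok_tile_flip hok_tile_flip; split=> //.
by move: h2; have -> : - (x + 1) + 1 = - x by lia.
Qed.

(** This and the following lemmas invert [hok] branch by branch: leaving a left child, leaving a
    right child, entering a frame, moving along a side. The primed versions start from the
    right-hand cell. *)
Lemma hok_out0 t u : hok t u -> t.1.1.2 -> t.2.1 = false ->
  [/\ u.1.1.1, u.1.2 = t.1.2 & u.2 = (true, t.2.2)].
Proof.
case: t u => [[[a b] [c e]] [i j]] [[[a' b'] [c' e']] [i' j']] /= h hb hi.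
rewrite hb hi /= in h; case: a' h => /=; last by rewrite andbF.
by move=> /and3P[-> /eqP -> /eqP[-> ->]].
Qed.
Lemma hok_out1 t u : hok t u -> t.1.1.2 -> t.2.1 -> u.1 = (Hi, Mid).
Proof.
case: t u => [[[a b] [c e]] [i j]] [[[a' b'] [c' e']] [i' j']] /= h hb hi.
rewrite hb hi /= in h; case: a' h => //=; rewrite andbT.
by case/andP => /eqP[->] /eqP[-> ->].
Qed.
Lemma hok_in t u : hok t u -> t.1 = (Lo, Mid) -> u.1.1.1 /\ u.2.1 = false.
Proof.
case: t u => [[[a b] [c e]] [i j]] [[[a' b'] [c' e']] [i' j']] /= h.
by case=> ????; subst; move: h => /= /andP[-> /negbTE].
Qed.
Lemma hok_along t u : hok t u -> t.1.1.2 = false -> t.1 <> (Lo, Mid) ->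
  [/\ u.1.1.1 = false, u.1 <> (Hi, Mid), u.1.2 = t.1.2, u.2 = t.2
    & (t.1.1, u.1.1) <> (Lo, Hi)].
Proof.
case: t u => [[[a b] [c e]] [i j]] [[[a' b'] [c' e']] [i' j']] /= h hb hn.
rewrite hb /= in h; subst b.
have nq : ((a, false) == Lo) && ((c, e) == Mid) = false.
  by apply/andP => -[/eqP e1 /eqP e2]; case: hn; rewrite e1 e2.
rewrite nq in h.
case/and5P: h => /negbTE -> /negP n1 /eqP -> /eqP -> /eqP n2; split=> //.
by case=> *; subst; case: n1.
Qed.
Lemma hok_out0' t u : hok t u -> u.1.1.1 -> u.2.1 = false -> t.1 = (Lo, Mid).
Proof.
case: t u => [[[a b] [c e]] [i j]] [[[a' b'] [c' e']] [i' j']] /= h hb hi.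
subst; case: b h => /=; first by rewrite hb /= andbF.
by case: ifP => [/andP[/eqP -> /eqP ->] //|_]; rewrite hb.
Qed.
Lemma hok_along' t u : hok t u -> u.1.1.1 = false -> u.1 <> (Hi, Mid) ->
  [/\ t.1.1.2 = false, t.1 <> (Lo, Mid), t.1.2 = u.1.2, t.2 = u.2
    & (t.1.1, u.1.1) <> (Lo, Hi)].
Proof.
move=> h ha hn; have hb : t.1.1.2 = false.
  case: t u ha hn h => [[[a b] [c e]] [i j]] [[[a' b'] [c' e']] [i' j']] /= -> hn.
  case: b => //= /andP[/andP[/eqP e1 /eqP e2] _].
  by case: hn; rewrite e1 e2.
have hn' : t.1 <> (Lo, Mid).
  by move=> ht; have [] := hok_in h ht; rewrite ha.
by have [] := hok_along h hb hn'.
Qed.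

(** Equal to [3 * 2 ^ k - 2]: a square of level [k] has [4 ^ k] units in at most [9 * 4 ^ k] cells,
    which is the origin of the factor [9]. *)
Fixpoint side (k : nat) : int := if k is k'.+1 then 2 * side k' + 2 else 1.

Definition kind_at (x w x' : int) : kind := (x' == x, x' == x + w - 1).

Definition row (s : plane) x y w (r : kind) : Prop :=
  forall x', x <= x' < x + w -> s x' y = (kind_at x w x', kind_at y w y, r).

Definition frame (s : plane) x y w (r : kind) : Prop :=
  forall x' y', x <= x' < x + w -> y <= y' < y + w ->
    [|| x' == x, x' == x + w - 1, y' == y | y' == y + w - 1] ->
    s x' y' = (kind_at x w x', kind_at y w y', r).

Fixpoint square (s : plane) k x y r : Prop :=
  frame s x y (side k) r /\
  if k is k'.+1 then
    forall i j : bool, square s k' (x + 1 + (if i then side k' else 0))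
                                   (y + 1 + (if j then side k' else 0)) (i, j)
  else True.

Lemma side_gt0 k : 1 <= side k. Proof. by elim: k => //= k; lia. Qed.
Lemma side_inj : injective side.
Proof.
elim=> [|k IH] [|l] //=; first by have := side_gt0 l; lia.
  by have := side_gt0 k; lia.
by move=> h; congr S; apply: IH; lia.
Qed.
Lemma side_lt k l : (k < l)%N -> side k < side l.
Proof.
elim: l => // l IH; rewrite ltnS leq_eqVlt => /orP[/eqP -> /=|/IH /=].
  by have := side_gt0 l; lia.
by have := side_gt0 l; lia.
Qed.

Lemma kind_at_Lo x w x' : 2 <= w -> x' = x -> kind_at x w x' = Lo.
Proof. by move=> ? ->; rewrite /kind_at; congr (_, _); lia. Qed.
Lemma kind_at_Hi x w x' : 2 <= w -> x' = x + w - 1 -> kind_at x w x' = Hi.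
Proof. by move=> ? ->; rewrite /kind_at; congr (_, _); lia. Qed.
Lemma kind_at_Mid x w x' : x < x' < x + w - 1 -> kind_at x w x' = Mid.
Proof. by move=> ?; rewrite /kind_at; congr (_, _); lia. Qed.
Lemma kind_at_One x x' : x' = x -> kind_at x 1 x' = One.
Proof. by move=> ->; rewrite /kind_at; congr (_, _); lia. Qed.

Section Vok.
Variables t u : tile.
Hypothesis h : vok t u.
Lemma swap_inj : injective swap. Proof. by case=> [[] []] [[] []]. Qed.
Lemma vok_out0 : t.1.2.2 -> t.2.2 = false ->
  [/\ u.1.2.1, u.1.1 = t.1.1 & u.2 = (t.2.1, true)].
Proof.
move=> h1 h2; have [e1 e2 e3] := hok_out0 h h1 h2.
by split=> //; apply: swap_inj; exact: e3.
Qed.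
Lemma vok_out1 : t.1.2.2 -> t.2.2 -> u.1 = (Mid, Hi).
Proof. by move=> h1 h2; have := hok_out1 h h1 h2; case: (u) => [[? ?] ?] [-> ->]. Qed.
Lemma vok_in : t.1 = (Mid, Lo) -> u.1.2.1 /\ u.2.2 = false.
Proof. by move=> e; have := hok_in h; rewrite /= e; apply. Qed.
Lemma vok_along : t.1.2.2 = false -> t.1 <> (Mid, Lo) ->
  [/\ u.1.2.1 = false, u.1 <> (Mid, Hi), u.1.1 = t.1.1, u.2 = t.2
    & (t.1.2, u.1.2) <> (Lo, Hi)].
Proof.
move=> h1 h2; have [|e1 e2 e3 e4 e5] := hok_along h h1.
  by move=> e; apply: h2; case: (t) e => [[? ?] ?] /= [-> ->].
split=> //; last by apply: swap_inj.
by move=> e; apply: e2; rewrite /= e.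
Qed.
Lemma vok_out0' : u.1.2.1 -> u.2.2 = false -> t.1 = (Mid, Lo).
Proof. by move=> h1 h2; have := hok_out0' h h1 h2; case: (t) => [[? ?] ?] [-> ->]. Qed.
End Vok.

Section Valid.
Variables (s : plane) (vs : valid s).

Lemma valid_hok x y x' : x' = x + 1 -> hok (s x y) (s x' y).
Proof. by move=> ->; case: (vs x y). Qed.
Lemma valid_vok x y y' : y' = y + 1 -> vok (s x y) (s x y').
Proof. by move=> ->; case: (vs x y). Qed.
Lemma valid_tile_ok x y : tile_ok (s x y). Proof. by case: (vs x y). Qed.

(** The first end met from [x] on closes the run; up to there the rules hand on the vertical kind
    and the role. *)
Lemma horizontal_run x y N : (s x y).1.1.1 -> (s x y).1 <> (Lo, Mid) -> 0 <= N ->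
  (s (x + N) y).1.1.2 -> exists w, 1 <= w <= N + 1 /\
  forall x', x <= x' < x + w -> s x' y = (kind_at x w x', (s x y).1.2, (s x y).2).
Proof.
move=> h1 h2 N0 hN.
have ex : exists n : nat, (s (x + n%:Z) y).1.1.2.
  by exists `|N|%N; have -> : `|N|%N%:Z = N by lia.
case: (ex_minnP ex) => n hn hmin.
have nN : (n%:Z <= N).
  have := hmin `|N|%N; have -> : `|N|%N%:Z = N by lia.
  by move/(_ hN); lia.
have hlt (a : nat) : (a < n)%N -> (s (x + a%:Z) y).1.1.2 = false.
  by move=> an; apply/negP => /hmin; lia.
have key (a : nat) : (a <= n)%N ->
    s (x + a%:Z) y = (((a == 0)%N, (a == n)%N), (s x y).1.2, (s x y).2).
  elim: a => [|a IH] an.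
    rewrite addr0; case E: (s x y) h1 => [[[p q] k] r] /= ->.
    congr (((_, _), _), _); case: (posnP n) => n0.
      by have := hn; rewrite n0 addr0 E /= => ->.
    by have := hlt _ n0; rewrite addr0 E /= => ->; lia.
  have {}IH := IH (ltnW an).
  have hh : hok (s (x + a%:Z) y) (s (x + a.+1%:Z) y) by apply: valid_hok; lia.
  have [] := hok_along hh (hlt _ an).
    rewrite IH /=; case: (posnP a) => a0.
      move: h2; have := hlt a an; rewrite a0 addr0.
      case E: (s x y) h1 => [[[p q] k] r] /= -> -> h2.
      by have -> : (0 == n)%N = false by lia.
    by [].
  move=> e1 _; rewrite IH /= => e2 e3 _.
  case E: (s _ y) e1 e2 e3 => [[[p q] k] r] /= -> -> ->.
  congr (((_, _), _), _).
  case: (ltngtP a.+1 n) an => // [an _|an _].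
    by have := hlt _ an; rewrite E.
  by have := hn; rewrite -an E.
exists (n%:Z + 1); split; first lia.
move=> x' hx'; have := key `|x' - x|%N.
have -> : x + `|x' - x|%N = x' by lia.
move=> -> //; last by lia.
by rewrite /kind_at; congr (((_, _), _), _); lia.
Qed.

(** The vertical kind along the run is [Lo] or [One], and [tile_ok] makes it [One] exactly when the
    run has width one, in agreement with [kind_at y w y]. *)
Lemma start_row x y N r : (s x y).1.1.1 -> (s x y).1.2.1 -> (s x y).2 = r ->
  0 <= N -> (s (x + N) y).1.1.2 -> exists w, 1 <= w <= N + 1 /\ row s x y w r.
Proof.
move=> h1 h2 <- N0 /(horizontal_run h1) [] //; first by move=> e; rewrite e in h2.
move=> w [wN hw]; exists w; split=> // x' hx'; rewrite hw //.
congr (_, _, _).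
have := hw x; case E: (s x y) h1 h2 (valid_tile_ok x y) => [[[p q] [a b]] c] /= -> ->.
move=> ht hx; have /hx[hx1 hq] : x <= x < x + w by lia.
move: ht; rewrite /tile_ok /= !xpair_eqE /= andbT /kind_at.
have -> : (y == y + w - 1) = (x == x + w - 1) by lia.
by rewrite -hq eqxx; case: q {E hx hq} => /=; case: b => //.
Qed.

Lemma square_frame k x y r : square s k x y r -> frame s x y (side k) r.
Proof. by case: k => [|k] []. Qed.

Lemma hchain x y x' : x <= x' ->
  (forall z, x <= z < x' -> (s z y).1.1.2 = false /\ (s z y).1 <> (Lo, Mid)) ->
  (s x' y).2 = (s x y).2.
Proof.
move=> le; have -> : x' = x + `|x' - x|%N by lia.
elim: `|_|%N => [|n IH] h; first by rewrite addr0.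
rewrite -IH; last by move=> z hz; apply: h; lia.
have [h1 h2] := h (x + n%:Z) ltac:(lia).
by have [] := hok_along (valid_hok y (_ : x + n.+1%:Z = x + n%:Z + 1)) h1 h2; first lia.
Qed.

Lemma vchain x y y' : y <= y' ->
  (forall z, y <= z < y' -> (s x z).1.2.2 = false /\ (s x z).1 <> (Mid, Lo)) ->
  (s x y').2 = (s x y).2.
Proof.
move=> le; have -> : y' = y + `|y' - y|%N by lia.
elim: `|_|%N => [|n IH] h; first by rewrite addr0.
rewrite -IH; last by move=> z hz; apply: h; lia.
have [h1 h2] := h (y + n%:Z) ltac:(lia).
by have [] := vok_along (valid_vok x (_ : y + n.+1%:Z = y + n%:Z + 1)) h1 h2; first lia.
Qed.

(** Going up out of a bottom child preserves the horizontal kinds, so the upper sibling begins with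
    a row of the same width. *)
Lemma top_row k x y i : square s k x y (i, false) ->
  row s x (y + side k) (side k) (i, true).
Proof.
move=> /square_frame r x' hx; have s0 := side_gt0 k.
have h := r x' (y + side k - 1) ltac:(lia) ltac:(lia) ltac:(lia).
have [] := vok_out0 (valid_vok x' (_ : y + side k = y + side k - 1 + 1)).
- lia.
- by rewrite h /kind_at /=; lia.
- by rewrite h.
rewrite h; case: (s _ _) (valid_tile_ok x' (y + side k)) => [[p [a b]] c] /= ht ha hp ->.
move: ht; rewrite hp ha /tile_ok /kind_at !xpair_eqE /= => ht.
have -> : b = (side k == 1).
  by move: ht; case: b => /=; case: (x' =P x) => e1;
     case: (x' =P x + side k - 1) => e2 //= _; symmetry; apply/eqP; lia.
by congr (_, _, _); congr (_, _); lia.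
Qed.

(* In the row above a bottom side, two children start; by induction on the width
   they are squares of equal level filling the row, and they force their upper
   siblings. *)
Lemma row_square w x y r : 1 <= w -> row s x y w r ->
  exists k, w = side k /\ square s k x y r.
Proof.
have [n] : exists n : nat, w <= n%:Z by exists `|w|%N; lia.
elim: n w x y r => [|n IH] w x y r wn w1 hrow; first lia.
have [w_1|w_2] : w = 1 \/ w >= 2 by lia.
  subst w; exists 0%N; split=> //; split=> //= x' y' hx hy _.
  have -> : y' = y by lia.
  exact: hrow.
pose X := x + w - 1.
have sxy : s x y = (Lo, Lo, r) by rewrite hrow ?kind_at_Lo //; lia.
have sX : s X y = (Hi, Lo, r) by rewrite hrow ?(@kind_at_Lo y) ?(@kind_at_Hi x) //; lia.
(* The last clause of [hok] forbids [Lo] directly followed by [Hi]. *)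
have {w_2} w_3 : w >= 3.
  suff : w <> 2 by lia.
  move=> w2; have := valid_hok (x:=x) y (x':=X); rewrite sxy sX.
  by move/(_ ltac:(lia)) => /hok_along [].
have B x' : x < x' < X -> s x' y = (Mid, Lo, r).
  by move=> hx; rewrite hrow ?(@kind_at_Lo y) ?(@kind_at_Mid x) //; lia.
have A x' : x < x' < X -> (s x' (y + 1)).1.2.1 /\ (s x' (y + 1)).2.2 = false.
  by move=> hx; apply: (vok_in (valid_vok x' (erefl (y + 1)))); rewrite B.
have sL : s x (y + 1) = (Lo, Mid, r).
  have := vok_along (valid_vok x (erefl (y + 1))); rewrite sxy => -[] //.
  case: (s x _) => [[? [? b]] ?] /= -> _ -> -> hb.
  by case: b hb.
have sR : s X (y + 1) = (Hi, Mid, r).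
  have := vok_along (valid_vok X (erefl (y + 1))); rewrite sX => -[] //.
  case: (s X _) => [[? [? b]] ?] /= -> _ -> -> hb.
  by case: b hb.
have endX : (s (X - 1) (y + 1)).1.1.2.
  apply: contraT => /negbTE e.
  have [] := hok_along (valid_hok (x:=X-1) (y + 1) (x':=X) ltac:(lia)) e.
    by have [] := A (X - 1) ltac:(lia); case: (s _ _) => [[? ?] ?] /= ? _ [] *; subst.
  by rewrite sR.
have [c1 c1i] := hok_in (valid_hok (y + 1) (erefl (x + 1))) (congr1 fst sL).
have [c1y c1j] := A (x + 1) ltac:(lia).
have [] := @start_row (x + 1) (y + 1) (w - 3) (false, false) c1 c1y.
- by case: (s _ _) c1i c1j => [? [? ?]] /= -> ->.
- lia.
- by have -> : x + 1 + (w - 3) = X - 1 by lia.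
move=> w1' [hw1 row1].
have [k1 [ek1 sq1]] := IH w1' _ _ _ ltac:(lia) ltac:(lia) row1.
have e1 := row1 (x + w1') ltac:(lia).
have ky1 : kind_at (y + 1) w1' (y + 1) <> Mid by rewrite /kind_at eqxx.
have [||d1 d2 d3] := hok_out0 (valid_hok (y + 1) (erefl (x + w1' + 1))).
- by rewrite e1 /kind_at /=; lia.
- by rewrite e1.
have ltX : x + w1' + 1 < X.
  suff : x + w1' + 1 <> X by lia.
  by move=> e; move: d1; rewrite e sR.
have [d4 _] := A (x + w1' + 1) ltac:(lia).
rewrite e1 /= in d3.
have [] := @start_row (x + w1' + 1) (y + 1) (w - 3 - w1') (true, false) d1 d4 d3.
- lia.
- by have -> : x + w1' + 1 + (w - 3 - w1') = X - 1 by lia.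
move=> w2' [hw2 row2].
have [k2 [ek2 sq2]] := IH w2' _ _ _ ltac:(lia) ltac:(lia) row2.
have e2 := row2 (x + w1' + w2') ltac:(lia).
(* A right child is followed by the right side of its parent, whose vertical kind is [Mid]; all
   cells strictly between the sides start a child vertically, so the second child ends at
   [X - 1]. *)
have w12 : w1' + w2' = w - 2.
  have e : (s (x + w1' + w2' + 1) (y + 1)).1 = (Hi, Mid).
    by apply: (hok_out1 (valid_hok (y + 1) (erefl _))); rewrite e2 //= /kind_at; lia.
  suff : ~ (x + w1' + w2' + 1 < X) by lia.
  move=> hX; have [] := A (x + w1' + w2' + 1) ltac:(lia).
  by rewrite e.
have r1 := square_frame sq1.
have r2 := square_frame sq2.
rewrite -ek1 in r1; rewrite -ek2 in r2.
(* Adjacent siblings have the same vertical kind in every row, so their tops are at the same height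
   and their widths coincide. *)
have kyE b : y + 1 <= b < y + 1 + w1' -> b < y + 1 + w2' ->
    kind_at (y + 1) w2' b = kind_at (y + 1) w1' b.
  move=> hb hb'.
  have h1 := r1 (x + w1') b ltac:(lia) ltac:(lia) ltac:(lia).
  have h2 := r2 (x + w1' + 1) b ltac:(lia) ltac:(lia) ltac:(lia).
  have [||_ + _] := hok_out0 (valid_hok b (erefl (x + w1' + 1))).
  - by rewrite h1 /kind_at /=; lia.
  - by rewrite h1.
  by rewrite h1 h2.
have w1E : w1' = w2'.
  suff : ~ (w1' < w2') /\ ~ (w2' < w1') by lia.
  split=> lt.
    by have := kyE (y + w1') ltac:(lia) ltac:(lia); rewrite /kind_at => /(congr1 snd) /= e; lia.
  by have := kyE (y + w2') ltac:(lia) ltac:(lia); rewrite /kind_at => /(congr1 snd) /= e; lia.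
have k2E : k2 = k1 by apply: side_inj; rewrite -ek2 -w1E.
subst k2 w2' w1'; pose v := side k1; rewrite -/v in row1 row2 r1 r2 hw1 hw2 c1 wn w_3 w12 *.
have v0 : 1 <= v by apply: side_gt0.
have [k3 [/side_inj <- {k3} sq3]] := IH v _ _ _ ltac:(lia) v0 (top_row sq1).
have [k4 [/side_inj <- {k4} sq4]] := IH v _ _ _ ltac:(lia) v0 (top_row sq2).
have r3 := square_frame sq3; have r4 := square_frame sq4.
exists k1.+1; split=> /=; first by rewrite -/v; lia.
rewrite -/v in r3 r4 sq3 sq4 *.
have wE : w = 2 * v + 2 by lia.
clear IH A endX c1 c1i c1y c1j e1 ky1 d1 d2 d3 d4 ltX e2 w12 kyE w1E.
split; last first.
  move=> [] []; [move: sq4|move: sq2|move: sq3|move: sq1]; rewrite ?addr0 //.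
  - by have -> : x + v + 1 = x + 1 + v by lia.
  - by have -> : x + v + 1 = x + 1 + v by lia.
(* The four children are in place. Every remaining cell of the frame except the corners touches a
   child, which forces its kinds; the role [r] then travels up both vertical sides and along the
   top. *)
have lft z : y + 1 <= z <= y + 2 * v -> (s x z).1 = (Lo, Mid).
  move=> hz; apply: (hok_out0' (valid_hok z (erefl (x + 1)))).
    have [h|h] : z < y + 1 + v \/ y + 1 + v <= z by lia.
      by rewrite r1 /kind_at //=; lia.
    by rewrite r3 /kind_at //=; lia.
  have [h|h] : z < y + 1 + v \/ y + 1 + v <= z by lia.
    by rewrite r1 //=; lia.
  by rewrite r3 //=; lia.
have rgt z : y + 1 <= z <= y + 2 * v -> (s X z).1 = (Hi, Mid).
  move=> hz; have XE : X = X - 1 + 1 by lia.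
  apply: (hok_out1 (valid_hok z XE)).
    have [h|h] : z < y + 1 + v \/ y + 1 + v <= z by lia.
      by rewrite r2 /kind_at //=; lia.
    by rewrite r4 /kind_at //=; lia.
  have [h|h] : z < y + 1 + v \/ y + 1 + v <= z by lia.
    by rewrite r2 //=; lia.
  by rewrite r4 //=; lia.
pose Y := y + w - 1.
have top z : x + 1 <= z <= x + 2 * v -> (s z Y).1 = (Mid, Hi).
  move=> hz; have YE : Y = Y - 1 + 1 by lia.
  apply: (vok_out1 (valid_vok z YE)).
    have [h|h] : z < x + 1 + v \/ x + 1 + v <= z by lia.
      by rewrite r3 /kind_at //=; lia.
    by rewrite r4 /kind_at //=; lia.
  have [h|h] : z < x + 1 + v \/ x + 1 + v <= z by lia.
    by rewrite r3 //=; lia.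
  by rewrite r4 //=; lia.
have lftr z : y <= z <= Y -> (s x z).2 = r.
  move=> hz; rewrite (@vchain x y z) ?sxy //; first lia.
  move=> z' hz'; have [->|h] : z' = y \/ y + 1 <= z' by lia.
    by rewrite sxy.
  by rewrite lft //; lia.
have rgtr z : y <= z <= Y -> (s X z).2 = r.
  move=> hz; rewrite (@vchain X y z) ?sX //; first lia.
  move=> z' hz'; have [->|h] : z' = y \/ y + 1 <= z' by lia.
    by rewrite sX.
  by rewrite rgt //; lia.
have sxY : s x Y = (Lo, Hi, r).
  have YE : Y = Y - 1 + 1 by lia.
  have [||_ _ eL _ _] := vok_along (valid_vok x YE).
  - by rewrite lft //; lia.
  - by rewrite lft //; lia.
  have [||_ _ eH _ _] := hok_along' (valid_hok Y (erefl (x + 1))).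
  - by rewrite top //; lia.
  - by rewrite top //; lia.
  rewrite (lft (Y - 1)) /= in eL; last lia.
  rewrite (top (x + 1)) /= in eH; last lia.
  have := lftr Y ltac:(lia).
  by case: (s x Y) eL eH => [[? ?] ?] /= -> -> ->.
have topr z : x <= z <= X -> (s z Y).2 = r.
  move=> hz; rewrite (@hchain x Y z) ?sxY //; first lia.
  move=> z' hz'; have [->|h] : z' = x \/ x + 1 <= z' by lia.
    by rewrite sxY.
  by rewrite top //; lia.
have sXY : s X Y = (Hi, Hi, r).
  have YE : Y = Y - 1 + 1 by lia.
  have XE : X = X - 1 + 1 by lia.
  have [||_ _ eL _ _] := vok_along (valid_vok X YE).
  - by rewrite rgt //; lia.
  - by rewrite rgt //; lia.
  have [||_ _ eH _ _] := hok_along (valid_hok Y XE).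
  - by rewrite top //; lia.
  - by rewrite top //; lia.
  rewrite (rgt (Y - 1)) /= in eL; last lia.
  rewrite (top (X - 1)) /= in eH; last lia.
  have := rgtr Y ltac:(lia).
  by case: (s X Y) eL eH => [[? ?] ?] /= -> -> ->.
move=> x' y'; rewrite -wE => hx hy hb.
have [->|[->|hy']] : y' = y \/ y' = Y \/ y < y' < Y by lia.
- have [->|[->|hx']] : x' = x \/ x' = X \/ x < x' < X by lia.
  + by rewrite sxy !kind_at_Lo //; lia.
  + by rewrite sX (@kind_at_Hi x) ?(@kind_at_Lo y) //; lia.
  + by rewrite B // (@kind_at_Mid x) ?(@kind_at_Lo y) //; lia.
- have [->|[->|hx']] : x' = x \/ x' = X \/ x < x' < X by lia.
  + by rewrite sxY (@kind_at_Lo x) ?(@kind_at_Hi y) //; lia.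
  + by rewrite sXY !kind_at_Hi //; lia.
  + rewrite (@kind_at_Mid x) ?(@kind_at_Hi y) //; try lia.
    by have := topr x' ltac:(lia); have := top x' ltac:(lia);
       case: (s x' Y) => [? ?] /= -> ->.
- have [->|->] : x' = x \/ x' = X by lia.
  + rewrite (@kind_at_Lo x) ?(@kind_at_Mid y) //; try lia.
    by have := lftr y' ltac:(lia); have := lft y' ltac:(lia);
       case: (s x y') => [? ?] /= -> ->.
  + rewrite (@kind_at_Hi x) ?(@kind_at_Mid y) //; try lia.
    by have := rgtr y' ltac:(lia); have := rgt y' ltac:(lia);
       case: (s X y') => [? ?] /= -> ->.
Qed.
End Valid.

Lemma plane_trK s : plane_tr (plane_tr s) = s.
Proof. by apply/funext => x; apply/funext => y; rewrite /plane_tr tile_trK. Qed.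
Lemma plane_flipK s : plane_flip (plane_flip s) = s.
Proof. by apply/funext => x; apply/funext => y; rewrite /plane_flip tile_flipK opprK. Qed.

Lemma square_plane_tr s k x y r : square s k x y r -> square (plane_tr s) k y x (swap r).
Proof.
elim: k x y r => [|k IH] x y r [hr hq]; split.
- by move=> x' y' hx hy hb; rewrite /plane_tr hr //; move: hb; rewrite orbC; lia.
- by [].
- by move=> x' y' hx hy hb; rewrite /plane_tr hr //; move: hb; lia.
- by move=> i j; apply: (IH _ _ _ (hq j i)).
Qed.

Lemma frame_plane_flip s x y w r : frame s x y w r ->
  frame (plane_flip s) (1 - x - w) y w (~~ r.1, r.2).
Proof.
move=> hr x' y' hx hy hb; rewrite /plane_flip hr; [|lia|lia|move: hb; lia].
by rewrite /tile_flip /kind_at /=; congr (_, _, _, _); rewrite /=; lia.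
Qed.

Lemma square_plane_flip s k x y r : square s k x y r ->
  square (plane_flip s) k (1 - x - side k) y (~~ r.1, r.2).
Proof.
elim: k x y r => [|k IH] x y r [/frame_plane_flip hr hq]; split=> // i j.
have := IH _ _ _ (hq (~~ i) j); rewrite negbK.
by congr square; case: i => /=; lia.
Qed.

Section Valid.
Variables (s : plane) (vs : valid s).

Lemma col_square w x y r : 1 <= w ->
  (forall y', y <= y' < y + w -> s x y' = (kind_at x w x, kind_at y w y', r)) ->
  exists k, w = side k /\ square s k x y r.
Proof.
move=> w1 h; have [] := @row_square _ (valid_plane_tr vs) w y x (swap r) w1.
  by move=> x' hx; rewrite /plane_tr h.
move=> k [-> sq]; exists k; split=> //.
by have := square_plane_tr sq; rewrite plane_trK; case: (r).
Qed.
End Valid.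

(* The tiles below the square and below its right sibling form the bottom side of
   the parent, which determines the parent by [row_square]. *)
Lemma parent00 s k x y : valid s -> square s k x y (false, false) ->
  exists r, square s k.+1 (x - 1) (y - 1) r.
Proof.
move=> vs sq; have r1 := square_frame sq; have k0 := side_gt0 k.
set v := side k in r1 k0.
pose X := x - 1; pose Y := y - 1.
have xE : x = X + 1 by lia.
have yE : y = Y + 1 by lia.
have lft z : y <= z < y + v -> (s X z).1 = (Lo, Mid).
  move=> hz; apply: (hok_out0' (valid_hok vs z xE)); rewrite r1 //; try lia.
  by rewrite /kind_at /=; lia.
have bot z : x <= z < x + v -> (s z Y).1 = (Mid, Lo).
  move=> hz; apply: (vok_out0' (valid_vok vs z yE)); rewrite r1 //; try lia.
  by rewrite /kind_at /=; lia.
(* The cell continues the bottom side to the left. Were it in the middle of that side, the cell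
   above it would start a child vertically, but that cell is [(Lo, Mid)]. *)
have [sXY sXYr] : (s X Y).1 = (Lo, Lo) /\ (s X Y).2 = (s x Y).2.
  have [||e1 e2 e3 e4 _] := hok_along' (valid_hok vs Y xE).
  - by rewrite bot //; lia.
  - by rewrite bot //; lia.
  split=> //; rewrite (bot x) /= in e3; last lia.
  have := valid_vok vs X yE.
  have := lft y ltac:(lia).
  case: (s X y) => [[? ?] u] /= [-> ->].
  case: (s X Y) e1 e2 e3 {e4} => [[[a b] k'] t] /= -> e2 e3; rewrite e3.
  rewrite /vok /hok /= /tile_tr /=; case: t => t1 t2; case: u => u1 u2 /=.
  by case: a {e2 e3}; rewrite ?andbF.
set r := (s x Y).2 in sXYr; exists r.
(* The right sibling copies the vertical kinds along the common boundary; [col_square] turns this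
   column into a square of the same level. *)
have nxt b : y <= b < y + v -> s (x + v) b = (kind_at (x + v) v (x + v), kind_at y v b, (true, false)).
  move=> hb; have h := r1 (x + v - 1) b ltac:(lia) ltac:(lia) ltac:(lia).
  have xv : x + v = x + v - 1 + 1 by lia.
  have [||] := hok_out0 (valid_hok vs b xv).
  - by rewrite h /kind_at /=; lia.
  - by rewrite h.
  rewrite h /=.
  case: (s _ _) (valid_tile_ok vs (x + v) b) => [[[a b'] k'] t] /= ht ha hk ->.
  move: ht; rewrite ha hk /tile_ok /= /kind_at !xpair_eqE /= => ht.
  congr (_, _, _, _); first by lia.
  by move: ht; case: b' => /=; case: (b =P y) => e1;
     case: (b =P y + v - 1) => e2 //= _; symmetry; apply/eqP; lia.
have [k2 [/side_inj <- sq2]] := col_square vs k0 nxt.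
have r2 := square_frame sq2; rewrite -/v in r2.
have bot2 z : x + v <= z < x + v + v -> (s z Y).1 = (Mid, Lo).
  move=> hz; apply: (vok_out0' (valid_vok vs z yE)); rewrite r2 //; try lia.
  by rewrite /kind_at /=; lia.
have botr z : x <= z <= x + v + v -> (s z Y).2 = r.
  move=> hz; rewrite (@hchain _ vs x Y z) //; first lia.
  move=> z' hz'; have [h|h] : x + v <= z' \/ z' < x + v by lia.
    by rewrite bot2 //; lia.
  by rewrite bot //; lia.
have XE : x + v + v = x + v + v - 1 + 1 by lia.
have sR : (s (x + v + v) y).1 = (Hi, Mid).
  by apply: (hok_out1 (valid_hok vs y XE)); rewrite r2 //; try lia; rewrite /kind_at /=; lia.
have sRY : (s (x + v + v) Y).1 = (Hi, Lo).
  have [||e1 e2 e3 e4 _] := hok_along (valid_hok vs Y XE).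
  - by rewrite bot2 //; lia.
  - by rewrite bot2 //; lia.
  rewrite (bot2 (x + v + v - 1)) /= in e3; last lia.
  have := valid_vok vs (x + v + v) yE; move: sR.
  case: (s (x + v + v) y) => [[? ?] u] /= [-> ->].
  case: (s _ Y) e1 e2 e3 {e4} => [[[a b] k'] t] /= -> e2 e3; rewrite e3.
  rewrite /vok /hok /= /tile_tr /=; case: t => t1 t2; case: u => u1 u2 /=.
  by case: b {e2 e3}; rewrite ?andbF.
have rw : row s X Y (2 * v + 2) r.
  move=> z hz; rewrite (@kind_at_Lo Y) //; last lia.
  have [->|[hz'|->]] : z = X \/ x <= z < x + v + v \/ z = x + v + v by lia.
  - by rewrite kind_at_Lo //; [case: (s X Y) sXY sXYr => [? ?] /= -> ->|lia].
  - rewrite kind_at_Mid //; last lia.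
    have := botr z ltac:(lia); have : (s z Y).1 = (Mid, Lo).
      have [h|h] : x + v <= z \/ z < x + v by lia.
        by rewrite bot2 //; lia.
      by rewrite bot //; lia.
    by case: (s z Y) => [? ?] /= -> ->.
  - rewrite kind_at_Hi //; [|lia|lia].
    by have := botr (x + v + v) ltac:(lia); case: (s _ Y) sRY => [? ?] /= -> ->.
have [k' [ek' sq']] := row_square vs (ltac:(lia) : 1 <= 2 * v + 2) rw.
by have <- : k' = k.+1 by apply: side_inj; rewrite -ek'.
Qed.

(** Reflections in either direction bring the square to the lower left position, which is the case
    of [parent00]. *)
Lemma parent s k x y r : valid s -> square s k x y r ->
  exists r', square s k.+1 (x - 1 - (if r.1 then side k else 0))
                           (y - 1 - (if r.2 then side k else 0)) r'.
Proof.
have P1 s' x' y' i : valid s' -> square s' k x' y' (i, false) ->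
    exists r', square s' k.+1 (x' - 1 - (if i then side k else 0)) (y' - 1) r'.
  case: i => vs sq; last by rewrite subr0; apply: parent00.
  have [r' sq'] := parent00 (valid_plane_flip vs) (square_plane_flip sq).
  exists (~~ r'.1, r'.2); have := square_plane_flip sq'; rewrite plane_flipK.
  by congr square => /=; lia.
case: r => i [] vs sq /=; last by rewrite subr0; apply: P1.
have sq1 := square_plane_tr (square_plane_flip (square_plane_tr sq)).
have [r' sq'] := P1 _ _ _ _ (valid_plane_tr (valid_plane_flip (valid_plane_tr vs))) sq1.
have := square_plane_tr (square_plane_flip (square_plane_tr sq')); rewrite plane_trK plane_flipK plane_trK => h.
exists (swap (~~ (swap r').1, (swap r').2)); move: h; congr square => /=; lia.
Qed.

(** * Ancestors, depth of units, disjointness of squares *)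

Definition is_unit (t : tile) : bool := t.1 == (One, One).

Lemma ancestor s k n x y r : valid s -> square s k x y r -> (k <= n)%N ->
  exists x0 y0 r', [/\ square s n x0 y0 r', x0 <= x, x + side k <= x0 + side n,
    y0 <= y & y + side k <= y0 + side n].
Proof.
move=> vs sq; elim: n => [|n IH]; first by rewrite leqn0 => /eqP <-; exists x, y, r.
rewrite leq_eqVlt => /orP[/eqP <-|/IH]; first by exists x, y, r.
move=> [x0 [y0 [r' [sq' h1 h2 h3 h4]]]].
have [r2 sq2] := parent vs sq'; have n0 := side_gt0 n.
by eexists; eexists; exists r2; split; [exact: sq2|..] => /=;
  case: (r') => [[] []] /=; lia.
Qed.

(** No tile of a frame of level at least one is [(One, One)], so the unit lies in a child, and each
    level adds one to its depth. *)
Lemma unit_depth s n x y r x' y' : square s n x y r ->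
  x <= x' < x + side n -> y <= y' < y + side n -> is_unit (s x' y') ->
  [/\ x + n%:Z <= x', x' < x + side n - n%:Z, y + n%:Z <= y'
    & y' < y + side n - n%:Z].
Proof.
elim: n x y r => [|n IH] x y r [hr hq] hx hy hu; first by split; lia.
have n0 := side_gt0 n.
have nb : ~~ [|| x' == x, x' == x + side n.+1 - 1, y' == y | y' == y + side n.+1 - 1].
  apply/negP => hb; move: hu; rewrite hr // /is_unit /= /kind_at.
  by move=> /eqP[]; rewrite /=; lia.
move: nb hx hy; rewrite /= => nb hx hy.
pose i := (x + 1 + side n <= x'); pose j := (y + 1 + side n <= y').
have [] := IH _ _ _ (hq i j) _ _ hu.
- by rewrite /i; case: ifP; lia.
- by rewrite /j; case: ifP; lia.
by rewrite /i /j; case: ifP; case: ifP => ? ? ? ? ? ?; split; lia.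
Qed.

(** If one frame is shifted to the right of the other and they overlap, a horizontal side of the
    right frame crosses the right side of the left one: the common cell would and would not end its
    side. For equal abscissas the same happens vertically. *)
Lemma frame_disjoint s w x y r x' y' r' : 2 <= w ->
  frame s x y w r -> frame s x' y' w r' ->
  x - w < x' < x + w -> y - w < y' < y + w -> x = x' /\ y = y'.
Proof.
have key x1 y1 r1 x2 y2 r2 : 2 <= w -> frame s x1 y1 w r1 -> frame s x2 y2 w r2 ->
    x1 < x2 < x1 + w -> y1 - w < y2 < y1 + w -> False.
  move=> w2 h1 h2 hx hy; pose Y := if y1 <= y2 then y2 else y2 + w - 1.
  have := h1 (x1 + w - 1) Y; have := h2 (x1 + w - 1) Y.
  move=> -> //; [|lia| |]; try by rewrite /Y; case: ifP; lia.
  move=> /(_ ltac:(lia)) h; have {h} := h ltac:(rewrite /Y; case: ifP; lia) ltac:(lia).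
  by move=> /(congr1 (fun t : tile => t.1.1.2)) /=; lia.
have key2 y1 r1 y2 r2 : 2 <= w -> frame s x y1 w r1 -> frame s x y2 w r2 ->
    y1 < y2 < y1 + w -> False.
  move=> w2 h1 h2 hy.
  have := h1 x (y1 + w - 1); have := h2 x (y1 + w - 1).
  move=> -> //; [|lia|lia|lia].
  move=> /(_ ltac:(lia)) h; have {h} := h ltac:(lia) ltac:(lia).
  by move=> /(congr1 (fun t : tile => t.1.2.2)) /=; lia.
move=> w2 h1 h2 hx hy.
have xE : x = x'.
  suff : ~ (x < x') /\ ~ (x' < x) by lia.
  split=> lt; first by apply: (key _ _ _ _ _ _ w2 h1 h2); lia.
  by apply: (key _ _ _ _ _ _ w2 h2 h1); lia.
split=> //; subst x'.
suff : ~ (y < y') /\ ~ (y' < y) by lia.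
split=> lt; first by apply: (key2 _ _ _ _ w2 h1 h2); lia.
by apply: (key2 _ _ _ _ w2 h2 h1); lia.
Qed.

Lemma square_disjoint s n x y r x' y' r' :
  square s n x y r -> square s n x' y' r' ->
  x - side n < x' < x + side n -> y - side n < y' < y + side n ->
  x = x' /\ y = y'.
Proof.
case: n => [|n] h1 h2 hx hy; first by move: hx hy => /=; lia.
apply: (frame_disjoint _ (square_frame h1) (square_frame h2)) => //=.
by have := side_gt0 n; lia.
Qed.

Lemma square_eq s s' n x y x' y' r a b :
  square s n x y r -> square s' n x' y' r ->
  0 <= a < side n -> 0 <= b < side n -> s (x + a) (y + b) = s' (x' + a) (y' + b).
Proof.
elim: n x y x' y' r a b => [|n IH] x y x' y' r a b [hr hq] [hr' hq'] ha hb.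
  rewrite hr ?hr' /=; try by move: ha hb => /=; lia.
  by rewrite /kind_at; congr (_, _, _); congr (_, _); move: ha hb => /=; lia.
have [hbd|nb] := boolP [|| a == 0, a == side n.+1 - 1, b == 0 | b == side n.+1 - 1].
  rewrite hr ?hr'; try by move: ha hb hbd => /=; lia.
  by rewrite /kind_at; congr (_, _, _); congr (_, _); lia.
move: nb ha hb; rewrite /= => nb ha hb; have n0 := side_gt0 n.
pose i := (1 + side n <= a); pose j := (1 + side n <= b).
pose a' := a - 1 - (if i then side n else 0).
pose b' := b - 1 - (if j then side n else 0).
have := IH _ _ _ _ _ a' b' (hq i j) (hq' i j).
rewrite /a' /b' /i /j => h.
have {h} := h ltac:(case: ifP; lia) ltac:(case: ifP; lia).
by congr (s _ _ = s' _ _); lia.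
Qed.

(** The role of a square is written only on its own frame, and the roles of its children are fixed
    by their positions. This is why all squares of one level admit the same contents. *)
Lemma square_eq_inner s s' n x y x' y' r r' a b :
  square s n x y r -> square s' n x' y' r' ->
  0 < a < side n - 1 -> 0 < b < side n - 1 -> s (x + a) (y + b) = s' (x' + a) (y' + b).
Proof.
case: n => [|n] [hr hq] [hr' hq'] /=; first lia.
move=> ha hb; have n0 := side_gt0 n.
pose i := (1 + side n <= a); pose j := (1 + side n <= b).
pose a' := a - 1 - (if i then side n else 0).
pose b' := b - 1 - (if j then side n else 0).
have := square_eq (a := a') (b := b') (hq i j) (hq' i j).
rewrite /a' /b' /i /j => h.
have {h} := h ltac:(case: ifP; lia) ltac:(case: ifP; lia).
by congr (s _ _ = s' _ _); lia.
Qed.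

Definition inside (s : plane) n x y : Prop := exists x0 y0 r,
  [/\ square s n x0 y0 r, x0 <= x < x0 + side n & y0 <= y < y0 + side n].

Lemma inside_plane_flip s n x y : inside (plane_flip s) n (- x) y -> inside s n x y.
Proof.
move=> [x0 [y0 [r [/square_plane_flip]]]]; rewrite plane_flipK => h h1 h2.
by eexists; eexists; eexists; split; [exact: h|lia|lia].
Qed.
Lemma inside_plane_tr s n x y : inside (plane_tr s) n y x -> inside s n x y.
Proof.
move=> [x0 [y0 [r [/square_plane_tr]]]]; rewrite plane_trK => h h1 h2.
by eexists; eexists; eexists; split; [exact: h|lia|lia].
Qed.

Lemma unit_inside s n x y : valid s -> is_unit (s x y) -> inside s n x y.
Proof.
move=> vs /eqP hu; have sq : square s 0 x y (s x y).2.
  split=> // x' y' /= hx hy _; have -> : x' = x by lia.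
  have -> : y' = y by lia.
  by rewrite !kind_at_One //; case: (s x y) hu => [? ?] /= ->.
have [x0 [y0 [r [h h1 h2 h3 h4]]]] := ancestor vs sq (leq0n n).
by exists x0, y0, r; split=> //; move: h2 h4 => /=; lia.
Qed.

(** If the run closes early it is a side of a square of level at most [n], which has an ancestor of
    level [n]; otherwise the run stays in the middle. Top sides are reduced to bottom sides by
    reflection. *)
Lemma start_cover s n x y : valid s -> (s x y).1.1.1 -> (s x y).1.2 <> Mid ->
  inside s n x y \/
  forall a, 0 < a < side n - 1 -> (s (x + a) y).1.1 = Mid.
Proof.
have key s' y' : valid s' -> (s' x y').1.1.1 -> (s' x y').1.2.1 ->
    inside s' n x y' \/ forall a, 0 < a < side n - 1 -> (s' (x + a) y').1.1 = Mid.
  move=> vs h1 h2.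
  have [[N hN]|nN] := pselect (exists N, 0 <= N < side n - 1 /\ (s' (x + N) y').1.1.2).
    left; have [w [hw hr]] := start_row vs h1 h2 (erefl _)
      (ltac:(lia) : 0 <= N) (proj2 hN).
    have [k [wk sq]] := row_square vs (ltac:(lia) : 1 <= w) hr.
    have kn : (k <= n)%N by case: ltnP => // /side_lt; lia.
    have k0 := side_gt0 k.
    have [x0 [y0 [r [sq' ? ? ? ?]]]] := ancestor vs sq kn.
    by exists x0, y0, r; split=> //; lia.
  right=> a ha.
  have hend (m : nat) : (m%:Z < side n - 1) -> (s' (x + m%:Z) y').1.1.2 = false.
    by move=> hm; apply/negP => h; apply: nN; exists m%:Z; split=> //; lia.
  have hky (m : nat) : (m%:Z < side n - 1) -> (s' (x + m%:Z) y').1.2.1 /\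
      ((0 < m)%N -> (s' (x + m%:Z) y').1.1.1 = false).
    elim: m => [|m IH] hm; first by rewrite addr0.
    have [IH1 IH2] := IH ltac:(lia).
    have [||e1 _ e3 _ _] := hok_along (valid_hok vs y' (ltac:(lia) : x + m.+1%:Z = x + m%:Z + 1)).
    - by apply: hend; lia.
    - by move=> e; move: IH1; rewrite e.
    by rewrite e3; split.
  have := hend `|a|%N; have := hky `|a|%N.
  have -> : `|a|%N%:Z = a by lia.
  move=> h3 h4; have {h3}[_ h3] := h3 ltac:(lia); have {}h3 := h3 ltac:(lia).
  have {h4} := h4 ltac:(lia); move: h3.
  by case: (s' _ _) => [[[? ?] ?] ?] /= -> ->.
move=> vs h1 h2; case E : (s x y).1.2 h2 => [[] b] h2; first by apply: key; rewrite ?E.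
case: b E h2 => // E _.
have vs' := valid_plane_tr (valid_plane_flip (valid_plane_tr vs)).
have [||/inside_plane_tr/inside_plane_flip/inside_plane_tr|h] := key _ (- y) vs'.
- by rewrite /plane_tr /plane_flip /plane_tr /= opprK.
- by rewrite /plane_tr /plane_flip /plane_tr /= opprK E.
- by left.
right=> a ha; have := h a ha.
by rewrite /plane_tr /plane_flip /plane_tr /= opprK.
Qed.

Lemma end_cover s n x y : valid s -> (s x y).1.1.2 -> (s x y).1.2 <> Mid ->
  inside s n x y \/
  forall a, 0 < a < side n - 1 -> (s (x - a) y).1.1 = Mid.
Proof.
move=> vs h1 h2.
have [|||h] := @start_cover (plane_flip s) n (- x) y (valid_plane_flip vs).
- by rewrite /plane_flip opprK.
- by rewrite /plane_flip opprK.
- by move=> /inside_plane_flip; left.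
right=> a ha; have := h a ha; rewrite /plane_flip opprD opprK /=.
by case: (s _ _) => [[[? ?] ?] ?] /= [-> ->].
Qed.

Lemma subsquares s k n x y r : square s n x y r -> (k <= n)%N ->
  exists l : seq (int * int), [/\ uniq l, size l = (4 ^ (n - k))%N &
    forall p, p \in l -> [/\ exists r', square s k p.1 p.2 r',
      x <= p.1, p.1 + side k <= x + side n, y <= p.2 & p.2 + side k <= y + side n]].
Proof.
elim: n x y r => [|n IH] x y r sq.
  rewrite leqn0 => /eqP ->; exists [:: (x, y)]; split=> // p.
  by rewrite inE => /eqP -> /=; split=> //; exists r.
rewrite leq_eqVlt => /orP[/eqP ->|].
  exists [:: (x, y)]; split; rewrite ?subnn // => p.
  by rewrite inE => /eqP -> /=; split=> //; exists r.
rewrite ltnS => kn; have n0 := side_gt0 n; have k0 := side_gt0 k.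
have [_ hq] := sq.
have [l1 [u1 z1 h1]] := IH _ _ _ (hq false false) kn.
have [l2 [u2 z2 h2]] := IH _ _ _ (hq false true) kn.
have [l3 [u3 z3 h3]] := IH _ _ _ (hq true false) kn.
have [l4 [u4 z4 h4]] := IH _ _ _ (hq true true) kn.
exists (l1 ++ l2 ++ l3 ++ l4); split.
- rewrite !cat_uniq u1 u2 u3 u4 !has_cat !negb_or /= !andbT.
  by repeat (apply/andP; split); apply/hasPn => p;
    (move=> /h2 + || move=> /h3 + || move=> /h4 +) => -[_ ? ? ? ?];
    apply/negP; (move=> /h1 + || move=> /h2 + || move=> /h3 +) => -[_ ? ? ? ?]; lia.
- by rewrite !size_cat z1 z2 z3 z4 subSn // expnS; lia.
- move=> p; rewrite !mem_cat => /or4P[/h1|/h2|/h3|/h4] [hp];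
    by move=> /= ? ? ? ?; split=> //; lia.
Qed.

(** * A point containing squares of all levels *)

Fixpoint square_tile k (r : kind) (a b : int) : tile :=
  if k is k'.+1 then
    if [|| a == 0, a == side k - 1, b == 0 | b == side k - 1] then
      (kind_at 0 (side k) a, kind_at 0 (side k) b, r)
    else let i := 1 + side k' <= a in let j := 1 + side k' <= b in
      square_tile k' (i, j) (a - 1 - (if i then side k' else 0))
                    (b - 1 - (if j then side k' else 0))
  else (kind_at 0 1 a, kind_at 0 1 b, r).

Lemma square_tile_bd k r a b : 0 <= a < side k -> 0 <= b < side k ->
  [|| a == 0, a == side k - 1, b == 0 | b == side k - 1] ->
  square_tile k r a b = (kind_at 0 (side k) a, kind_at 0 (side k) b, r).
Proof. by case: k => //= k ha hb ->. Qed.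

Lemma square_tile_square s k x y r :
  (forall a b, 0 <= a < side k -> 0 <= b < side k ->
     s (x + a) (y + b) = square_tile k r a b) -> square s k x y r.
Proof.
elim: k x y r => [|k IH] x y r h; split=> //.
- move=> x' y' hx hy hb; have := h (x' - x) (y' - y) ltac:(lia) ltac:(lia).
  rewrite !subrKC => ->; rewrite /=; move: hx hy hb => /= hx hy hb.
  by rewrite /kind_at; congr (_, _, _); congr (_, _); lia.
- move=> x' y' hx hy hb; have := h (x' - x) (y' - y) ltac:(lia) ltac:(lia).
  rewrite !subrKC => ->; rewrite square_tile_bd; try lia.
  by rewrite /kind_at; congr (_, _, _); congr (_, _); lia.
- move=> i j; apply: IH => a b ha hb; have k0 := side_gt0 k.
  set a' := 1 + (if i then side k else 0) + a.
  set b' := 1 + (if j then side k else 0) + b.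
  have := h a' b'; rewrite -/(square_tile k.+1 r a' b').
  have ha' : 0 < a' < side k.+1 - 1 by rewrite /a'; case: (i) => /=; lia.
  have hb' : 0 < b' < side k.+1 - 1 by rewrite /b'; case: (j) => /=; lia.
  move=> /(_ ltac:(lia) ltac:(lia)) /=.
  have -> : [|| a' == 0, a' == 2 * side k + 2 - 1, b' == 0 | b' == 2 * side k + 2 - 1] = false.
    by move: ha' hb' => /=; lia.
  have -> : (1 + side k <= a') = i by rewrite /a'; case: (i); lia.
  have -> : (1 + side k <= b') = j by rewrite /b'; case: (j); lia.
  have -> : a' - 1 - (if i then side k else 0) = a by rewrite /a'; lia.
  have -> : b' - 1 - (if j then side k else 0) = b by rewrite /b'; lia.
  by move=> <-; congr s; rewrite /a' /b'; lia.
Qed.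

Lemma square_tile_tile_tr k r a b : square_tile k (swap r) b a = tile_tr (square_tile k r a b).
Proof.
elim: k r a b => [|k IH] r a b //=.
have -> : [|| b == 0, b == 2 * side k + 2 - 1, a == 0 | a == 2 * side k + 2 - 1]
  = [|| a == 0, a == 2 * side k + 2 - 1, b == 0 | b == 2 * side k + 2 - 1].
  by do 4!case: eqP.
by case: ifP => // _; rewrite -IH.
Qed.

Lemma square_tile_ok k r a b : 0 <= a < side k -> 0 <= b < side k -> tile_ok (square_tile k r a b).
Proof.
elim: k r a b => [|k IH] r a b ha hb.
  have -> : a = 0 by move: ha => /=; lia.
  by have -> : b = 0 by move: hb => /=; lia.
rewrite /=; case: ifP => hbd; last first.
  by move: ha hb => /= ha hb; apply: IH; case: ifP; lia.
have k0 := side_gt0 k; move: ha hb => /= ha hb; move: hbd.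
rewrite /tile_ok /kind_at add0r /= !xpair_eqE /=.
case: (a =P 0) => e1; case: (a =P _ - 1) => e2; case: (b =P 0) => e3;
  case: (b =P _ - 1) => e4 //=; lia.
Qed.

Lemma square_tile_hok k r a b : 0 <= a < side k - 1 -> 0 <= b < side k ->
  hok (square_tile k r a b) (square_tile k r (a + 1) b).
Proof.
elim: k r a b => [|k IH] r a b ha hb; first by move: ha => /=; lia.
have k0 := side_gt0 k; have DE : side k.+1 = 2 * side k + 2 by [].
have [hbd|nb] := boolP ((b == 0) || (b == side k.+1 - 1)).
  rewrite (@square_tile_bd _ _ a) ?(@square_tile_bd _ _ (a + 1)); try lia.
  have -> : kind_at 0 (side k.+1) b = if b == 0 then Lo else Hi.
    have [e|e] : b = 0 \/ b = side k.+1 - 1 by lia.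
      by rewrite e eqxx kind_at_Lo //; lia.
    by rewrite ifF ?kind_at_Hi //; lia.
  have [->|a0] := eqVneq a 0.
    rewrite (@kind_at_Lo 0 _ 0) ?kind_at_Mid; try lia.
    by rewrite /hok /=; case: (b == 0); case: (r) => [[] []].
  rewrite (@kind_at_Mid 0 _ a); last lia.
  have [e|a1] := eqVneq (a + 1) (side k.+1 - 1).
    rewrite kind_at_Hi; try lia.
    by rewrite /hok /=; case: (b == 0); case: (r) => [[] []].
  rewrite kind_at_Mid; try lia.
  by rewrite /hok /=; case: (b == 0); case: (r) => [[] []].
have inner a1 : 0 < a1 < side k.+1 - 1 -> exists i j : bool, exists a2 b2,
    [/\ i = (1 + side k <= a1), j = (1 + side k <= b),
     a2 = a1 - 1 - (if i then side k else 0), b2 = b - 1 - (if j then side k else 0) &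
     square_tile k.+1 r a1 b = square_tile k (i, j) a2 b2].
  move=> h1; exists (1 + side k <= a1), (1 + side k <= b).
  eexists; eexists; split=> //.
  by rewrite [LHS]/= ifF //; lia.
have bpos : 0 < b < side k.+1 - 1 by lia.
have [a0|a0] := eqVneq a 0.
  have [i [j [a2 [b2 [ei ej ea eb ->]]]]] := inner (a + 1) ltac:(lia).
  rewrite square_tile_bd; try lia.
  rewrite (@kind_at_Lo 0 _ a); try lia.
  rewrite (@kind_at_Mid 0 _ b); try lia.
  have {ei} ei : i = false by lia.
  rewrite ei in ea *.
  rewrite square_tile_bd; [|lia|move: ej eb bpos; case: (j); lia|lia].
  rewrite /kind_at (_ : a2 == 0) /=; last by lia.
  by case: (r).
have [a1|a1] := eqVneq (a + 1) (side k.+1 - 1).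
  have [i [j [a2 [b2 [ei ej ea eb ->]]]]] := inner a ltac:(lia).
  rewrite (@square_tile_bd k.+1); try lia.
  rewrite (@kind_at_Hi 0 _ (a + 1)); try lia.
  rewrite (@kind_at_Mid 0 _ b); try lia.
  have {ei} ei : i by lia.
  rewrite ei in ea *.
  have ea2 : a2 = side k - 1 by lia.
  rewrite square_tile_bd; [|lia|move: ej eb bpos; case: (j); lia|lia].
  rewrite /kind_at (_ : a2 == 0 + side k - 1) /=; last by lia.
  by case: (r).
have [i [j [a2 [b2 [ei ej ea eb ->]]]]] := inner a ltac:(lia).
have [i' [j' [a2' [b2' [ei' ej' ea' eb' ->]]]]] := inner (a + 1) ltac:(lia).
have ejj : j' = j by lia.
rewrite ejj in eb' *; have ebb : b2' = b2 by rewrite eb' eb.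
rewrite ebb.
have hb2 : 0 <= b2 < side k by move: ej eb bpos; case: (j); lia.
have [e|ne] := eqVneq a (side k).
  have ii : i = false by lia.
  have ii' : i' = true by lia.
  rewrite ii in ea *; rewrite ii' in ea' *.
  rewrite (@square_tile_bd _ _ a2) ?(@square_tile_bd _ _ a2'); try lia.
  have f1 : (a2 == 0 + side k - 1) = true by lia.
  have f2 : (a2' == 0) = true by lia.
  rewrite /kind_at f1 f2 /=.
  by rewrite !eqxx.
have ii : i' = i by lia.
rewrite ii in ea' *; have -> : a2' = a2 + 1 by lia.
by apply: IH => //; move: ei ea a0 a1; case: (i); lia.
Qed.

(** The square of level [k] with corner [(-k, -k)] is the lower left child of the next one, so these
    squares are nested and exhaust the plane; [k = |x| + |y|] is large enough for the cell to belong
    to it. *)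
Definition model : plane := fun x y =>
  let k := (`|x| + `|y|)%N in square_tile k (false, false) (x + k%:Z) (y + k%:Z).

Lemma side_ge k : 2 * k%:Z + 1 <= side k.
Proof. by elim: k => //= k; lia. Qed.

Lemma square_tile_succ k a b : 0 <= a < side k -> 0 <= b < side k ->
  square_tile k.+1 (false, false) (a + 1) (b + 1) = square_tile k (false, false) a b.
Proof.
move=> ha hb /=; have k0 := side_gt0 k; rewrite ifF; last by lia.
have -> : (1 + side k <= a + 1) = false by lia.
have -> : (1 + side k <= b + 1) = false by lia.
by congr square_tile; lia.
Qed.

Lemma modelE k x y : 0 <= x + k%:Z < side k -> 0 <= y + k%:Z < side k ->
  model x y = square_tile k (false, false) (x + k%:Z) (y + k%:Z).
Proof.
have key k1 n x1 y1 : 0 <= x1 + k1%:Z < side k1 -> 0 <= y1 + k1%:Z < side k1 ->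
  [/\ square_tile (k1 + n) (false, false) (x1 + (k1 + n)%:Z) (y1 + (k1 + n)%:Z) =
    square_tile k1 (false, false) (x1 + k1%:Z) (y1 + k1%:Z),
    0 <= x1 + (k1 + n)%:Z < side (k1 + n) & 0 <= y1 + (k1 + n)%:Z < side (k1 + n)].
  move=> hx hy; elim: n => [|n [IH1 IH2 IH3]]; first by rewrite addn0.
  rewrite addnS; split; [|by rewrite /=; lia..].
  rewrite -IH1 -(square_tile_succ IH2 IH3).
  by congr square_tile; lia.
move=> hx hy; rewrite /model; set K := (`|x| + `|y|)%N.
have hK := side_ge K.
have [h|h] := leqP k K.
  have [e _ _] := key k (K - k)%N x y hx hy.
  by rewrite -e subnKC.
have [] := key K (k - K)%N x y; [by lia|by lia|].
by rewrite subnKC; [move=> -> | lia].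
Qed.

Lemma model_valid : valid model.
Proof.
move=> x y; pose k := (`|x| + `|y| + 2)%N; have hk := side_ge k.
rewrite !(@modelE k); try lia.
split.
- by apply: square_tile_ok; lia.
- have -> : x + 1 + k%:Z = x + k%:Z + 1 by lia.
  by apply: square_tile_hok; lia.
- have -> : y + 1 + k%:Z = y + k%:Z + 1 by lia.
  have := @square_tile_hok k (swap (false, false)) (y + k%:Z) (x + k%:Z).
  by rewrite !square_tile_tile_tr; apply; lia.
Qed.

Lemma model_square k : square model k (- k%:Z) (- k%:Z) (false, false).
Proof.
apply: square_tile_square => a b ha hb; rewrite (@modelE k); try lia.
by congr square_tile; lia.
Qed.

(** * Counting the tilings of a window *)

Lemma vok_along' t u : vok t u -> u.1.2.1 = false -> u.1 <> (Mid, Hi) ->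
  [/\ t.1.2.2 = false, t.1 <> (Mid, Lo), t.1.1 = u.1.1 & t.2 = u.2].
Proof.
move=> h h1 h2; have [|e1 e2 e3 e4 _] := hok_along' h h1.
  by move=> e; apply: h2; case: (u) e => [[? ?] ?] /= [-> ->].
split=> //; last by apply: swap_inj.
by move=> e; apply: e2; rewrite /= e.
Qed.

Definition sideN n : nat := `|side n|%N.
Lemma sideNE n : (sideN n)%:Z = side n.
Proof. by have := side_gt0 n; rewrite /sideN; lia. Qed.

Section Code.
Variables (n M : nat).
Hypothesis n0 : (0 < n)%N.
(** Marks are recorded on [[-D, M)] in both directions, since a square of level [n] meeting the
    window may begin up to [D - 1] cells before it. *)
Let D := sideN n.
Let L := (M + D)%N.
Let b := D.-1.
Let nb := (L %/ b).+1.

Let D4 : (4 <= D)%N.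
Proof.
rewrite /D; case: n n0 => // k _; have := sideNE k.+1.
by have := side_gt0 k; rewrite /=; lia.
Qed.

Let b0 : (0 < b)%N. Proof. by rewrite /b; lia. Qed.

Definition long_start (s : plane) (x y : int) : Prop :=
  (s x y).1.1.1 /\ forall a, 0 < a < side n - 1 -> (s (x + a) y).1.1 = Mid.
Definition long_end (s : plane) (x y : int) : Prop :=
  (s x y).1.1.2 /\ forall a, 0 < a < side n - 1 -> (s (x - a) y).1.1 = Mid.

(** For each row and each block of length [b], the position and the data of a marked cell; nothing
    is lost when a block contains at most one such cell. *)
Definition mark (P : int -> int -> Prop) (T : Type) (f : int -> int -> T)
    (p : 'I_L * 'I_nb) : option ('I_b * T) :=
  let x (o : 'I_b) : int := (p.2 * b + o)%N%:Z - D%:Z in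
  let y : int := p.1%:Z - D%:Z in
  omap (fun o => (o, f (x o) y)) [pick o | `[< P (x o) y >]].

Lemma mark_eq (P P' : int -> int -> Prop) T (f f' : int -> int -> T) :
  (forall x y x', P x y -> P x' y -> x < x' < x + b%:Z -> False) ->
  (forall p, mark P f p = mark P' f' p) ->
  forall x y, - D%:Z <= x < M%:Z -> - D%:Z <= y < M%:Z -> P x y -> f x y = f' x y.
Proof.
move=> sep h x y hx hy hP.
pose x1 := absz (x + D%:Z); pose y1 := absz (y + D%:Z).
have x1L : (x1 < L)%N by rewrite /x1 /L; lia.
have y1L : (y1 < L)%N by rewrite /y1 /L; lia.
have blk : (x1 %/ b < nb)%N by rewrite /nb ltnS leq_div2r // ltnW.
have := h (Ordinal y1L, Ordinal blk); rewrite /mark /=.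
have ey : y1%:Z - D%:Z = y by rewrite /y1; lia.
rewrite ey.
have ob : (x1 %% b < b)%N by rewrite ltn_mod.
have ex : (x1 %/ b * b + Ordinal ob)%N%:Z - D%:Z = x.
  by rewrite /= -divn_eq /x1; lia.
case: pickP => [c /asboolP hc|/(_ (Ordinal ob))]; last by rewrite ex; case: asboolP.
have cE : c = Ordinal ob.
  apply: val_inj => /=; have lc := ltn_ord c; move: ex; rewrite /= => ex.
  case: (ltngtP c (x1 %% b)%N) => // lt.
    by exfalso; apply: (sep _ _ x hc hP); rewrite -ex; lia.
  by exfalso; apply: (sep _ _ _ hP hc); rewrite -ex; lia.
case: pickP => [c' _|_] //= [e1]; rewrite -e1 cE => e2.
by move: e2; rewrite ex.
Qed.

(* Ends of horizontal sides belonging to squares of level at least [n] are sparse: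
   two of them in the same row are at distance at least [side n - 1], so that a
   block of that length contains at most one.  The flag records which of them are
   the corners of squares of level exactly [n], whose inside is known. *)
Definition code (s : plane) :=
  ([ffun i : 'I_L => s 0 i%:Z], [ffun i : 'I_L => s i%:Z 0],
   [ffun p => mark (long_start s)
      (fun x y => (s x y, `[< exists r, square s n x y r >])) p],
   [ffun p => mark (long_end s) s p]).

(* Raster scan: a tile in the middle of a side is copied from its left or lower
   neighbour, and the end of a side is either marked or inside a square of level
   [n] with a marked corner. *)
Lemma code_determines s s' : valid s -> valid s' -> code s = code s' ->
  forall x y, 0 <= x < M%:Z -> 0 <= y < M%:Z -> s x y = s' x y.
Proof.
move=> vs vs' [] /ffunP h1 /ffunP h2 /ffunP h3 /ffunP h4.
have DE : D%:Z = side n by rewrite sideNE.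
have sep1 t x y x' : long_start t x y -> long_start t x' y -> x < x' < x + b%:Z -> False.
  move=> [_ h] [h' _] hx; have := h (x' - x) ltac:(rewrite /b in hx; lia).
  by rewrite subrKC => e; rewrite e in h'.
have sep2 t x y x' : long_end t x y -> long_end t x' y -> x < x' < x + b%:Z -> False.
  move=> [h' _] [_ h] hx; have := h (x' - x) ltac:(rewrite /b in hx; lia).
  by rewrite subKr => e; rewrite e in h'.
have eqs : forall p, mark (long_start s) (fun x y => (s x y, `[< exists r, square s n x y r >])) p =
    mark (long_start s') (fun x y => (s' x y, `[< exists r, square s' n x y r >])) p.
  by move=> p; have := h3 p; rewrite !ffunE.
have eqe : forall p, mark (long_end s) s p = mark (long_end s') s' p.
  by move=> p; have := h4 p; rewrite !ffunE.
have Ms := mark_eq (@sep1 s) eqs.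
have Ms' := mark_eq (@sep1 s') (fun p => esym (eqs p)).
have Me := mark_eq (@sep2 s) eqe.
have Me' := mark_eq (@sep2 s') (fun p => esym (eqe p)).
have key (t t' : plane) : valid t -> valid t' ->
    (forall x y, - D%:Z <= x < M%:Z -> - D%:Z <= y < M%:Z -> long_start t x y ->
      (t x y, `[< exists r, square t n x y r >]) =
      (t' x y, `[< exists r, square t' n x y r >])) ->
    (forall x y, - D%:Z <= x < M%:Z -> - D%:Z <= y < M%:Z -> long_end t x y ->
      t x y = t' x y) ->
    forall x y, 0 <= x < M%:Z -> 0 <= y < M%:Z ->
    (t x y).1.1 <> Mid /\ (t x y).1.2 <> Mid \/ inside t n x y -> t x y = t' x y.
  move=> vt vt' hs he x y hx hy.
  have hins : inside t n x y -> t x y = t' x y.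
    move=> [x0 [y0 [r [sq hx0 hy0]]]].
    have rg := square_frame sq; have s4 : side n >= 4 by lia.
    (* The corner of a square of level [n] is a long start. Its mark carries the flag and, through
       the tile, the role, and these determine the square by [square_eq]. *)
    have ls : long_start t x0 y0.
      split; first by rewrite rg ?kind_at_Lo //; lia.
      by move=> a ha; rewrite rg; [rewrite /= kind_at_Mid //; lia|lia|lia|lia].
    have := hs x0 y0 ltac:(lia) ltac:(lia) ls; case=> e1 e2.
    have : `[< exists r, square t n x0 y0 r >] by apply/asboolP; exists r.
    rewrite e2 => /asboolP [r' sq'].
    have rr : r' = r.
      move: e1; rewrite rg; try lia.
      by rewrite (square_frame sq'); try lia; case.
    rewrite rr in sq'; have := square_eq (a := x - x0) (b := y - y0) sq sq'.
    by rewrite !subrKC; apply; lia.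
  case=> // -[k1 k2].
  case E : (t x y).1.1 k1 => [p q] k1.
  have [hp|hp] := boolP p.
    have hp' : (t x y).1.1.1 by rewrite E.
    have [/hins //|h] := start_cover n vt hp' k2.
    by case: (hs x y ltac:(lia) ltac:(lia) (conj hp' h)) => ->.
  have hq : q by case: q k1 E => // k1 _; case: p hp k1.
  have hq' : (t x y).1.1.2 by rewrite E.
  have [/hins //|h] := end_cover n vt hq' k2.
  by apply: he (conj hq' h); lia.
move=> x y hx hy.
have [N hN] : exists N : nat, (`|x| + `|y| <= N)%N by eexists.
elim: N x y hx hy hN => [|N IH] x y hx hy hN.
  have -> : x = 0 by lia.
  have yL : (`|y| < L)%N by rewrite /L; lia.
  by have := h1 (Ordinal yL); rewrite !ffunE /=; have -> : `|y|%N%:Z = y by lia.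
have [x0|x0] := eqVneq x 0.
  rewrite x0; have yL : (`|y| < L)%N by rewrite /L; lia.
  by have := h1 (Ordinal yL); rewrite !ffunE /=; have -> : `|y|%N%:Z = y by lia.
have [y0|y0] := eqVneq y 0.
  rewrite y0; have xL : (`|x| < L)%N by rewrite /L; lia.
  by have := h2 (Ordinal xL); rewrite !ffunE /=; have -> : `|x|%N%:Z = x by lia.
have IHx := IH (x - 1) y ltac:(lia) ltac:(lia) ltac:(lia).
have IHy := IH x (y - 1) ltac:(lia) ltac:(lia) ltac:(lia).
have Ks := key _ _ vs vs' Ms Me x y hx hy.
have Ks' := key _ _ vs' vs Ms' Me' x y hx hy.
have [c|c] := pselect ((s x y).1.1 <> Mid /\ (s x y).1.2 <> Mid).
  by apply: Ks; left.
have [c'|c'] := pselect ((s' x y).1.1 <> Mid /\ (s' x y).1.2 <> Mid).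
  by symmetry; apply: Ks'; left.
have ok := valid_tile_ok vs x y; have ok' := valid_tile_ok vs' x y.
have xE : x = x - 1 + 1 by lia.
have yE : y = y - 1 + 1 by lia.
have [kx|kx] := eqVneq (s x y).1.1 Mid.
  have ky : (s x y).1.2 <> Mid.
    by move=> e; move: ok; rewrite /tile_ok; case: (s x y) kx e => [[? ?] ?] /= -> ->.
  have [||e1 e2 e3 e4 _] := hok_along' (valid_hok vs y xE).
  - by rewrite kx.
  - by move=> e; rewrite e in kx.
  have := valid_hok vs' y xE; rewrite -IHx => hh.
  have [f1 f2 f3 f4 _] := hok_along hh e1 e2.
  have kx' : (s' x y).1.1 = Mid.
    by apply: contrapT => e; apply: c'; split=> //; rewrite f3 e3.
  rewrite e3 in f3; rewrite e4 in f4.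
  by case: (s x y) (s' x y) kx kx' f3 f4 => [[? ?] ?] [[? ?] ?] /= -> -> -> ->.
have ky : (s x y).1.2 = Mid.
  by apply: contrapT => e; apply: c; split=> //; apply/eqP.
have [||e1 e2 e3 e4] := vok_along' (valid_vok vs x yE).
- by rewrite ky.
- by move=> e; rewrite e in ky.
have := valid_vok vs' x yE; rewrite -IHy => hh.
have [f1 f2 f3 f4 _] := vok_along hh e1 e2.
rewrite e3 in f3; rewrite e4 in f4.
have ky' : (s' x y).1.2 = Mid.
  by apply: contrapT => e; apply: c'; split=> //; rewrite f3; apply/eqP.
by case: (s x y) (s' x y) ky ky' f3 f4 => [[? ?] ?] [[? ?] ?] /= -> -> -> ->.
Qed.

Lemma leq_exp2rW p q k : (p <= q)%N -> (p ^ k <= q ^ k)%N.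
Proof. by case: k => // k; rewrite leq_exp2r. Qed.

(** There are [64] tiles, hence [128 * b] marks for a start with its flag, and [None]. As [nb] is
    about [L / b], the logarithm of the bound is of order [L ^ 2 * ln b / b], small against [L ^ 2]
    for large [n]. *)
Lemma code_card : exists C : finType, exists2 cd : plane -> C,
    (forall s s', valid s -> valid s' -> cd s = cd s' ->
      forall x y, 0 <= x < M%:Z -> 0 <= y < M%:Z -> s x y = s' x y)
  & (#|C| <= 64 ^ (2 * L) * (1 + 128 * b) ^ (2 * (L * nb)))%N.
Proof.
exists ({ffun 'I_L -> tile} * {ffun 'I_L -> tile} *
  {ffun 'I_L * 'I_nb -> option ('I_b * (tile * bool))} *
  {ffun 'I_L * 'I_nb -> option ('I_b * tile)} : finType)%type.
exists code; first exact: code_determines.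
rewrite !(card_prod, card_ffun, card_option, card_ord, card_bool).
rewrite (_ : (2 * 2 * (2 * 2) * (2 * 2) = 64)%N) // !mul2n -!addnn !expnD -mulnA.
apply: leq_mul => //; apply: leq_mul; apply: leq_exp2rW; lia.
Qed.
End Code.

(** * Local sets *)

Definition agree (T : Type) k (x y : Z2 -> T) : Prop :=
  forall v : Z2, (`|v.1| <= k)%N -> (`|v.2| <= k)%N -> x v = y v.

Lemma agree_le (T : Type) k l (x y : Z2 -> T) : (k <= l)%N -> agree l x y -> agree k x y.
Proof. by move=> kl h v h1 h2; apply: h; exact: leq_trans kl. Qed.

Section Topology.
Context {A : alphabetType}.
Implicit Types (x y : config A) (U : set (config A)).

Lemma near_coord x (v : Z2) : nbhs x [set y | x v = y v].
Proof.
have h := @proj_continuous Z2 (fun=> discrete_topology A) v x.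
have hv : nbhs (x v : discrete_topology A) [set x v] by exact: discrete_set1.
have : nbhs x (proj v @^-1` [set x v]) := h _ hv.
by apply: filterS => y /= e; exact: esym e.
Qed.

Lemma near_agree x k : nbhs x [set y | agree k x y].
Proof.
pose s : seq Z2 := [seq (i%:Z - k%:Z, j%:Z - k%:Z) | i <- iota 0 (k + k).+1, j <- iota 0 (k + k).+1].
have h (l : seq Z2) : nbhs x [set y | forall v, v \in l -> x v = y v].
  elim: l => [|v l IH]; first by apply: filterE.
  apply: filterS2 IH (near_coord x v) => y /= h1 h2 w.
  by rewrite inE => /orP[/eqP ->|/h1].
apply: filterS (h s) => y /= hy v h1 h2; apply: hy.
apply/allpairsP; exists (absz (v.1 + k%:Z), absz (v.2 + k%:Z)).
split; rewrite ?mem_iota /=; [lia|lia|].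
by case: v h1 h2 => a b /= h1 h2; congr (_, _); lia.
Qed.

Lemma nbhs_agreeP x U : nbhs x U <-> exists k, forall y, agree k x y -> U y.
Proof.
split; last by move=> [k hk]; apply: filterS (near_agree x k).
pose F : set_system (config A) := [set V | exists k, forall y, agree k x y -> V y].
have FF : Filter F.
  split; first by exists 0%N.
    move=> V W [k hk] [l hl]; exists (maxn k l) => y hy.
    by split; [apply: hk|apply: hl]; apply: agree_le hy; rewrite leq_max leqnn ?orbT.
  by move=> V W VW [k hk]; exists k => y /hk /VW.
have : F --> x.
  apply/cvg_sup => v; apply/cvg_image.
    rewrite eqEsubset; split=> // a _; exists (fun=> a) => //.
  move=> V /= hV; exists [set y : config A | V (y v)].
    exists (maxn `|v.1| `|v.2|)%N => y hy.
    have /= <- : x v = y v by apply: hy; rewrite ?leq_maxl ?leq_maxr.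
    exact: (nbhs_singleton hV).
  rewrite eqEsubset; split=> [a [y /= Vy <-] //|a Va].
  by exists (fun=> a).
by move=> h /h.
Qed.

Definition local k U : Prop := forall x y, agree k x y -> U x -> U y.

Lemma agree_sym k x y : agree k x y -> agree k y x.
Proof. by move=> h v h1 h2; rewrite h. Qed.
Lemma agree_trans k x y z : agree k x y -> agree k y z -> agree k x z.
Proof. by move=> h h' v h1 h2; rewrite h // h'. Qed.

Lemma open_local k U : local k U -> open U.
Proof.
move=> lU; rewrite openE => x Ux; apply/nbhs_agreeP; exists k => y xy.
exact: lU Ux.
Qed.

Lemma local_agree k x : local k [set y | agree k x y].
Proof. by move=> y z yz /= xy; exact: agree_trans yz. Qed.

Lemma localC k U : local k U -> local k (~` U).
Proof. by move=> h x y xy nx Uy; apply: nx; apply: h Uy; exact: agree_sym. Qed.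

Lemma localI k l U V : local k U -> local l V -> local (maxn k l) (U `&` V).
Proof.
by move=> hU hV x y xy [Ux Vx]; split; [apply: hU Ux|apply: hV Vx];
  apply: agree_le xy; rewrite ?leq_maxl ?leq_maxr.
Qed.

Lemma config_compact : compact [set: config A].
Proof.
have h := @tychonoff Z2 (fun=> discrete_topology A) (fun=> setT)
  (fun=> @finite_compact (discrete_topology A) setT (@finite_finset A setT)).
suff <- : [set f : Z2 -> discrete_topology A | forall i, [set: discrete_topology A] (f i)] = setT.
  exact: h.
by rewrite eqEsubset.
Qed.

End Topology.

(** Curtis-Hedlund-Lyndon: [X] is compact, so finitely many agreement neighbourhoods on which the
    image at the origin is constant cover it, and the largest of their radii works. *)
Lemma block_map (A B : alphabetType) (X : set (config A)) (phi : config A -> config B) :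
  closed X -> {within X, continuous phi} ->
  exists r, forall x y, X x -> X y -> agree r x y -> phi x (0, 0) = phi y (0, 0).
Proof.
move=> cX /subspace_continuousP cphi.
have cptX : compact X := subclosed_compact cX config_compact (@subsetT _ X).
have ex (z : config A) : exists k, X z -> forall y, X y -> agree k z y ->
    phi z (0, 0) = phi y (0, 0).
  have [Xz|nXz] := pselect (X z); last by exists 0%N.
  have /nbhs_agreeP[k hk] := cphi z Xz _ (near_coord (phi z) (0, 0)).
  by exists k => _ y Xy /hk; apply.
have [k hk] := choice ex.
rewrite compact_cover in cptX.
have [|z Xz|D DX cov] := cptX _ X (fun z => [set y | agree (k z) z y]).
- by move=> z Xz; apply: (@open_local _ (k z)); exact: local_agree.
- by exists z.
exists (\max_(z <- D) k z) => x y Xx Xy xy.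
have [z /= zD zx] := cov x Xx.
have Xz : X z by have := DX z zD; rewrite inE.
rewrite -(hk z Xz x Xx zx); apply: hk => //.
apply: agree_trans zx _; apply: agree_le xy.
exact: leq_bigmax_seq.
Qed.

Section Borel.
Context {A : alphabetType}.

(** These are the clopen sets, an algebra generating the Borel sets; measures are constructed and
    compared on them. *)
Definition locals : set (set (config A)) := [set U | exists k, local k U].

Lemma borel_locals : <<s @open (config A) >> = <<s locals >>.
Proof.
rewrite eqEsubset; split; apply: smallest_sub.
- exact: smallest_sigma_algebra.
- move=> U oU; have -> : U = \bigcup_k [set x | forall y, agree k x y -> U y].
    rewrite eqEsubset; split=> [x Ux|x [k _]]; last by apply.
    by have /nbhs_agreeP[k hk] := open_nbhs_nbhs (conj oU Ux); exists k.
  apply: sigma_algebra_bigcup => k; apply: sub_sigma_algebra; exists k.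
  by move=> x y xy hx z yz; apply: hx; exact: agree_trans yz.
- exact: smallest_sigma_algebra.
- by move=> U [k /open_local oU]; exact: sub_sigma_algebra.
Qed.

Lemma borel_unique (R : realType) (m1 m2 : {measure set (borel_config A) -> \bar R}) :
  (m1 setT < +oo)%E -> (forall k U, local k U -> m1 U = m2 U) ->
  forall E : set (borel_config A), measurable E -> m1 E = m2 E.
Proof.
move=> fin h E mE; apply: (@measure_unique _ R (borel_config A) locals (fun=> setT)) => //.
- exact: borel_locals.
- by move=> U V [k hU] [l hV]; exists (maxn k l); exact: localI.
- by move=> _; exists 0%N.
- by rewrite bigcup_const.
- by move=> U [k /h].
Qed.

Lemma local_measurable k (U : set (config A)) : local k U ->
  measurable (U : set (borel_config A)).
Proof. by move=> /open_local oU; exact: sub_sigma_algebra. Qed.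

Lemma closed_borel (X : set (config A)) : closed X -> measurable (X : set (borel_config A)).
Proof.
move=> cX; rewrite -[X]setCK; apply: measurableC.
by apply: sub_sigma_algebra; exact: closed_openC.
Qed.
End Borel.

(** * Extension of contents on local sets to Borel probabilities *)

Fact local_display : measure_display. Proof. by []. Qed.
Definition local_config (A : alphabetType) : Type := config A.

Section LocalAlgebra.
Variable A : alphabetType.
Lemma locals0 : @locals A set0. Proof. by exists 0%N. Qed.
Lemma localsU : setU_closed (@locals A).
Proof.
move=> U V [k hU] [l hV]; exists (maxn k l); rewrite -[U `|` V]setCK setCU.
by apply: localC; apply: localI; exact: localC.
Qed.
Lemma localsC : setC_closed (@locals A).
Proof. by move=> U [k hU]; exists k; exact: localC. Qed.
HB.instance Definition _ := Pointed.on (local_config A).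
HB.instance Definition _ := @isAlgebraOfSets.Build local_display
  (local_config A) (@locals A) locals0 localsU localsC.
End LocalAlgebra.

Section Extension.
Context (R : realType) (A : alphabetType) (m : set (config A) -> R).
Hypothesis m_ge0 : forall U, 0 <= m U.
Hypothesis m_add : forall U V, U `&` V = set0 -> m (U `|` V) = m U + m V.
Hypothesis mT : m setT = 1.

Let m0 : m set0 = 0.
Proof.
have := @m_add set0 set0 (setI0 _); rewrite setU0 => h.
by apply: (addrI (m set0)); rewrite addr0.
Qed.

Definition local_content (U : set (local_config A)) : \bar R := (m U)%:E.

Let content0 : local_content set0 = 0%E. Proof. by rewrite /local_content m0. Qed.
Let content_ge0 U : (0 <= local_content U)%E. Proof. by rewrite /local_content lee_fin. Qed.
(* Local sets are compact, so a disjoint local union of local sets is finite. *)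
Let content_sigma : semi_sigma_additive local_content.
Proof.
move=> F mF tF mUF.
have finU n : m (\big[setU/set0]_(i < n) F i) = \sum_(i < n) m (F i).
  elim: n => [|n IH]; first by rewrite !big_ord0.
  rewrite !big_ord_recr /= m_add ?IH //.
  rewrite big_distrl /= big1 // => i _.
  by have /trivIsetP/(_ i n I I) := tF; apply; rewrite neq_ltn ltn_ord.
have [n0 hn0] : exists n0, forall i, (n0 <= i)%N -> F i = set0.
  have cU : compact (\bigcup_i F i : set (config A)).
    apply: (subclosed_compact _ (@config_compact A)) => //.
    case: mUF => k /localC /open_local oC.
    by rewrite -openC.
  rewrite compact_cover in cU.
  have [i _|x [i _ Fx]|D _ cov] := cU nat setT (F : nat -> set (config A)).
  - by case: (mF i) => k /open_local.
  - by exists i.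
  exists (\max_(i <- D) i).+1 => i hi; apply/seteqP; split=> // x Fx.
  have [j /= jD Fjx] := cov x (ex_intro2 _ _ i I Fx).
  have ji : j != i.
    rewrite neq_ltn (leq_trans _ hi) // ltnS.
    exact: (@leq_bigmax_seq _ (enum_fset D) xpredT id j).
  have /trivIsetP/(_ j i I I ji) := tF.
  by move=> e; have : (F j `&` F i) x by []; rewrite e.
have -> : local_content (\bigcup_i F i) = (\sum_(0 <= i < n0) local_content (F i))%E.
  rewrite big_mkord /local_content sumEFin -finU; congr ((m _)%:E).
  rewrite -(bigcup_mkord n0 F).
  apply/seteqP; split=> x [i hi Fx]; exists i => //.
  by rewrite /= ltnNge; apply/negP => /hn0 e; rewrite e in Fx.
apply: cvg_near_cst; exists n0 => // n /= hn.
rewrite (big_cat_nat _ hn) //= (_ : (\sum_(n0 <= i < n) local_content (F i))%E = 0%E) ?adde0 //.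
by rewrite big_nat big1 // => i /andP[/hn0 -> _].
Qed.

HB.instance Definition _ := isMeasure.Build _ _ _ local_content
  content0 content_ge0 content_sigma.

Definition extension (E : set (borel_config A)) : \bar R := measure_extension local_content E.

Let extension0 : extension set0 = 0%E. Proof. exact: measure0. Qed.
Let extension_ge0 E : (0 <= extension E)%E. Proof. exact: measure_ge0. Qed.

Let mE (E : set (config A)) : measurable (E : set (borel_config A)) ->
  measurable (E : set (g_sigma_algebraType (@measurable _ (local_config A)))).
Proof. by rewrite /measurable /= borel_locals. Qed.

Let extension_sigma : semi_sigma_additive extension.
Proof.
move=> F mF tF mUF.
apply: (@measure_semi_sigma_additive _ _ _ (measure_extension local_content) F) => //.
  by move=> i; exact: mE.
exact: mE.
Qed.

HB.instance Definition _ := isMeasure.Build _ _ _ extension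
  extension0 extension_ge0 extension_sigma.

Let extension_local k U : local k U -> extension U = (m U)%:E.
Proof.
move=> lU; rewrite /extension /measure_extension measurable_mu_extE //.
by exists k.
Qed.

Let extensionT : extension setT = 1%E.
Proof. by rewrite (@extension_local 0) // mT. Qed.

HB.instance Definition _ := Measure_isProbability.Build _ _ _ extension extensionT.

Lemma extend_content : exists mu : probability (borel_config A) R,
  forall k U, local k U -> mu U = (m U)%:E.
Proof. by exists extension. Qed.

End Extension.

(** * Gibbs' inequality *)

Section Sums.
Variable R : realType.

(** Entropy plus mean energy is at most the logarithm of the partition function. Termwise it is
    [ln z <= z - 1] at [z = a i / (Z * p i)], the terms with [p i = 0] being treated apart. *)
Lemma gibbs (I : finType) (P : {set I}) (p a : I -> R) :
  (forall i, i \in P -> 0 <= p i) -> \sum_(i in P) p i = 1 ->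
  (forall i, i \in P -> 0 < a i) ->
  \sum_(i in P) (p i * ln (a i) - p i * ln (p i)) <= ln (\sum_(i in P) a i).
Proof.
move=> p0 p1 a0; set Z := \sum_(i in P) a i.
have [P0|[i0 i0P]] := set_0Vmem P.
  by move: p1; rewrite P0 big_set0 => /esym/eqP; rewrite oner_eq0.
have Z0 : 0 < Z.
  rewrite /Z (bigD1 i0) //= ltr_pwDl ?a0 //.
  by apply: sumr_ge0 => i /andP[/a0 /ltW].
rewrite -subr_le0 -[X in _ - X]mul1r -p1 mulr_suml -sumrB.
apply: (@le_trans _ _ (\sum_(i in P) (a i / Z - p i))); last first.
  by rewrite sumrB p1 -mulr_suml divff ?subrr // gt_eqF.
apply: ler_sum => i iP; have ai := a0 i iP.
have [pi0|pi0] := eqVneq (p i) 0.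
  by rewrite pi0 !mul0r !subr0 divr_ge0 // ltW.
have pip : 0 < p i by rewrite lt_neqAle eq_sym pi0 p0.
have -> : p i * ln (a i) - p i * ln (p i) - p i * ln Z = p i * ln (a i / Z / p i).
  by rewrite !ln_div ?posrE ?divr_gt0 // !mulrBr; ring.
have -> : a i / Z - p i = p i * (a i / Z / p i - 1).
  by rewrite mulrBr mulr1 mulrCA divff // mulr1.
rewrite ler_pM2l //.
have h : 0 < a i / Z / p i by rewrite !divr_gt0.
set z := a i / Z / p i in h *.
have := @le_ln1Dx R (z - 1); rewrite (_ : 1 + (z - 1) = z); last by ring.
by apply; lra.
Qed.

Lemma sum_inj_le (I J : finType) (P : {set I}) (c : I -> J) (F : J -> R) :
  {in P &, injective c} -> (forall j, 0 <= F j) ->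
  \sum_(i in P) F (c i) <= \sum_j F j.
Proof.
move=> ci F0; rewrite -(big_imset F ci) /=.
rewrite [leRHS](bigID (mem [set c x | x in P]%SET)) /= lerDl.
exact: sumr_ge0.
Qed.

Lemma ln_prod (I : finType) (F : I -> R) : (forall i, 0 < F i) ->
  ln (\prod_i F i) = \sum_i ln (F i).
Proof.
move=> F0.
suff : 0 < \prod_i F i /\ ln (\prod_i F i) = \sum_i ln (F i) by case.
apply: (big_ind2 (fun x y : R => 0 < x /\ ln x = y)) => //.
- by rewrite ln1.
- move=> x1 x2 y1 y2 [h1 <-] [h2 <-]; rewrite mulr_gt0 //; split=> //.
  by rewrite lnM ?posrE.
Qed.

Lemma sum_residues (k J N : nat) (G : nat -> R) : (forall i, 0 <= G i) ->
  (k * J <= N)%N ->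
  \sum_(o < k) \sum_(a < J) G (o + k * a)%N <= \sum_(i < N) G i.
Proof.
move=> G0 kJ.
have -> : \sum_(o < k) \sum_(a < J) G (o + k * a)%N = \sum_(0 <= i < k * J) G i.
  elim: J {kJ} => [|J IH].
    by rewrite muln0 big_geq // big1 // => o _; rewrite big_ord0.
  under eq_bigr do rewrite big_ord_recr /=.
  rewrite big_split /= IH mulnS [in RHS]addnC.
  rewrite [RHS](@big_cat_nat _ _ _ (k * J)%N) ?leq_addr //=; congr (_ + _).
  rewrite -[X in _ = \sum_(X <= _ < _) _]add0n big_addn addKn big_mkord.
  by apply: eq_bigr => i _.
rewrite -(big_mkord xpredT G) [leRHS](@big_cat_nat _ _ _ (k * J)%N) //= lerDl.
by apply: sumr_ge0.
Qed.
End Sums.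

(** * Languages and entropy *)

Section Fekete.
Context (R : realType) (a : nat -> nat -> R).
Hypothesis a_ge0 : forall m n, 0 <= a m n.
Hypothesis a0n : forall n, a 0 n = 0.
Hypothesis am0 : forall m, a m 0 = 0.
Hypothesis subl : forall m1 m2 n, a (m1 + m2) n <= a m1 n + a m2 n.
Hypothesis subr : forall m n1 n2, a m (n1 + n2) <= a m n1 + a m n2.

Let S := [set r : R | exists p : nat * nat, [/\ (0 < p.1)%N, (0 < p.2)%N &
   r = (p.1%:R * p.2%:R)^-1 * a p.1 p.2]].

Definition fekete_lim : R := inf S.

Let sublM i k n : a (i * k) n <= i%:R * a k n.
Proof.
elim: i => [|i IH]; first by rewrite mul0n a0n mul0r.
by rewrite mulSn -natr1 mulrDl mul1r addrC (le_trans (subl _ _ _)) // lerD2l.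
Qed.
Let subrM i k n : a n (i * k) <= i%:R * a n k.
Proof.
elim: i => [|i IH]; first by rewrite mul0n am0 mul0r.
by rewrite mulSn -natr1 mulrDl mul1r addrC (le_trans (subr _ _ _)) // lerD2l.
Qed.
Let a_le m n : a m n <= m%:R * n%:R * a 1 1.
Proof.
have := sublM m 1 n; rewrite muln1 => /le_trans -> //.
rewrite -mulrA ler_wpM2l //; have := subrM n 1 1; by rewrite muln1.
Qed.

Let lbS : lbound S 0.
Proof. by move=> r [p [_ _ ->]]; rewrite mulr_ge0 // invr_ge0 mulr_ge0. Qed.
Let S_ne : S !=set0. Proof. by exists ((1 * 1)^-1 * a 1 1), (1, 1)%N. Qed.

Lemma fekete_ge m n : (0 < m)%N -> (0 < n)%N ->
  fekete_lim <= (m%:R * n%:R)^-1 * a m n.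
Proof.
move=> m0 n0; apply: ge_inf; first by exists 0; exact: lbS.
by exists (m, n).
Qed.

(** Cutting an [m] by [n] rectangle into [k] by [l] ones leaves two strips; they account for the
    last two terms, which vanish as [m] and [n] grow independently. *)
Let upper k l m n : (0 < k)%N -> (0 < l)%N -> (0 < m)%N -> (0 < n)%N ->
  (m%:R * n%:R)^-1 * a m n <=
    (k%:R * l%:R)^-1 * a k l + l%:R * a 1 1 / n%:R + k%:R * a 1 1 / m%:R.
Proof.
move=> k0 l0 m0 n0.
set i := (m %/ k)%N; set j := (n %/ l)%N; set r := (m %% k)%N; set s := (n %% l)%N.
have h1 : a m n <= i%:R * a k n + a r n.
  by rewrite {1}(divn_eq m k) (le_trans (subl _ _ _)) // lerD2r.
have h2 : a k n <= j%:R * a k l + a k s.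
  by rewrite {1}(divn_eq n l) (le_trans (subr _ _ _)) // lerD2r.
have c0 : 0 <= a 1 1 by [].
have ik : (i%:R * k%:R <= m%:R :> R) by rewrite -natrM ler_nat leq_divM.
have jl : (j%:R * l%:R <= n%:R :> R) by rewrite -natrM ler_nat leq_divM.
have h3 : a k s <= k%:R * l%:R * a 1 1.
  apply: (le_trans (a_le _ _)); rewrite ler_wpM2r // ler_wpM2l // ler_nat.
  by rewrite ltnW // ltn_mod.
have h4 : a r n <= k%:R * n%:R * a 1 1.
  apply: (le_trans (a_le _ _)); rewrite ler_wpM2r // ler_wpM2r // ler_nat.
  by rewrite ltnW // ltn_mod.
have kR : 0 < k%:R :> R by rewrite ltr0n.
have lR : 0 < l%:R :> R by rewrite ltr0n.
have mR : 0 < m%:R :> R by rewrite ltr0n.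
have nR : 0 < n%:R :> R by rewrite ltr0n.
rewrite ler_pdivrMl ?mulr_gt0 //.
have h5 : i%:R * (j%:R * a k l) <= m%:R * n%:R * ((k%:R * l%:R)^-1 * a k l).
  rewrite mulrA mulrA ler_wpM2r // ler_pdivlMr ?mulr_gt0 //.
  by rewrite mulrACA ler_pM // mulr_ge0.
have h6 : i%:R * a k s <= m%:R * l%:R * a 1 1.
  apply: (@le_trans _ _ (i%:R * (k%:R * l%:R * a 1 1))); first by rewrite ler_wpM2l.
  by rewrite !mulrA ler_wpM2r // ler_wpM2r.
have -> : m%:R * n%:R * ((k%:R * l%:R)^-1 * a k l + l%:R * a 1 1 / n%:R + k%:R * a 1 1 / m%:R)
  = m%:R * n%:R * ((k%:R * l%:R)^-1 * a k l) + m%:R * l%:R * a 1 1 + k%:R * n%:R * a 1 1.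
  by field; rewrite !gt_eqF.
apply: (le_trans h1); apply: lerD => //.
apply: le_trans (lerD h5 h6); rewrite -mulrDr; exact: ler_wpM2l.
Qed.

Lemma fekete : (fun p : nat * nat => (p.1%:R * p.2%:R)^-1 * a p.1 p.2 : R)
  @ filter_prod \oo \oo --> fekete_lim.
Proof.
apply/cvgrPdist_le => /= e e0.
have [_ [[k l] /= [k0 l0 ->]] hkl] : exists2 r, S r & r < fekete_lim + e / 3.
  by apply: inf_adherent; [rewrite divr_gt0|split=> //; exists 0; exact: lbS].
have c0 : 0 <= a 1 1 by [].
pose K (x : R) := (Num.truncn (x * a 1 1 / (e / 3))).+1.
have hK (x y : nat) : (K x%:R <= y)%N -> (0 < y)%N /\ x%:R * a 1 1 / y%:R <= e / 3.
  move=> xy; have y0 : (0 < y)%N by exact: leq_trans xy.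
  split=> //; rewrite ler_pdivrMr ?ltr0n // [leRHS]mulrC -ler_pdivrMr ?divr_gt0 //.
  apply: (@le_trans _ _ (K x%:R)%:R); last by rewrite ler_nat.
  by apply: ltW; exact: truncnS_gt.
exists ([set n | (K k%:R <= n)%N], [set n | (K l%:R <= n)%N]) => /=.
  by split; [exists (K k%:R)|exists (K l%:R)].
move=> [m n] [/= /hK[m0 hm] /hK[n0 hn]].
rewrite ler_norml; apply/andP; split.
  have := upper k0 l0 m0 n0; lra.
have := fekete_ge m0 n0; lra.
Qed.
End Fekete.

Section Language.
Context {A : alphabetType}.
Implicit Types (X : set (config A)) (S : {fset Z2}) (x y : config A).

Lemma mem_rect n1 n2 (v : Z2) :
  (v \in rect n1 n2) = (1 <= v.1 <= n1%:Z) && (1 <= v.2 <= n2%:Z).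
Proof.
apply/imfset2P/idP => /= [[i]|h].
  by rewrite mem_iota => hi [j]; rewrite mem_iota => hj -> /=; lia.
exists `|v.1|%N; first by rewrite mem_iota; lia.
exists `|v.2|%N; first by rewrite mem_iota; lia.
by case: v h => i j /= h; congr (_, _); lia.
Qed.

Lemma restrP S x y : restr S x = restr S y <-> forall v, v \in S -> x v = y v.
Proof.
split=> [/ffunP h v vS|h]; first by have := h [` vS]%fset; rewrite !ffunE.
by apply/ffunP => v; rewrite !ffunE h // fsvalP.
Qed.

Lemma languageP X S w : reflect (exists2 x, X x & restr S x = w) (w \in language X S).
Proof. by rewrite inE; exact: asboolP. Qed.

Lemma restr_language X S x : X x -> restr S x \in language X S.
Proof. by move=> Xx; apply/languageP; exists x. Qed.

Definition rep X (S : {fset Z2}) (w : {ffun S -> A}) : config A :=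
  xget point [set x | X x /\ restr S x = w].
Lemma repP X S (w : {ffun S -> A}) : w \in language X S -> X (rep X w) /\ restr S (rep X w) = w.
Proof.
by move=> /languageP[x Xx e]; exact: (@xgetPex _ point [set x | X x /\ restr S x = w] (ex_intro _ x (conj Xx e))).
Qed.

Lemma card_language_le X S (C : finType) (D : {set C}) (code : config A -> C) :
  (forall x, X x -> code x \in D) ->
  (forall x y, X x -> X y -> code x = code y -> restr S x = restr S y) ->
  (#|language X S| <= #|D|)%N.
Proof.
move=> hD hc.
have inj : {in language X S &, injective (fun w => code (rep X w))}.
  move=> w w' /repP[X1 e1] /repP[X2 e2] /(hc _ _ X1 X2); by rewrite e1 e2.
rewrite -(card_in_imset inj); apply: subset_leq_card; apply/fintype.subsetP => c.
by move=> /imsetP[w /repP[/hD h _] ->].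
Qed.

Lemma card_language_ge X S (C : finType) (D : {set C}) (f : C -> config A) :
  (forall c, c \in D -> X (f c)) ->
  {in D &, injective (fun c => restr S (f c))} ->
  (#|D| <= #|language X S|)%N.
Proof.
move=> hX inj; rewrite -(card_in_imset inj); apply: subset_leq_card.
by apply/fintype.subsetP => w /imsetP[c cD ->]; exact: restr_language (hX _ cD).
Qed.

Lemma shiftE (t : Z2) x v : shift t x v = x (v + t). Proof. by []. Qed.

Section Subshift.
Variables (R : realType) (X : set (config A)).
Hypotheses (sX : is_subshift X) (X0 : X !=set0).

Definition lnL n1 n2 : R := ln #|language X (rect n1 n2)|%:R.

Lemma card_language_gt0 S : (0 < #|language X S|)%N.
Proof.
case: X0 => x Xx; rewrite card_gt0; apply/set0Pn; exists (restr S x).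
exact: restr_language.
Qed.

Lemma lnL_ge0 n1 n2 : 0 <= lnL n1 n2.
Proof. by apply: ln_ge0; rewrite ler1n card_language_gt0. Qed.

Let card_empty S : S =i fset0 -> (#|language X S| <= 1)%N.
Proof.
move=> S0; rewrite -(cards1 tt).
apply: (@card_language_le X S unit [set tt]%SET (fun=> tt)).
  by move=> x _; rewrite inE.
by move=> x y _ _ _; apply/restrP => v; rewrite S0 inE.
Qed.

Lemma lnL0 n : lnL 0 n = 0.
Proof.
apply: le_anti; rewrite lnL_ge0 andbT; apply: ln_le0; rewrite -[1]/(1%:R) ler_nat.
by apply: card_empty => v; rewrite mem_rect inE; lia.
Qed.
Lemma lnLr0 n : lnL n 0 = 0.
Proof.
apply: le_anti; rewrite lnL_ge0 andbT; apply: ln_le0; rewrite -[1]/(1%:R) ler_nat.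
by apply: card_empty => v; rewrite mem_rect inE; lia.
Qed.

Lemma lnL_split (S S1 S2 : {fset Z2}) (t : Z2) :
  (forall v, v \in S -> v \in S1 \/ v - t \in S2) ->
  ln #|language X S|%:R <= ln #|language X S1|%:R + ln #|language X S2|%:R :> R.
Proof.
move=> h; rewrite -lnM ?posrE ?ltr0n ?card_language_gt0 //.
rewrite ler_ln ?posrE ?mulr_gt0 ?ltr0n ?card_language_gt0 // -natrM ler_nat.
rewrite -cardsX.
apply: (@card_language_le X S _ (finset.setX (language X S1) (language X S2)) (fun x => (restr S1 x, restr S2 (shift t x)))).
  move=> x Xx; rewrite inE /= !restr_language //; exact: (proj2 sX).
move=> x y _ _ [/restrP h1 /restrP h2]; apply/restrP => v /h[/h1//|/h2].
by rewrite !shiftE subrK.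
Qed.

Lemma lnL_subl m1 m2 n : lnL (m1 + m2) n <= lnL m1 n + lnL m2 n.
Proof.
apply: (@lnL_split _ _ _ (m1%:Z, 0)) => -[i j]; rewrite !mem_rect.
have -> : ((i, j) - (m1%:Z, 0)).1 = i - m1%:Z by [].
have -> : ((i, j) - (m1%:Z, 0)).2 = j by rewrite [LHS]subr0.
rewrite /=; have [h|h] := leP i m1%:Z; [left|right]; lia.
Qed.
Lemma lnL_subr m n1 n2 : lnL m (n1 + n2) <= lnL m n1 + lnL m n2.
Proof.
apply: (@lnL_split _ _ _ (0, n1%:Z)) => -[i j]; rewrite !mem_rect.
have -> : ((i, j) - (0, n1%:Z)).2 = j - n1%:Z by [].
have -> : ((i, j) - (0, n1%:Z)).1 = i by rewrite [LHS]subr0.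
rewrite /=; have [h|h] := leP j n1%:Z; [left|right]; lia.
Qed.

Lemma entropy_cvg : (fun n : nat * nat => (n.1%:R * n.2%:R)^-1 * lnL n.1 n.2 : R)
  @ filter_prod \oo \oo --> entropy R X.
Proof.
have h := fekete lnL_ge0 lnL0 lnLr0 lnL_subl lnL_subr.
by rewrite /entropy (cvg_lim _ h).
Qed.

Lemma entropy_square : (fun n : nat => (n%:R ^+ 2)^-1 * lnL n n : R) @ \oo --> entropy R X.
Proof.
have hf : (fun n : nat => (n, n)) @ \oo --> filter_prod \oo \oo.
  move=> U [[P Q] /= [hP hQ] hU].
  by apply: filterS2 hP hQ => n Pn Qn; apply: hU.
rewrite [X in X @ _](_ : _ = (fun n : nat * nat => (n.1%:R * n.2%:R)^-1 * lnL n.1 n.2) \o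
  (fun n : nat => (n, n))); last by apply/funext => n /=; rewrite expr2.
exact: cvg_comp hf entropy_cvg.
Qed.

End Subshift.
End Language.

(** * Existence of measures of maximal entropy *)

Definition pos (i j : nat) : Z2 := (i%:Z, j%:Z).

Section Blocks.
Context (R : realType) (B : alphabetType) (Y : set (config B)).
Hypothesis Y0 : Y !=set0.
Variables (N k : nat).
Hypothesis k0 : (0 < k)%N.
Let L := language Y (rect N N).
Let y (w : {ffun rect N N -> B}) := rep Y w.
Variable q : {ffun rect k k -> B} -> R.
Hypotheses (q_gt0 : forall u, 0 < q u) (q_sum : \sum_u q u <= 1).

Let win (i j : nat) (w : {ffun rect N N -> B}) := restr (rect k k) (shift (pos i j) (y w)).

(** One block fewer than fits, so that every offset below [k] keeps the grid inside the window. *)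
Let J := (N %/ k).-1.

Let Lgt0 : (0 < #|L|)%N. Proof. exact: card_language_gt0. Qed.

Let q_le1 u : q u <= 1.
Proof.
apply: le_trans q_sum; rewrite (bigD1 u) //= lerDl.
by apply: sumr_ge0 => v _; exact: ltW.
Qed.

(** The first [k] and the last [2 * k] lines contain everything that the grid misses, whatever its
    offset. *)
Let coord (c : 'I_(3 * k)) : int :=
  if (c < k)%N then c%:Z + 1 else N%:Z - (3 * k)%:Z + c%:Z + 1.

Let edge (w : {ffun rect N N -> B}) : {ffun 'I_(3 * k) * 'I_N * bool -> B} :=
  [ffun p : 'I_(3 * k) * 'I_N * bool =>
    if p.2 then y w (coord p.1.1, p.1.2%:Z + 1) else y w (p.1.2%:Z + 1, coord p.1.1)].

Let kJ : (k * J + k <= N)%N \/ J = 0%N.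
Proof.
rewrite /J; case E : (N %/ k)%N => [|j] /=; first by right.
left; rewrite addnC -mulnS -E mulnC; exact: leq_divM.
Qed.
Let kJ' : (N < k * J + 2 * k)%N.
Proof.
rewrite /J; have := ltn_ceil N k0; case: (N %/ k)%N => [|j] /=; lia.
Qed.

Let edge_eq w w' (c : int) (i : nat) (b : bool) : edge w = edge w' ->
  (1 <= c <= k%:Z) || (N%:Z - 2 * k%:Z < c <= N%:Z) -> (i < N)%N ->
  (if b then y w (c, i%:Z + 1) else y w (i%:Z + 1, c)) =
  (if b then y w' (c, i%:Z + 1) else y w' (i%:Z + 1, c)).
Proof.
move=> /ffunP e hc iN.
have [c' ec] : exists c' : 'I_(3 * k), coord c' = c.
  case/orP: hc => hc.
    have h : (`|c - 1| < 3 * k)%N by lia.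
    by exists (Ordinal h); rewrite /coord /= ifT; lia.
  have h : (absz (c - 1 - N%:Z + (3 * k)%:Z)%R < 3 * k)%N by lia.
  by exists (Ordinal h); rewrite /coord /= ifF; lia.
by have := e (c', Ordinal iN, b); rewrite !ffunE /= ec.
Qed.

(* Gibbs' inequality for the uniform measure on [L] against the product of copies
   of [q] over the blocks of the grid with offset [(o1, o2)]. *)
Let offset_bound (o1 o2 : 'I_k) :
  ln #|L|%:R + (#|L|%:R)^-1 * \sum_(w in L) \sum_(a < J) \sum_(b < J)
      ln (q (win (o1 + k * a) (o2 + k * b) w))
    <= (6 * k * N)%:R * ln #|B|%:R.
Proof.
set p := (#|L|%:R)^-1 : R.
have LR : 0 < #|L|%:R :> R by rewrite ltr0n.
pose f (w : {ffun rect N N -> B}) : {ffun 'I_J * 'I_J -> {ffun rect k k -> B}} :=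
  [ffun ab : 'I_J * 'I_J => win (o1 + k * ab.1) (o2 + k * ab.2) w].
pose F (c : {ffun 'I_J * 'I_J -> {ffun rect k k -> B}} * {ffun 'I_(3 * k) * 'I_N * bool -> B}) :=
  \prod_ab q (c.1 ab).
have F0 c : 0 < F c by apply: prodr_gt0.
have inj : {in L &, injective (fun w => (f w, edge w))}.
  move=> w w' /repP[_ e1] /repP[_ e2] [/ffunP ef ee].
  rewrite -e1 -e2; apply/restrP => -[u1 u2]; rewrite mem_rect /= => hu.
  rewrite -/(y w) -/(y w').
  have [h|h] := boolP (((1 <= u1 <= k%:Z) || (N%:Z - 2 * k%:Z < u1 <= N%:Z))).
    have := @edge_eq w w' u1 (absz (u2 - 1)) true ee h ltac:(lia).
    by have -> : (absz (u2 - 1))%:Z + 1 = u2 by lia.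
  have [h'|h'] := boolP (((1 <= u2 <= k%:Z) || (N%:Z - 2 * k%:Z < u2 <= N%:Z))).
    have := @edge_eq w w' u2 (absz (u1 - 1)) false ee h' ltac:(lia).
    by have -> : (absz (u1 - 1))%:Z + 1 = u1 by lia.
  have o1k := ltn_ord o1; have o2k := ltn_ord o2.
  pose x1 := absz (u1 - 1 - o1%:Z)%R; pose x2 := absz (u2 - 1 - o2%:Z)%R.
  have d1 := divn_eq x1 k; have m1 := ltn_pmod x1 k0.
  have d2 := divn_eq x2 k; have m2 := ltn_pmod x2 k0.
  have x1J : (x1 < J * k)%N by rewrite /x1 mulnC; lia.
  have x2J : (x2 < J * k)%N by rewrite /x2 mulnC; lia.
  have a1 : (x1 %/ k < J)%N by rewrite ltn_divLR.
  have a2 : (x2 %/ k < J)%N by rewrite ltn_divLR.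
  have := ef (Ordinal a1, Ordinal a2); rewrite !ffunE /= => /restrP.
  move=> /(_ ((x1 %% k)%N%:Z + 1, (x2 %% k)%N%:Z + 1)).
  rewrite mem_rect /= => /(_ ltac:(lia)).
  rewrite !shiftE (_ : _ + pos _ _ = (u1, u2)) //.
  have e1' : (o1 + k * (x1 %/ k) = x1 %/ k * k + o1)%N by rewrite addnC mulnC.
  have e2' : (o2 + k * (x2 %/ k) = x2 %/ k * k + o2)%N by rewrite addnC mulnC.
  by rewrite /pos e1' e2'; congr (_, _) => /=; lia.
have p0 : 0 <= p by rewrite invr_ge0.
have sp : \sum_(w in L) p = 1 by rewrite sumr_const -mulr_natl divff // gt_eqF.
have G1 := @gibbs R _ L (fun=> p) (fun w => F (f w, edge w)) (fun _ _ => p0) sp (fun _ _ => F0 _).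
have G2 : ln (\sum_(w in L) F (f w, edge w)) <= (6 * k * N)%:R * ln #|B|%:R.
  have SF : \sum_c F c <= #|B|%:R ^+ (6 * k * N).
    rewrite /F -(pair_bigA _ (fun (c1 : {ffun 'I_J * 'I_J -> {ffun rect k k -> B}})
      (c2 : {ffun 'I_(3 * k) * 'I_N * bool -> B}) => \prod_ab q (c1 ab))) /= exchange_big /=.
    under eq_bigr do rewrite -(bigA_distr_bigA (fun ab u => q u)).
    rewrite sumr_const card_ffun !card_prod !card_ord card_bool.
    rewrite (_ : 3 * k * N * 2 = 6 * k * N)%N; last by lia.
    rewrite -[leLHS]mulr_natl natrX; apply: ler_piMr; first exact: exprn_ge0.
    have q0 : 0 <= \sum_u q u by apply: sumr_ge0 => u _; exact: ltW.
    by rewrite prodr_const exprn_ile1.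
  have B0 : (0 < #|B|)%N by apply/card_gt0P; exists point.
  rewrite mulr_natl -lnXn ?ltr0n // ler_ln ?posrE ?exprn_gt0 ?ltr0n //.
    exact: le_trans (sum_inj_le inj (fun c => ltW (F0 c))) SF.
  case/card_gt0P: Lgt0 => w wL.
  by rewrite (bigD1 w) //= ltr_pwDl // sumr_ge0 // => i _; exact: ltW.
apply: le_trans G2; apply: le_trans G1.
rewrite sumrB -mulr_sumr -mulr_suml sp mul1r lnV ?posrE // opprK addrC lerD2r.
rewrite ler_wpM2l // ler_sum // => w _.
by rewrite /F /= ln_prod // pair_bigA /= ler_sum // => ab _; rewrite ffunE.
Qed.

(** As in Misiurewicz's proof of the variational principle, summing over the [k ^ 2] offsets
    replaces the blocks of a grid by all positions, each met at most once; the positions not met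
    contribute nonnegative terms because [q <= 1]. *)
Lemma block_entropy :
  (k ^ 2)%:R * ln #|L|%:R <= (6 * k ^ 3 * N)%:R * ln #|B|%:R +
    (#|L|%:R)^-1 * \sum_(w in L) \sum_(i < N) \sum_(j < N) - ln (q (win i j w)).
Proof.
have h : \sum_(o1 < k) \sum_(o2 < k) (ln #|L|%:R + (#|L|%:R)^-1 *
    \sum_(w in L) \sum_(a < J) \sum_(b < J) ln (q (win (o1 + k * a) (o2 + k * b) w)))
    <= \sum_(o1 < k) \sum_(o2 < k) (6 * k * N)%:R * ln #|B|%:R.
  by apply: ler_sum => o1 _; apply: ler_sum => o2 _; exact: offset_bound.
move: h; rewrite !sumr_const !card_ord -mulrnA.
rewrite (_ : \sum_(o1 < k) \sum_(o2 < k) _ = (k ^ 2)%:R * ln #|L|%:R +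
  \sum_(o1 < k) \sum_(o2 < k) (#|L|%:R)^-1 *
    \sum_(w in L) \sum_(a < J) \sum_(b < J) ln (q (win (o1 + k * a) (o2 + k * b) w))); last first.
  under eq_bigr do rewrite big_split /= sumr_const card_ord.
  by rewrite big_split /= sumr_const card_ord -mulrnA mulr_natl mulnn.
rewrite -lerBrDr => /le_trans; apply.
rewrite -[X in X - _]mulr_natl mulrA -natrM (_ : k * k * (6 * k * N) = 6 * k ^ 3 * N)%N; last by lia.
rewrite lerD2l.
under eq_bigr do rewrite -mulr_sumr.
rewrite -mulr_sumr -mulrN ler_wpM2l ?invr_ge0 //.
under eq_bigr do rewrite exchange_big /=.
rewrite exchange_big /= -sumrN ler_sum // => w _.
have g0 i j : 0 <= - ln (q (win i j w)) by rewrite oppr_ge0 ln_le0.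
have kJN : (k * J <= N)%N by case: kJ => [|->]; lia.
pose G i j := - ln (q (win i j w)).
apply: (@le_trans _ _ (\sum_(o1 < k) \sum_(a < J) \sum_(o2 < k) \sum_(b < J)
    G (o1 + k * a)%N (o2 + k * b)%N)).
  rewrite -sumrN ler_sum // => o1 _; rewrite exchange_big /= -sumrN ler_sum // => a _.
  by rewrite -sumrN ler_sum // => o2 _; rewrite -sumrN.
apply: (@le_trans _ _ (\sum_(o1 < k) \sum_(a < J) \sum_(j < N) G (o1 + k * a)%N j)).
  apply: ler_sum => o1 _; apply: ler_sum => a _.
  by apply: (@sum_residues R k J N (G (o1 + k * a)%N)) => // i; exact: g0.
apply: (@sum_residues R k J N (fun i => \sum_(j < N) G i j)) => // i.
by apply: sumr_ge0 => j _; exact: g0.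
Qed.
End Blocks.

(** * Shifts and invariant measures *)

Section Shift.
Context {A : alphabetType}.
Implicit Types (x y : config A) (U : set (config A)) (t u : Z2).

Lemma shift_add t u x : shift t (shift u x) = shift (t + u) x.
Proof. by apply/funext => v; rewrite /Defs.shift addrA. Qed.
Lemma shift0 x : shift 0 x = x.
Proof. by apply/funext => v; rewrite /Defs.shift addr0. Qed.

Lemma agree_shift k t x y : agree (k + `|t.1| + `|t.2|) x y ->
  agree k (shift t x) (shift t y).
Proof.
move=> h v h1 h2; rewrite !shiftE; apply: h.
  have -> : (v + t).1 = v.1 + t.1 by []. lia.
have -> : (v + t).2 = v.2 + t.2 by []. lia.
Qed.

Lemma local_shift k t U : local k U -> local (k + `|t.1| + `|t.2|) (shift t @^-1` U).
Proof. by move=> lU x y /agree_shift xy; exact: lU xy. Qed.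

Lemma measurable_shift t :
  measurable_fun setT (shift t : borel_config A -> borel_config A).
Proof.
apply: (@measurability _ _ (borel_config A) (borel_config A) setT (shift t) (@locals A)).
  exact: borel_locals.
move=> _ [U [k lU] <-]; rewrite setTI.
by apply: local_measurable; exact: local_shift lU.
Qed.

Definition mshift t : borel_config A -> borel_config A := shift t.
HB.instance Definition _ t := isMeasurableFun.Build _ _ (borel_config A)
  (borel_config A) (mshift t) (measurable_shift t).

Lemma local_restr (S : {fset Z2}) (w : {ffun S -> A}) : exists k, local k [set x | restr S x = w].
Proof.
exists (\max_(v <- S) maxn `|v.1| `|v.2|)%N => x y xy /= <-; apply/restrP => v vS.
symmetry; apply: xy.
  by apply: leq_trans (leq_bigmax_seq _ vS isT); rewrite leq_maxl.
by apply: leq_trans (leq_bigmax_seq _ vS isT); rewrite leq_maxr.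
Qed.
End Shift.

(** An ultrafilter gives limits of the empirical masses of all sets at once, in place of a diagonal
    extraction. *)
Lemma ultra_lim (R : realType) (G : set_system nat) (f : nat -> R) :
  UltraFilter G -> (forall n, 0 <= f n <= 1) -> exists l : R, f @ G --> l.
Proof.
move=> GU f01.
have PF : ProperFilter (f @ G) by exact: fmap_proper_filter.
have [] := @segment_compact R 0 1 (f @ G) PF.
  have : G (f @^-1` `[0, 1]) by apply: filterE => n; rewrite /= in_itv; exact: f01.
  by [].

move=> l [_ cl]; exists l => V Vl.
have [//|nV] := in_ultra_setVsetC (f @^-1` V) GU.
by have [z []] := cl (~` V) V nV Vl.
Qed.

Section InvariantMeasures.
Context {R : realType} {A : alphabetType} (X : set (config A)).
Variable mu : probability (borel_config A) R.
Hypotheses (sX : is_subshift X) (inv : invariant_on X mu).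

Definition prob U : R := fine (mu U).

Lemma mu_fin (U : set (borel_config A)) : measurable U -> mu U = (prob U)%:E.
Proof. by move=> mU; rewrite /prob fineK // fin_num_measure. Qed.

Lemma mu_setI (U : set (borel_config A)) : measurable U -> mu (X `&` U) = mu U.
Proof.
move=> mU; have mX := closed_borel (proj1 sX).
have hX : mu (~` X) = 0%E by rewrite probability_setC // (proj1 inv) subee.
rewrite -[in RHS](setIT U) -(setUv X) setIUr measureU.
- rewrite [X in (_ + X)%E](_ : _ = 0%E) ?adde0 1?setIC //.
  apply/eqP; rewrite eq_le measure_ge0 andbT -hX le_measure ?inE //.
  + by apply: measurableI => //; exact: measurableC.
  + exact: measurableC.
- exact: measurableI.
- by apply: measurableI => //; exact: measurableC.
- by rewrite setIACA setICr setI0.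
Qed.

Lemma measurable_restr (S : {fset Z2}) (w : {ffun S -> A}) : measurable ([set x | restr S x = w] : set (borel_config A)).
Proof. have [k h] := local_restr w; exact: local_measurable h. Qed.

Lemma prob_cylinder (S : {fset Z2}) (w : {ffun S -> A}) :
  fine (mu (cylinder X w)) = prob [set x | restr S x = w].
Proof. by rewrite /cylinder -[X in mu X]/(X `&` [set x | restr S x = w]) mu_setI //; exact: measurable_restr. Qed.

Lemma prob_ge0 U : 0 <= prob U. Proof. by rewrite fine_ge0. Qed.

Lemma prob_restr0 (S : {fset Z2}) (w : {ffun S -> A}) : w \notin language X S ->
  prob [set x | restr S x = w] = 0.
Proof.
move=> wN; rewrite -prob_cylinder /cylinder (_ : [set x | _] = set0) ?measure0 //.
by apply/seteqP; split=> // x [Xx e]; case/negP: wN; rewrite -e; exact: restr_language.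
Qed.

Lemma prob_shift t (U : set (borel_config A)) : measurable U ->
  prob (shift t @^-1` U) = prob U.
Proof. by move=> mU; rewrite /prob (proj2 inv). Qed.

Lemma prob_partition (S : {fset Z2}) (U : set (borel_config A)) : measurable U ->
  prob U = \sum_w prob (U `&` [set x | restr S x = w]).
Proof.
move=> mU; set D := [set` index_enum {ffun S -> A}].
have e : U = \bigcup_(w in D) (U `&` [set x | restr S x = w]).
  apply/seteqP; split=> [x Ux|x [w _ []//]].
  by exists (restr S x) => //; rewrite /D /= mem_index_enum.
have : mu U = (\sum_w mu (U `&` [set x | restr S x = w]))%E.
  rewrite {1}e measure_fin_bigcup //.
  - by rewrite [RHS]fsbig_seq // index_enum_uniq.
  - exact: finite_seq.
  - apply/trivIsetP => w w' _ _ ww'; apply/seteqP; split=> // x [[_ /= e1] [_ /= e2]].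
    by move: ww'; rewrite -e1 -e2 eqxx.
  - by move=> w _; apply: measurableI => //; exact: measurable_restr.
move=> h; rewrite [in LHS]/prob h.
rewrite (eq_bigr (fun w => (prob (U `&` [set x | restr S x = w]))%:E)) ?sumEFin // => w _.
by apply: mu_fin; apply: measurableI => //; exact: measurable_restr.
Qed.

Lemma prob_sum (S : {fset Z2}) : \sum_(w in language X S) prob [set x | restr S x = w] = 1.
Proof.
have := @prob_partition S setT measurableT; rewrite /prob probability_setT /= => ->.
under [in RHS]eq_bigr do rewrite setTI.
rewrite [RHS](bigID (mem (language X S))) /= [X in _ = _ + X]big1 ?addr0 //.
exact: prob_restr0.
Qed.
End InvariantMeasures.

(** * Limits of empirical measures *)

Section Existence.
Context (R : realType) (A : alphabetType) (X : set (config A)).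
Hypotheses (sX : is_subshift X) (X0 : X !=set0).

Let L n := language X (rect n n).
Let Lgt0 n : 0 < #|L n|%:R :> R. Proof. by rewrite ltr0n card_language_gt0. Qed.

(** The uniform measure on the patterns of a window, each represented by a point of [X], averaged
    over the translations within the window. The index [n.+1] keeps the denominators nonzero. *)
Definition empirical (n : nat) (U : set (config A)) : R :=
  (#|L n.+1|%:R)^-1 * ((n.+1 ^ 2)%:R^-1 *
    \sum_(w in L n.+1) \sum_(i < n.+1) \sum_(j < n.+1)
      (`[< U (shift (pos i j) (rep X w)) >] : nat)%:R).

Let emp_ge0 n U : 0 <= empirical n U.
Proof.
rewrite !mulr_ge0 ?invr_ge0 //; apply: sumr_ge0 => w _.
by apply: sumr_ge0 => i _; apply: sumr_ge0 => j _.
Qed.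

Let emp_add n U V : U `&` V = set0 -> empirical n (U `|` V) = empirical n U + empirical n V.
Proof.
move=> UV; rewrite -!mulrDr -big_split /=; congr (_ * (_ * _)).
apply: eq_bigr => w _; rewrite -big_split; apply: eq_bigr => i _.
rewrite -big_split; apply: eq_bigr => j _ /=; rewrite -natrD; congr _%:R.
set z := shift _ _; case: (asboolP (U z)) => Uz; case: (asboolP (V z)) => Vz.
- by have : (U `&` V) z by []; rewrite UV.
- by rewrite asboolT //; left.
- by rewrite asboolT //; right.
- by rewrite asboolF // => -[].
Qed.

Let emp_X n U : X `<=` U -> empirical n U = 1.
Proof.
move=> XU; rewrite /empirical (eq_bigr (fun=> (n.+1 ^ 2)%:R)) => [|w /repP[Xw _]].
  rewrite sumr_const -[X in _ * (_ * X)]mulr_natl [X in _ * X]mulrCA mulVf.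
    by rewrite mulr1 mulVf // gt_eqF.
  by rewrite pnatr_eq0 -lt0n expn_gt0.
rewrite (eq_bigr (fun=> n.+1%:R)) => [|i _].
  by rewrite sumr_const card_ord -mulrnA mulnn.
rewrite (eq_bigr (fun=> 1)) => [|j _]; first by rewrite sumr_const card_ord.
by rewrite asboolT //; apply: XU; exact: (proj2 sX).
Qed.

Let emp_le1 n U : empirical n U <= 1.
Proof.
have := emp_add n (setICr U); rewrite setUv emp_X // => ->.
by rewrite lerDl.
Qed.

(** The sum telescopes in the direction of [t], leaving the difference of two boundary lines: at
    most [n.+1] out of [n.+1 ^ 2] positions. *)
Let emp_shift n U (t : Z2) : t = (1, 0) \/ t = (0, 1) ->
  `|empirical n (shift t @^-1` U) - empirical n U| <= n.+1%:R^-1.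
Proof.
move=> ht; rewrite /empirical -mulrBr -mulrBr -sumrB.
set S := \sum_(w in _) _.
suff hS : `|S| <= #|L n.+1|%:R * n.+1%:R.
  rewrite !normrM [X in X * _]ger0_norm ?invr_ge0 // [X in _ * (X * _)]ger0_norm ?invr_ge0 //.
  apply: (@le_trans _ _ ((#|L n.+1|%:R)^-1 * ((n.+1 ^ 2)%:R^-1 * (#|L n.+1|%:R * n.+1%:R)))).
    by apply: ler_wpM2l; rewrite ?invr_ge0 //; apply: ler_wpM2l; rewrite ?invr_ge0.
  have c0 : n.+1%:R != 0 :> R by rewrite pnatr_eq0.
  have a0 : #|L n.+1|%:R != 0 :> R by rewrite gt_eqF.
  rewrite natrX; move: (n.+1%:R) (#|L n.+1|%:R) c0 a0 => c a c0 a0.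
  by rewrite le_eqVlt; apply/orP; left; apply/eqP; field; rewrite a0 c0.
apply: (le_trans (ler_norm_sum _ _ _)); rewrite mulr_natl -sumr_const ler_sum // => w _.
pose f (i j : nat) : R := (`[< U (shift (pos i j) (rep X w)) >] : nat)%:R.
have f01 i j : 0 <= f i j <= 1 by rewrite /f; case: asbool; rewrite /= ?lexx ?ler01.
have fd (i j i' j' : nat) : `|f i j - f i' j'| <= 1.
  by rewrite ler_norml; have := f01 i j; have := f01 i' j'; lra.
have tele (g : nat -> R) m : \sum_(i < m) g i.+1 - \sum_(i < m) g i = g m - g 0%N.
  elim: m => [|m IH]; first by rewrite !big_ord0 !subrr.
  by rewrite !big_ord_recr /=; move: IH; lra.
have bd (g h : nat -> R) : (forall j, `|g j - h j| <= 1) ->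
    `|\sum_(j < n.+1) g j - \sum_(j < n.+1) h j| <= n.+1%:R.
  move=> gh; rewrite -sumrB; apply: (le_trans (ler_norm_sum _ _ _)).
  apply: (@le_trans _ _ (\sum_(j < n.+1) 1)); first exact: ler_sum.
  by rewrite sumr_const card_ord.
case: ht => ->.
  have -> : \sum_(i < n.+1) \sum_(j < n.+1)
      (`[< (shift (1, 0) @^-1` U) (shift (pos i j) (rep X w)) >] : nat)%:R
      = \sum_(i < n.+1) \sum_(j < n.+1) f i.+1 j.
    apply: eq_bigr => i _; apply: eq_bigr => j _; rewrite /f /= shift_add.
    do 4 congr (_ _); congr (asbool (U (shift _ _))); rewrite /pos; congr (_, _) => /=; lia.
  by rewrite (tele (fun i => \sum_(j < n.+1) f i j)); apply: bd.
have -> : \sum_(i < n.+1) \sum_(j < n.+1)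
    (`[< (shift (0, 1) @^-1` U) (shift (pos i j) (rep X w)) >] : nat)%:R
    = \sum_(i < n.+1) \sum_(j < n.+1) f i j.+1.
  apply: eq_bigr => i _; apply: eq_bigr => j _; rewrite /f /= shift_add.
  congr (asbool (U (shift _ _)))%:R; rewrite /pos; congr (_, _) => /=; lia.
rewrite -sumrB (eq_bigr (fun i : 'I_n.+1 => f i n.+1 - f i 0%N)) => [|i _]; last exact: tele.
by rewrite sumrB; apply: (bd (fun i => f i n.+1) (fun i => f i 0%N)).
Qed.

Section Limit.
Variable (G : set_system nat).
Hypotheses (GU : UltraFilter G) (nG : \oo `<=` G).

Let emp01 U n : 0 <= empirical n U <= 1. Proof. by rewrite emp_ge0 emp_le1. Qed.

Let ex_lim U : exists l : R, (fun n => empirical n U) @ G --> l.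
Proof. exact: ultra_lim GU (emp01 U). Qed.

Definition lim_content U : R := projT1 (cid (ex_lim U)).
Let m := lim_content.
Let mP U : (fun n => empirical n U) @ G --> m U. Proof. exact: (projT2 (cid (ex_lim U))). Qed.

Let lim_uniq (f : nat -> R) (a b : R) : f @ G --> a -> f @ G --> b -> a = b.
Proof. exact: (@cvg_unique R (@norm_hausdorff _ _) (f @ G)). Qed.

Let m_ge0 U : 0 <= m U.
Proof. by apply: (cvgr_to_ge (@mP U)); apply: nearW. Qed.

Let m_add U V : U `&` V = set0 -> m (U `|` V) = m U + m V.
Proof.
move=> UV; apply: (lim_uniq (@mP _)).
by under eq_fun do rewrite emp_add //; exact: cvgD.
Qed.

Let m_X U : X `<=` U -> m U = 1.
Proof.
move=> XU; apply: (lim_uniq (@mP _)).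
by under eq_fun do rewrite emp_X //; exact: cvg_cst.
Qed.

Let m_shift1 U t : t = (1, 0) \/ t = (0, 1) -> m (shift t @^-1` U) = m U.
Proof.
move=> ht; pose d n := empirical n (shift t @^-1` U) - empirical n U.
have d0 : d @ \oo --> (0 : R).
  have h := @cvg_harmonic R.
  have h' : - (harmonic : nat -> R) @ \oo --> (0 : R) by rewrite -oppr0; exact: cvgN.
  apply: (squeeze_cvgr _ h' h); apply: nearW => n.
  by have := emp_shift n U ht; rewrite ler_norml.
have d0G : d @ G --> (0 : R) by move=> V /d0 /nG.
apply/eqP; rewrite -subr_eq0; apply/eqP; apply: (lim_uniq _ d0G).
exact: cvgB.
Qed.

Let m_shift t U : m (shift t @^-1` U) = m U.
Proof.
pose P t := forall U, m (shift t @^-1` U) = m U.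
have P0 : P 0.
  by move=> V; congr m; apply/funext => x /=; rewrite /preimage /= shift0.
have PD a b : P a -> P b -> P (a + b).
  move=> Pa Pb V; rewrite -(Pa V) -[RHS]Pb; congr m; apply/funext => x.
  by rewrite /preimage /= shift_add.
have PN a : P a -> P (- a).
  move=> Pa V; rewrite -[LHS]Pa; congr m; apply/funext => x.
  by rewrite /preimage /= shift_add addNr shift0.
have Pn a (n : nat) : P a -> P (a *+ n).
  by move=> Pa; elim: n => [|n IH]; rewrite ?mulr0n // mulrS; exact: PD.
have Pz a (z : int) : P a -> P (a *~ z).
  by move=> Pa; case: z => n; [exact: Pn|apply: PN; exact: Pn].
have -> : t = (1, 0) *~ t.1 + (0, 1) *~ t.2.
  case: t => i j /=; apply/eqP; rewrite xpair_eqE.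
  have e1 (z : int) : ((1, 0) : Z2) *~ z = (z, 0).
    have e (n : nat) : ((1, 0) : Z2) *+ n = (n%:Z, 0).
      by elim: n => // n IH; rewrite mulrSr IH; congr (_, _) => /=; lia.
    by case: z => n; rewrite /intmul e //; congr (_, _); lia.
  have e2 (z : int) : ((0, 1) : Z2) *~ z = (0, z).
    have e (n : nat) : ((0, 1) : Z2) *+ n = (0, n%:Z).
      by elim: n => // n IH; rewrite mulrSr IH; congr (_, _) => /=; lia.
    by case: z => n; rewrite /intmul e //; congr (_, _); lia.
  by rewrite e1 e2 /=; lia.
by apply: PD; apply: Pz => V; apply: m_shift1; [left|right].
Qed.

Lemma lim_invariant : exists mu : probability (borel_config A) R,
  invariant_on X mu /\ forall k U, local k U -> mu U = (m U)%:E.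
Proof.
have [mu hmu] := extend_content m_ge0 m_add (m_X (@subsetT _ X)).
exists mu; split=> //; split.
  (* As [X] is closed, its complement is the union of the local sets [V k]; each misses [X] and
     hence is null. *)
  pose V k : set (borel_config A) := [set x | forall y, agree k x y -> (~` X) y].
  have lV k : local k (V k).
    by move=> x y xy hx z yz; apply: hx; exact: agree_trans yz.
  have mV k : measurable (V k) by exact: local_measurable (lV k).
  have V0 k : mu (V k) = 0%E.
    rewrite (hmu k _ (lV k)); congr (_%:E).
    have XV : X `<=` ~` V k by move=> x Xx Vx; exact: (Vx x).
    have := m_add (setICr (V k)); rewrite setUv (m_X (@subsetT _ X)) (m_X XV) => h.
    by apply: (addIr 1); rewrite -h add0r.
  have oX : open (~` X) by apply: closed_openC; exact: (proj1 sX).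
  have XC : ~` X = \bigcup_k V k.
    rewrite eqEsubset; split=> [x Xx|x [k _]]; last by apply.
    by have /nbhs_agreeP[k hk] := open_nbhs_nbhs (conj oX Xx); exists k.
  have mX := closed_borel (proj1 sX).
  have : mu (~` X) = 0%E.
    apply/eqP; rewrite eq_le measure_ge0 andbT XC.
    apply: (le_trans (measure_sigma_subadditive mu mV _ (@subset_refl _ _))).
      exact: bigcupT_measurable.
    by rewrite eseries0 // => *; exact: V0.
  rewrite probability_setC // => /eqP; rewrite sube_eq // add0e => /eqP //.
move=> t E mE; apply/esym.
apply: (@borel_unique A R mu (pushforward mu (mshift t))) => //.
  exact: (le_lt_trans (probability_le1 mu measurableT) (ltry _)).
move=> k U lU; apply: (etrans (hmu _ _ lU)); apply: esym.
by apply: (etrans (hmu _ _ (local_shift (t := t) lU))); rewrite m_shift.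
Qed.

Let C k (u : {ffun rect k k -> A}) : set (config A) := [set x | restr (rect k k) x = u].
Arguments C : clear implicits.

Lemma empirical_bound k n (q : {ffun rect k k -> A} -> R) : (0 < k)%N ->
  (forall u, 0 < q u) -> \sum_u q u <= 1 ->
  (k ^ 2)%:R * ((n.+1%:R ^+ 2)^-1 * lnL R X n.+1 n.+1) <=
  (6 * k ^ 3)%:R * ln #|A|%:R * n.+1%:R^-1 + \sum_u empirical n (C k u) * - ln (q u).
Proof.
move=> k0 q0 q1; have h := block_entropy X0 n.+1 k0 q0 q1.
have e : \sum_u empirical n (C k u) * - ln (q u) = (#|L n.+1|%:R)^-1 * ((n.+1 ^ 2)%:R^-1 *
    \sum_(w in L n.+1) \sum_(i < n.+1) \sum_(j < n.+1)
      - ln (q (restr (rect k k) (shift (pos i j) (rep X w))))).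
  rewrite /empirical.
  under eq_bigr do rewrite -!mulrA mulr_suml.
  rewrite -!mulr_sumr; congr (_ * (_ * _)); rewrite exchange_big /=.
  apply: eq_bigr => w _; under eq_bigr do rewrite mulr_suml.
  rewrite exchange_big /=; apply: eq_bigr => i _.
  under eq_bigr do rewrite mulr_suml.
  rewrite exchange_big /=; apply: eq_bigr => j _.
  rewrite (bigD1 (restr (rect k k) (shift (pos i j) (rep X w)))) //= asboolT // mul1r.
  rewrite big1 ?addr0 // => u /eqP hu; rewrite asboolF ?mul0r // => hu'.
  by apply: hu; rewrite -hu'.
rewrite e; set T := \sum_(w in _) _ in h *.
have c0 : 0 < n.+1%:R :> R by [].
have -> : (6 * k ^ 3)%:R * ln #|A|%:R * n.+1%:R^-1 + (#|L n.+1|%:R)^-1 * ((n.+1 ^ 2)%:R^-1 * T)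
  = (n.+1%:R ^+ 2)^-1 * ((6 * k ^ 3 * n.+1)%:R * ln #|A|%:R + (#|L n.+1|%:R)^-1 * T).
  rewrite natrX [in RHS]natrM; move: (Lgt0 n.+1) c0; move: (n.+1%:R) (#|L n.+1|%:R) => c a a0 c0.
  by field; rewrite !gt_eqF.
by rewrite mulrCA ler_pM2l // invr_gt0 exprn_gt0.
Qed.

(** For fixed [q] the cross entropy is linear in the masses of finitely many cylinders, so it passes
    to the limit along [G]. *)
Lemma lim_cross k (q : {ffun rect k k -> A} -> R) : (0 < k)%N ->
  (forall u, 0 < q u) -> \sum_u q u <= 1 ->
  (k ^ 2)%:R * entropy R X <= \sum_u m (C k u) * - ln (q u).
Proof.
move=> k0 q0 q1.
have h1 : (fun n => (k ^ 2)%:R * ((n.+1%:R ^+ 2)^-1 * lnL R X n.+1 n.+1)) @ G -->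
    (k ^ 2)%:R * entropy R X.
  apply: cvgM; first exact: cvg_cst.
  have := @entropy_square A R X sX X0.
  by rewrite -(cvg_shiftS (fun n : nat => (n%:R ^+ 2)^-1 * lnL R X n n : R)) => h V /h /nG.
have h2 : (fun n => (6 * k ^ 3)%:R * ln #|A|%:R * n.+1%:R^-1 +
    \sum_u empirical n (C k u) * - ln (q u)) @ G --> \sum_u m (C k u) * - ln (q u).
  rewrite -[X in _ --> X]add0r; apply: cvgD.
    rewrite -[X in _ --> X](mulr0 ((6 * k ^ 3)%:R * ln #|A|%:R)); apply: cvgM; first exact: cvg_cst.
    have := @cvg_harmonic R; by move=> h V /h /nG.
  elim: (index_enum _) => [|u r IH].
    by under eq_fun do rewrite big_nil; rewrite big_nil; exact: cvg_cst.
  under eq_fun do rewrite big_cons.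
  rewrite big_cons; apply: cvgD IH; apply: cvgM; [exact: mP|exact: cvg_cst].
rewrite -subr_ge0; apply: (cvgr_to_ge (cvgB h2 h1)); apply: nearW => n.
by rewrite subr_ge0; exact: empirical_bound.
Qed.

End Limit.
End Existence.

Section MME.
Context (R : realType) (A : alphabetType) (X : set (config A)).
Hypotheses (sX : is_subshift X) (X0 : X !=set0).
Implicit Type mu : probability (borel_config A) R.

Definition shannon mu N : R := \sum_(w in language X (rect N N))
  - (fine (mu (cylinder X w)) * ln (fine (mu (cylinder X w)))).

Lemma shannon_prob mu N : invariant_on X mu -> shannon mu N =
  \sum_(w in language X (rect N N))
    - (prob mu [set x | restr (rect N N) x = w] * ln (prob mu [set x | restr (rect N N) x = w])).
Proof. by move=> inv; apply: eq_bigr => w _; rewrite (prob_cylinder sX inv). Qed.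

Lemma shannon_le mu N : invariant_on X mu -> shannon mu N <= lnL R X N N.
Proof.
move=> inv; rewrite shannon_prob //.
have := @gibbs R _ (language X (rect N N)) (fun w => prob mu [set x | restr (rect N N) x = w])
  (fun=> 1) (fun w _ => prob_ge0 _ _) (prob_sum sX inv _) (fun _ _ => ltr01).
rewrite sumr_const => h; apply: le_trans h; apply: ler_sum => w _.
by rewrite ln1 mulr0 sub0r.
Qed.

(** Cross entropy against a perturbation of the block distribution of the limit gives
    [k ^ 2 * entropy R X <= shannon mu k] for all [k > 0]. As [shannon mu k] is at most
    [lnL R X k k], the averages are squeezed. *)
Lemma exists_max_entropy_measure : exists mu, max_entropy_measure X mu.
Proof.
have [G [GU nG]] := ultraFilterLemma eventually_filter.
have [mu [inv hmu]] := lim_invariant R sX X0 GU nG.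
exists mu; split=> //.
have pE (S : {fset Z2}) (w : {ffun S -> A}) :
    prob mu [set x | restr S x = w] = lim_content R sX X0 GU [set x | restr S x = w].
  by have [k lk] := local_restr w; rewrite /prob (hmu _ _ lk).
have key k : (0 < k)%N -> (k ^ 2)%:R * entropy R X <= shannon mu k.
  move=> k0; rewrite shannon_prob //.
  pose p (w : {ffun rect k k -> A}) := prob mu [set x | restr (rect k k) x = w].
  have p0 w : 0 <= p w by exact: prob_ge0.
  have sp : \sum_w p w = 1.
    have := @prob_partition R A mu (rect k k) setT measurableT.
    rewrite {1}/prob probability_setT /= => ->.
    by apply: eq_bigr => w _; rewrite setTI.
  have M0 : (0 < #|{ffun rect k k -> A}|)%N by apply/card_gt0P; exists [ffun=> point].
  have MR : 0 < #|{ffun rect k k -> A}|%:R :> R by rewrite ltr0n.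
  have -> : \sum_(w in language X (rect k k)) - (p w * ln (p w)) = \sum_w - (p w * ln (p w)).
    rewrite [RHS](bigID (mem (language X (rect k k)))) /= [X in _ = _ + X]big1 ?addr0 //.
    by move=> w wN; rewrite /p (prob_restr0 sX inv wN) mul0r oppr0.
  apply/ler_addgt0Pr => d d0.
  (* [q] has to be positive, so [p] is mixed with the uniform distribution; [expR (- d) * p <= q]
     costs at most [d]. *)
  pose e : R := 1 - expR (- d).
  have e1 : e < 1 by rewrite /e gtrBl expR_gt0.
  have e0 : 0 < e by rewrite subr_gt0 expR_lt1 oppr_lt0.
  pose q w := (1 - e) * p w + e / #|{ffun rect k k -> A}|%:R.
  have q0 w : 0 < q w.
    by rewrite /q ltr_wpDl ?divr_gt0 // mulr_ge0 ?p0 // subr_ge0 ltW.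
  have sq : \sum_w q w <= 1.
    rewrite big_split /= -mulr_sumr sp mulr1 sumr_const -[X in _ + X]mulr_natr.
    by rewrite divfK ?gt_eqF // subrK.
  apply: (le_trans (lim_cross sX X0 GU nG k0 q0 sq)).
  rewrite -[d]mul1r -sp mulr_suml -big_split /=; apply: ler_sum => w _.
  rewrite -pE -/(p w).
  have [->|pw] := eqVneq (p w) 0; first by rewrite !mul0r oppr0 addr0.
  have pw0 : 0 < p w by rewrite lt_neqAle eq_sym pw p0.
  rewrite -mulrN -mulrDr ler_pM2l // lerNl opprD opprK -[- d]expRK.
  rewrite -lnM ?posrE ?expR_gt0 // ler_ln ?posrE ?mulr_gt0 ?expR_gt0 //.
  rewrite /q (_ : 1 - e = expR (- d)); last by rewrite /e; ring.
  by rewrite mulrC lerDl divr_ge0 // ltW.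
rewrite /measure_entropy; apply: cvg_lim => //.
apply: (@squeeze_cvgr _ _ _ _ (fun=> entropy R X) (fun N => (N%:R ^+ 2)^-1 * lnL R X N N)).
- exists 1%N => // N /= N1.
  have NR : 0 < N%:R ^+ 2 :> R by rewrite exprn_gt0 // ltr0n.
  apply/andP; split; last by rewrite ler_pM2l ?invr_gt0 //; exact: shannon_le.
  by rewrite mulrC ler_pdivlMr // mulrC -natrX; exact: key.
- exact: cvg_cst.
- exact: entropy_square.
Qed.

End MME.

(** * The shift of finite type *)

(* Only units carry free symbols; elsewhere the symbol is [ord0]. *)
Definition letter (q : nat) : Type := (tile * 'I_q.+1)%type.
HB.instance Definition _ q := Finite.on (letter q).
HB.instance Definition _ q := isPointed.Build (letter q) ((Lo, Lo, Lo), ord0).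

Section System.
Variable q : nat.
Implicit Types x y : config (letter q).

Definition tiles x : plane := fun i j => (x (i, j) : letter q).1.
Definition symbol x (v : Z2) : 'I_q.+1 := (x v : letter q).2.

Definition good x : Prop :=
  [/\ tile_ok (tiles x 0 0), hok (tiles x 0 0) (tiles x 1 0),
      vok (tiles x 0 0) (tiles x 0 1) &
      ~~ is_unit (tiles x 0 0) -> symbol x (0, 0) = ord0].

Definition system : set (config (letter q)) := [set x | forall t, good (shift t x)].

Definition corner : {fset Z2} := [fset (0, 0); (1, 0); (0, 1)]%fset.

Lemma good_corner x y : restr corner x = restr corner y -> good x -> good y.
Proof.
move=> /restrP h.
have h0 : x (0, 0) = y (0, 0) by apply: h; rewrite !inE eqxx.
have h1 : x (1, 0) = y (1, 0) by apply: h; rewrite !inE eqxx ?orbT.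
have h2 : x (0, 1) = y (0, 1) by apply: h; rewrite !inE eqxx ?orbT.
by rewrite /good /tiles /symbol h0 h1 h2.
Qed.

Lemma system_subshift : is_subshift system.
Proof.
split; last by move=> t x hx u; rewrite shift_add; exact: hx.
have -> : system = \bigcap_t [set x | good (shift t x)].
  by apply/seteqP; split=> x hx t; [move=> _; exact: hx|exact: hx].
apply: closed_bigI => t _; rewrite -openC.
apply: (@open_local _ (1 + `|t.1| + `|t.2|)%N) => x y /agree_shift xy /= nx gy; apply: nx.
apply: good_corner gy; apply/restrP => v hv; symmetry; apply: xy;
  by move: hv; rewrite !inE => /orP[/orP[]|] /eqP ->.
Qed.

Lemma system_sft : is_sft system.
Proof.
split; first exact: system_subshift.
exists [set (existT _ corner (restr corner x) : pattern (letter q)) | x in [set x | ~ good x]].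
  apply: (@sub_finite_set _ _ ((fun w : {ffun corner -> letter q} => existT _ corner w : pattern (letter q)) @` setT)).
    by move=> _ [x _ <-]; exists (restr corner x).
  by apply: finite_image; exact: finite_finset.
apply/seteqP; split=> x hx.
  by move=> _ [y ny <-] [t /= e]; apply: ny; exact: good_corner e (hx t).
move=> t; apply: contrapT => nx.
by apply: (hx (existT _ corner (restr corner (shift t x)))); [exists (shift t x)|exists t].
Qed.

Lemma systemP x : system x <->
  valid (tiles x) /\ forall v : Z2, ~~ is_unit (tiles x v.1 v.2) -> symbol x v = ord0.
Proof.
split=> [hx|[hv hs] [i j]].
  split=> [i j|[i j]].
    have [] := hx (i, j); rewrite /tiles /Defs.shift.
    have e0 : (0, 0) + (i, j) = (i, j) :> Z2 by rewrite add0r.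
    have e1 : (1, 0) + (i, j) = (i + 1, j) :> Z2 by congr (_, _) => /=; lia.
    have e2 : (0, 1) + (i, j) = (i, j + 1) :> Z2 by congr (_, _) => /=; lia.
    by rewrite e0 e1 e2.
  have [_ _ _] := hx (i, j); rewrite /tiles /symbol /Defs.shift.
  by have -> : (0, 0) + (i, j) = (i, j) :> Z2 by rewrite add0r.
have e0 : (0, 0) + (i, j) = (i, j) :> Z2 by rewrite add0r.
have e1 : (1, 0) + (i, j) = (i + 1, j) :> Z2 by congr (_, _) => /=; lia.
have e2 : (0, 1) + (i, j) = (i, j + 1) :> Z2 by congr (_, _) => /=; lia.
have [h1 h2 h3] := hv i j; have h4 := hs (i, j).
by rewrite /good /tiles /symbol /Defs.shift e0 e1 e2.
Qed.

Definition fill (s : plane) (f : Z2 -> 'I_q.+1) : config (letter q) :=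
  fun v => (s v.1 v.2, if is_unit (s v.1 v.2) then f v else ord0) : letter q.

Lemma fill_system s f : valid s -> system (fill s f).
Proof.
move=> vs; apply/systemP; split; first exact: vs.
by move=> [i j]; rewrite /symbol /fill /tiles /= => /negbTE ->.
Qed.

Definition translate (s : plane) (a b : int) : plane := fun i j => s (i + a) (j + b).

Lemma translate_valid s a b : valid s -> valid (translate s a b).
Proof.
move=> vs i j; have := vs (i + a) (j + b); rewrite /translate.
have -> : i + 1 + a = i + a + 1 by lia.
by have -> : j + 1 + b = j + b + 1 by lia.
Qed.

Lemma square_translate s k a b (x y : int) r : square s k x y r ->
  square (translate s a b) k (x - a) (y - b) r.
Proof.
elim: k x y r => [|k IH] x y r [hr hq]; (split; [|by [] || move=> i j]).
- by move=> i j hi hj hb; rewrite /translate hr /kind_at; [congr (_, _, _); congr (_, _); lia|move: hi => /=; lia|move: hj => /=; lia|move: hb => /=; lia].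
- by move=> i j hi hj hb; rewrite /translate hr /kind_at; [congr (_, _, _); congr (_, _); lia|lia|lia|lia].
- have := IH _ _ _ (hq i j); congr square; lia.
Qed.

Lemma window_square m : exists2 s : plane, valid s & square s m 1 1 (false, false).
Proof.
exists (translate model (- m%:Z - 1) (- m%:Z - 1)).
  by apply: translate_valid; exact: model_valid.
by have := square_translate (- m%:Z - 1) (- m%:Z - 1) (model_square m); congr square; lia.
Qed.

(** The subsquares of level [0] of a square of level [m] are [4 ^ m] units, whose symbols are
    free. *)
Lemma card_system m : (q.+1 ^ (4 ^ m) <= #|language system (rect (sideN m) (sideN m))|)%N.
Proof.
have [s vs sq] := window_square m.
have [l [ul zl hl]] := subsquares sq (leq0n m); rewrite subn0 in zl.
pose f (c : {ffun 'I_(4 ^ m) -> 'I_q.+1}) := fill s (fun v : Z2 =>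
   if insub (index v l) is Some i then c i else ord0).
rewrite -{1}(card_ord q.+1) -{1}(card_ord (4 ^ m)) -card_ffun -cardsT.
apply: (@card_language_ge _ _ _ _ _ f) => [c _|c c' _ _ /restrP h].
  exact: fill_system.
apply/ffunP => i; have il : (i < size l)%N by rewrite zl.
pose v := nth (0, 0) l i.
have vl : v \in l by exact: mem_nth.
have [[r hs] h1 h2 h3 h4] := hl v vl; have sm := sideNE m.
have vr : v \in rect (sideN m) (sideN m).
  by move: h1 h2 h3 h4; rewrite mem_rect sm; move: v.1 v.2 (side m) => a b D /=; lia.
have := h v vr; rewrite /f /fill.
have hu : is_unit (s v.1 v.2).
  have [hr _] := hs; rewrite hr ?kind_at_One ?eqxx //=; lia.
rewrite hu.
by rewrite index_uniq // valK => -[].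
Qed.
End System.

(** * Entropy of the system and cost of the tile layer *)

Section Size.
Variable R : realType.

Lemma sideE k : side k = 3 * 2 ^+ k - 2.
Proof. by elim: k => // k; rewrite exprS /=; lia. Qed.

Lemma side_real k : (sideN k)%:R = 3 * 2 ^+ k - 2 :> R.
Proof.
have -> : (sideN k)%:R = ((side k)%:~R : R) by rewrite -sideNE.
by rewrite sideE rmorphB rmorphM rmorphXn.
Qed.

Lemma sideN_cvg (T : topologicalType) (f : nat -> T) (l : T) :
  f @ \oo --> l -> (fun m => f (sideN m)) @ \oo --> l.
Proof.
move=> fl V /fl [N _ hN]; exists N => // m /= Nm; apply: hN => /=.
by have := side_ge m; rewrite -sideNE; lia.
Qed.

Lemma system_nonempty q : @system q !=set0.
Proof. by exists (fill model (fun=> ord0)); apply: fill_system; exact: model_valid. Qed.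

Lemma entropy_system q : ln q.+1%:R / 9 <= entropy R (@system q).
Proof.
have h := sideN_cvg (@entropy_square _ R _ (system_subshift q) (system_nonempty q)).
apply: (cvgr_to_ge h); apply: nearW => m.
have D0 : 0 < (sideN m)%:R :> R by rewrite ltr0n; have := side_ge m; rewrite -sideNE; lia.
have D9 : (sideN m)%:R ^+ 2 <= 9 * 4 ^+ m :> R.
  rewrite (_ : 9 * 4 ^+ m = (3 * 2 ^+ m) ^+ 2); last first.
    by rewrite exprMn -exprM mulnC exprM; congr (_ * _ ^+ m); ring.
  by rewrite ler_pXn2r ?nnegrE ?(ltW D0) ?mulr_ge0 ?exprn_ge0 // side_real; lra.
have h1 : ln q.+1%:R * 4 ^+ m <= lnL R (@system q) (sideN m) (sideN m).
  have -> : ln q.+1%:R * 4 ^+ m = ln (q.+1 ^ (4 ^ m))%:R :> R.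
    by rewrite natrX lnXn // -[RHS]mulr_natr natrX.
  by rewrite ler_ln ?posrE ?ltr0n ?expn_gt0 ?card_language_gt0 ?ler_nat ?card_system //; exact: system_nonempty.
rewrite [leRHS]mulrC ler_pdivlMr ?exprn_gt0 //.
apply: le_trans h1; rewrite -mulrA ler_wpM2l ?ln_ge0 ?ler1n //.
by rewrite ler_pdivrMl.
Qed.

Lemma large_entropy (M : R) : exists q, M < entropy R (@system q).
Proof.
exists (Num.truncn (expR (9 * (M + 1)))); apply: lt_le_trans (entropy_system _).
rewrite ltr_pdivlMr // mulrC; apply: (@lt_le_trans _ _ (9 * (M + 1))); first by lra.
rewrite -[X in X <= _](expRK (9 * (M + 1))) ler_ln ?posrE ?expR_gt0 //.
exact/ltW/truncnS_gt.
Qed.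
End Size.

Section TileCount.
Variable R : realType.

(** In [(1 + e * x / 2) ^ 2 <= expR (e * x)] the quadratic term [(e * x) ^ 2 / 4] already dominates
    [c * x]. *)
Lemma ln1Dx_le (e c x : R) : 0 < e -> 0 <= c -> 4 * c <= e ^+ 2 * x -> ln (1 + c * x) <= e * x.
Proof.
move=> e0 c0 cx.
have x0 : 0 <= x by rewrite -(@pmulr_rge0 _ (e ^+ 2)) ?exprn_gt0 //; lra.
have cx0 : 0 < 1 + c * x by rewrite ltr_pwDl // mulr_ge0.
rewrite -[leRHS]expRK ler_ln ?posrE ?expR_gt0 //.
have h := @expR_ge1Dx R (e * x / 2).
have -> : expR (e * x) = expR (e * x / 2) ^+ 2 by rewrite -expRM_natl; congr expR; field.
have ex0 : 0 <= e * x by rewrite mulr_ge0 // ltW.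
apply: (@le_trans _ _ ((1 + e * x / 2) ^+ 2)); last by rewrite ler_pXn2r ?nnegrE ?expR_ge0 //; lra.
by nra.
Qed.

Lemma tile_code_small (d : R) : 0 < d -> exists N0, forall M, (N0 <= M)%N ->
  exists C : finType, exists2 cd : plane -> C,
    (forall s s', valid s -> valid s' -> cd s = cd s' ->
       forall x y, 0 <= x < M%:Z -> 0 <= y < M%:Z -> s x y = s' x y) &
    ln #|C|%:R <= d * M%:R ^+ 2.
Proof.
(* Since [L <= 2 * M], the marks cost [8 * e * M ^ 2 = d / 2 * M ^ 2] up to terms linear in [M]. The
   level [n] is chosen so that [ln (1 + 128 * b) <= e * b], whence [512 = 4 * 128]. *)
move=> d0; pose e := d / 16; have e0 : 0 < e by rewrite divr_gt0.
pose n := (Num.truncn (512 / e ^+ 2)).+1.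
pose b := (sideN n).-1; have sn := side_ge n.
have nb : (n <= b)%N by rewrite /b; move: sn; rewrite -sideNE; lia.
have b0 : (0 < b)%N by apply: leq_trans nb.
have bR : 0 < b%:R :> R by rewrite ltr0n.
have hb : ln (1 + 128 * b%:R) <= e * b%:R.
  apply: ln1Dx_le => //; rewrite -ler_pdivrMl ?exprn_gt0 // mulrC.
  rewrite (_ : 4 * 128 = 512); last by ring.
  by apply: (@le_trans _ _ n%:R); [exact/ltW/truncnS_gt|rewrite ler_nat].
pose c : R := 4 * ln 64 + 4 * (e * b%:R).
pose N0 := maxn (sideN n) (Num.truncn (2 * c / d)).+1.
exists N0 => M; rewrite geq_max => /andP[M1 M2].
have [C [cd h1 h2]] := code_card M (isT : (0 < n)%N).
exists C, cd => //.
have ln64 : 0 <= ln 64 :> R by apply: ln_ge0; lra.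
have [C0|C0] := posnP #|C|.
  by rewrite C0 ln0 // mulr_ge0 ?exprn_ge0 // ltW.
set L := (M + sideN n)%N in h2; rewrite -/b in h2.
have LM : L%:R <= 2 * M%:R :> R by rewrite -natrM ler_nat /L; lia.
have Lb : (L %/ b).+1%:R <= 2 * M%:R / b%:R + 1 :> R.
  rewrite -addn1 natrD lerD2r ler_pdivlMr // -natrM -natrM ler_nat.
  apply: leq_trans (leq_divM _ _) _; rewrite /L; lia.
have b1 : 0 < 1 + 128 * b%:R :> R by rewrite ltr_pwDl // mulr_ge0.
have lb0 : 0 <= ln (1 + 128 * b%:R) :> R by apply: ln_ge0; rewrite lerDl mulr_ge0.
apply: (@le_trans _ _ (2 * L%:R * ln 64 + 2 * L%:R * (L %/ b).+1%:R * ln (1 + 128 * b%:R))).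
  have -> : 2 * L%:R * ln 64 + 2 * L%:R * (L %/ b).+1%:R * ln (1 + 128 * b%:R) =
      ln ((64 ^ (2 * L) * (1 + 128 * b) ^ (2 * (L * (L %/ b).+1)))%N%:R) :> R.
    rewrite natrM !natrX lnM ?posrE ?exprn_gt0 ?ltr0n //.
    rewrite !lnXn ?ltr0n // -[X in _ = X + _]mulr_natl -[X in _ = _ + X]mulr_natl.
    by rewrite natrD !natrM mulrA.
  by rewrite ler_ln ?posrE ?ltr0n ?ler_nat // muln_gt0 !expn_gt0.
have M0 : 0 < M%:R :> R by rewrite ltr0n; apply: leq_trans M2.
have L0 : 0 <= L%:R :> R by [].
apply: (@le_trans _ _ (2 * (2 * M%:R) * ln 64 + 2 * (2 * M%:R) * (2 * M%:R / b%:R + 1) * (e * b%:R))).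
  apply: lerD; first by rewrite ler_wpM2r // ler_wpM2l.
  rewrite ler_pM ?mulr_ge0 // ler_pM ?mulr_ge0 // ler_wpM2l //.
have -> : 2 * (2 * M%:R) * ln 64 + 2 * (2 * M%:R) * (2 * M%:R / b%:R + 1) * (e * b%:R) =
   d / 2 * M%:R ^+ 2 + c * M%:R.
  by rewrite /c /e; field; rewrite gt_eqF.
have : 2 * c / d <= M%:R.
  by apply: (@le_trans _ _ (Num.truncn (2 * c / d)).+1%:R); [exact/ltW/truncnS_gt|rewrite ler_nat].
rewrite ler_pdivrMr // => h.
have : 2 * c * M%:R <= M%:R * d * M%:R by rewrite ler_wpM2r // ltW.
by rewrite expr2; lra.
Qed.
End TileCount.

(** * Factors *)

Section Occurrences.
Context (R : realType) (B : alphabetType) (l : nat) (u : {ffun rect l l -> B}).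
Implicit Types (y z : config B).

Definition hit y : R := (restr (rect l l) y == u)%:R.

(** The pattern would also fit at [i = N - l] or [j = N - l]; without these the number of positions
    is [(N - l) ^ 2]. *)
Definition occ N y : R := \sum_(i < N - l) \sum_(j < N - l) hit (shift (pos i j) y).

Lemma hit_ge0 y : 0 <= hit y. Proof. by rewrite /hit. Qed.
Lemma hit_le1 y : hit y <= 1. Proof. by rewrite /hit; case: eqP; rewrite ?lexx ?ler01. Qed.

Lemma window_eq N y z (i j : nat) : (i < N - l)%N -> (j < N - l)%N ->
  restr (rect N N) y = restr (rect N N) z ->
  restr (rect l l) (shift (pos i j) y) = restr (rect l l) (shift (pos i j) z).
Proof.
move=> iN jN /restrP yz; apply/restrP => -[v1 v2]; rewrite mem_rect /= => hv.
rewrite !shiftE; apply: yz; rewrite mem_rect /=; lia.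
Qed.

Lemma occ_eq N y z : restr (rect N N) y = restr (rect N N) z -> occ N y = occ N z.
Proof.
move=> yz; apply: eq_bigr => i _; apply: eq_bigr => j _.
by rewrite /hit (window_eq _ _ yz).
Qed.

Lemma expected_occ (Y : set (config B)) (nu : probability (borel_config B) R) N :
  is_subshift Y -> invariant_on Y nu ->
  \sum_(w in language Y (rect N N)) prob nu [set y | restr (rect N N) y = w] * occ N (rep Y w) =
  ((N - l) ^ 2)%:R * prob nu [set y | restr (rect l l) y = u].
Proof.
move=> sY inv; set U := [set y | restr (rect l l) y = u].
have mU : measurable (U : set (borel_config B)) by exact: measurable_restr.
under eq_bigr do rewrite mulr_sumr; rewrite exchange_big /=.
rewrite (eq_bigr (fun=> (N - l)%:R * prob nu U)) => [|i _].
  by rewrite sumr_const card_ord -mulrnAl -mulrnA mulnn.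
under eq_bigr do rewrite mulr_sumr; rewrite exchange_big /=.
rewrite (eq_bigr (fun=> prob nu U)) => [|j _]; first by rewrite sumr_const card_ord mulr_natl.
have mS : measurable (shift (pos i j) @^-1` U : set (borel_config B)).
  have [k lk] := local_restr u; exact: local_measurable (local_shift (t := pos i j) lk).
rewrite -(prob_shift inv (pos i j) mU) (prob_partition nu (rect N N) mS).
rewrite [RHS](bigID (mem (language Y (rect N N)))) /= [X in _ = _ + X]big1 ?addr0.
  apply: eq_bigr => w wL; have [_ ew] := repP wL.
  rewrite /hit; case: eqP => h; rewrite ?mulr1 ?mulr0.
    congr (prob nu); apply/seteqP; split=> [y /= yw|y []//]; split=> //=.
    by rewrite /U /= -h; apply: (window_eq (N := N)) => //; rewrite yw ew.
  rewrite (_ : _ `&` _ = set0); first by rewrite /prob measure0.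
  apply/seteqP; split=> // y [/= yu yw]; apply: h; rewrite -yu.
  by apply: (window_eq (N := N)) => //; rewrite yw ew.
move=> w wN; apply: le_anti; rewrite prob_ge0 andbT -(prob_restr0 sY inv wN).
have mw := measurable_restr w.
rewrite -lee_fin -!mu_fin //; last exact: measurableI.
by apply: le_measure; rewrite ?inE //; exact: measurableI.
Qed.
End Occurrences.

Lemma square_local s s' k x y c : square s k x y c ->
  (forall x' y', x <= x' < x + side k -> y <= y' < y + side k -> s x' y' = s' x' y') ->
  square s' k x y c.
Proof.
elim: k x y c => [|k IH] x y c [hr hq] h; split=> //.
- by move=> x' y' hx hy hb; rewrite -h //; exact: hr.
- by move=> x' y' hx hy hb; rewrite -h //; exact: hr.
move=> i j; apply: IH (hq i j) _ => x' y' hx hy; apply: h; move: hx hy => /=; case: i; case: j; lia.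
Qed.

(** * Squares of a fixed level in a window *)

Section Islands.
Context (q : nat) (B : alphabetType) (Y : set (config B)) (phi : config (letter q) -> config B).
Local Notation X := (@system q).
Hypothesis phi_factor : factor_map X Y phi.
Variable r : nat.
Hypothesis phi_range : forall x y, X x -> X y -> agree r x y -> phi x (0, 0) = phi y (0, 0).
Implicit Types x y z : config (letter q).

Lemma phi_local x x' (v v' : Z2) : X x -> X x' ->
  (forall u : Z2, (`|u.1| <= r)%N -> (`|u.2| <= r)%N -> x (v + u) = x' (v' + u)) ->
  phi x v = phi x' v'.
Proof.
have [[_ sX] _ _ phi_shift _] := phi_factor.
have e z w : X z -> phi z w = phi (shift w z) (0, 0).
  by move=> /phi_shift ->; rewrite shiftE add0r.
move=> Xx Xx' h; rewrite (e x) // (e x') //; apply: phi_range; try exact: sX.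
by move=> u u1 u2; rewrite !shiftE ![u + _]addrC; exact: h.
Qed.

Variables (n N : nat).
Hypothesis n_large : (2 * r + 2 <= n)%N.
Let d := sideN n.
(** Side of a core: the map reads [r] cells further on each side, and one more is given up for the
    outer frame, whose tiles show the role of the square. *)
Let e := (d - 2 * r - 2)%N.
Let d_side : d%:Z = side n. Proof. exact: sideNE. Qed.
Let d_ge : (2 * n + 1 <= d)%N. Proof. by have := side_ge n; rewrite -d_side; lia. Qed.

Definition island x (p : Z2) : Prop := exists c, square (tiles x) n p.1 p.2 c.

Definition content (p : Z2) (y : config B) : {ffun rect e e -> B} :=
  restr (rect e e) (shift (p + (r%:Z, r%:Z)) y).

Lemma island_shift x p v : island x p -> island (shift v x) (p - v).
Proof. by move=> [c /(square_translate v.1 v.2) h]; exists c. Qed.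

Lemma content_eq x x' p p' : X x -> X x' -> island x p -> island x' p' ->
  (forall a : Z2, 0 < a.1 < d%:Z - 1 -> 0 < a.2 < d%:Z - 1 ->
     symbol x (p + a) = symbol x' (p' + a)) ->
  content p (phi x) = content p' (phi x').
Proof.
move=> Xx Xx' [c hc] [c' hc'] h; apply/restrP => -[w1 w2]; rewrite mem_rect /= => hv; rewrite !shiftE.
apply: phi_local => // -[u1 u2] /= hu1 hu2.
pose a : Z2 := (r%:Z + w1 + u1, r%:Z + w2 + u2).
have ha1 : 0 < a.1 < d%:Z - 1 by rewrite /=; move: d_ge; rewrite /e in hv; lia.
have ha2 : 0 < a.2 < d%:Z - 1 by rewrite /=; move: d_ge; rewrite /e in hv; lia.
have eq (p0 : Z2) : (w1, w2) + (p0 + (r%:Z, r%:Z)) + (u1, u2) = p0 + a.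
  by case: p0 => i j; congr (_, _) => /=; lia.
rewrite !eq; have := h a ha1 ha2.
have : tiles x (p.1 + a.1) (p.2 + a.2) = tiles x' (p'.1 + a.1) (p'.2 + a.2).
  by apply: square_eq_inner hc hc' _ _; rewrite -d_side.
by rewrite /tiles /symbol; case: (x _) (x' _) => [? ?] [? ?] /= -> ->.
Qed.

Definition contents : {set {ffun rect e e -> B}} :=
  finset (fun c => `[< exists2 x, X x /\ island x (0, 0) & content (0, 0) (phi x) = c >]).

Lemma contentsP c : reflect (exists2 x, X x /\ island x (0, 0) & content (0, 0) (phi x) = c)
  (c \in contents).
Proof. by rewrite inE; exact: asboolP. Qed.

Lemma mem_contents x p : X x -> island x p -> content p (phi x) \in contents.
Proof.
have [[_ sX] _ _ phi_shift _] := phi_factor.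
move=> Xx hp; apply/contentsP; exists (shift p x); first split.
- exact: sX.
- by have := island_shift p hp; rewrite subrr.
rewrite phi_shift // /content shift_add.
by have -> : (0, 0) + (r%:Z, r%:Z) + p = p + (r%:Z, r%:Z) :> Z2 by case: (p) => i j; congr (_, _) => /=; lia.
Qed.

Lemma contents_gt0 : (0 < #|contents|)%N.
Proof.
have [s vs sq] := window_square n.
apply/card_gt0P; exists (content (1, 1) (phi (fill s (fun=> ord0)))); apply: mem_contents.
  exact: fill_system.
by exists (false, false).
Qed.

Definition site (p : 'I_N * 'I_N) : Z2 := (p.1%:Z + 1, p.2%:Z + 1).

Definition islands x : {set 'I_N * 'I_N} :=
  finset (fun p : 'I_N * 'I_N =>
    [&& (p.1 + d <= N)%N, (p.2 + d <= N)%N & `[< island x (site p) >]]).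

Lemma islandsP x (p : 'I_N * 'I_N) :
  reflect [/\ (p.1 + d <= N)%N, (p.2 + d <= N)%N & island x (site p)]
  (p \in islands x).
Proof. by rewrite inE; apply: (iffP and3P) => -[? ? /asboolP]. Qed.

Lemma islands_disjoint x p p' (a a' : Z2) : p \in islands x -> p' \in islands x ->
  0 <= a.1 < d%:Z -> 0 <= a.2 < d%:Z -> 0 <= a'.1 < d%:Z -> 0 <= a'.2 < d%:Z ->
  site p + a = site p' + a' -> p = p'.
Proof.
move=> /islandsP[_ _ [c hc]] /islandsP[_ _ [c' hc']] h1 h2 h3 h4 [e1 e2].
have [] := square_disjoint hc hc'; rewrite -?d_side /=; try lia.
case: p p' {hc hc'} e1 e2 => [p1 p2] [p1' p2'] /= _ _ f1 f2.
by congr (_, _); apply: val_inj => /=; lia.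
Qed.

(** A strip along the boundary of the window enlarged by [r]. A square of level [n] not contained in
    the window meets the enlarged window only within this strip. *)
Definition border := ('I_(2 * (d + r)) * 'I_(N + 2 * r) * bool)%type.

Definition border_site (b : border) : Z2 :=
  let c : int := if (b.1.1 < d + r)%N then b.1.1%:Z + 1 - r%:Z
                 else N%:Z - d%:Z + 1 + b.1.1%:Z - (d + r)%:Z in
  let c' : int := b.1.2%:Z + 1 - r%:Z in
  if b.2 then (c, c') else (c', c).

Definition band x : {ffun border -> 'I_q.+1} := [ffun b => symbol x (border_site b)].

Definition filling x : {ffun 'I_N * 'I_N -> {ffun rect e e -> B}} :=
  [ffun p => if p \in islands x then content (site p) (phi x) else [ffun=> point]].

Lemma mem_border (u : Z2) : 1 - r%:Z <= u.1 <= N%:Z + r%:Z -> 1 - r%:Z <= u.2 <= N%:Z + r%:Z ->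
  [|| u.1 <= d%:Z, N%:Z - d%:Z < u.1, u.2 <= d%:Z | N%:Z - d%:Z < u.2] ->
  exists b, border_site b = u.
Proof.
case: u => u1 u2 /= h1 h2 h.
have key (c c' : int) : 1 - r%:Z <= c <= N%:Z + r%:Z -> 1 - r%:Z <= c' <= N%:Z + r%:Z ->
    (c <= d%:Z) || (N%:Z - d%:Z < c) ->
    exists (i : 'I_(2 * (d + r))) (j : 'I_(N + 2 * r)), forall b,
      border_site (i, j, b) = if b then (c, c') else (c', c).
  move=> hc hc' hcd.
  have jN : (absz (c' - 1 + r%:Z)%R < N + 2 * r)%N by lia.
  have [cd|cd] := leP c d%:Z.
    have iD : (absz (c - 1 + r%:Z)%R < 2 * (d + r))%N by lia.
    exists (Ordinal iD), (Ordinal jN) => b; rewrite /border_site /=.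
    by case: b; (rewrite ifT; last by lia); congr (_, _); lia.
  have iD : (absz (c - 1 - N%:Z + d%:Z + (d + r)%N%:Z)%R < 2 * (d + r))%N by lia.
  exists (Ordinal iD), (Ordinal jN) => b; rewrite /border_site /=.
  by case: b; (rewrite ifF; last by lia); congr (_, _); lia.
have [hu|hu] := boolP ((u1 <= d%:Z) || (N%:Z - d%:Z < u1)).
  by have [i [j hb]] := key u1 u2 h1 h2 hu; exists (i, j, true); rewrite hb.
have [i [j hb]] := key u2 u1 h2 h1 ltac:(lia).
by exists (i, j, false); rewrite hb.
Qed.

Lemma islands_eq x x' :
  (forall a b, 1 <= a <= N%:Z -> 1 <= b <= N%:Z -> tiles x a b = tiles x' a b) ->
  islands x = islands x'.
Proof.
move=> h.
have sub z z' : (forall a b, 1 <= a <= N%:Z -> 1 <= b <= N%:Z -> tiles z a b = tiles z' a b) ->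
    forall p, p \in islands z -> p \in islands z'.
  move=> hz p /islandsP[p1 p2 [c hc]]; apply/islandsP; split=> //; exists c.
  apply: square_local hc _ => a b; rewrite -d_side /site /= => ha hb; apply: hz; lia.
apply/setP => p; apply/idP/idP; apply: sub => // a b ha hb.
by rewrite h.
Qed.

(* Units lie at depth at least [n] in their island, so a site of the window
   outside the cores of the inner islands does not see their symbols. *)
Lemma code_window x x' : X x -> X x' ->
  (forall a b, 1 - r%:Z <= a <= N%:Z + r%:Z -> 1 - r%:Z <= b <= N%:Z + r%:Z ->
     tiles x a b = tiles x' a b) ->
  band x = band x' -> filling x = filling x' ->
  restr (rect N N) (phi x) = restr (rect N N) (phi x').
Proof.
move=> Xx Xx' ht /ffunP hb /ffunP hf.
have eI : islands x = islands x' by apply: islands_eq => a b ha hb'; apply: ht; lia.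
apply/restrP => v; rewrite mem_rect => hv.
have [/existsP[p /and3P[pI v1 v2]]|nv] := boolP [exists p, [&& p \in islands x,
   (site p).1 + r%:Z + 1 <= v.1 <= (site p).1 + r%:Z + e%:Z &
   (site p).2 + r%:Z + 1 <= v.2 <= (site p).2 + r%:Z + e%:Z]].
  have := hf p; rewrite !ffunE -eI pI => /restrP /(_ (v - (site p + (r%:Z, r%:Z)))).
  rewrite !shiftE subrK; apply; rewrite mem_rect.
  have -> : (v - (site p + (r%:Z, r%:Z))).1 = v.1 - ((site p).1 + r%:Z) by [].
  have -> : (v - (site p + (r%:Z, r%:Z))).2 = v.2 - ((site p).2 + r%:Z) by []. lia.
apply: phi_local => // u u1 u2.
have : (v + u).1 = v.1 + u.1 /\ (v + u).2 = v.2 + u.2 by [].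
move: (v + u) => -[a b] /= [ab1 ab2]; have hw1 : 1 - r%:Z <= a <= N%:Z + r%:Z by lia.
have hw2 : 1 - r%:Z <= b <= N%:Z + r%:Z by lia.
have et := ht _ _ hw1 hw2.
have [[vx sx] [vx' sx']] := (proj1 (systemP x) Xx, proj1 (systemP x') Xx').
suff es : symbol x (a, b) = symbol x' (a, b).
  by move: et es; rewrite /tiles /symbol; case: (x (a, b)) (x' (a, b)) => [? ?] [? ?] /= -> ->.
have [hu|hu] := boolP (is_unit (tiles x a b)); last by rewrite sx // sx' // -et.
have [x0 [y0 [c [hc h1 h2]]]] := unit_inside n vx hu.
have [f1 f2 f3 f4] := unit_depth hc h1 h2 hu.
have [hbd|hbd] := boolP [|| a <= d%:Z, N%:Z - d%:Z < a, b <= d%:Z | N%:Z - d%:Z < b].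
  have [b' eb] := @mem_border (a, b) hw1 hw2 hbd.
  by have := hb b'; rewrite !ffunE eb.
case/negP: nv; apply/existsP; rewrite -d_side in h1 h2 f2 f4.
have i1 : (absz (x0 - 1)%R < N)%N by lia.
have i2 : (absz (y0 - 1)%R < N)%N by lia.
exists (Ordinal i1, Ordinal i2).
have ep : site (Ordinal i1, Ordinal i2) = (x0, y0).
  by rewrite /site /=; congr (_, _); lia.
apply/and3P; split.
- by apply/islandsP; rewrite ep; split=> /=; [lia|lia|exists c].
- by rewrite ep /e /=; lia.
- by rewrite ep /e /=; lia.
Qed.

Variables (R : realType) (l : nat) (u : {ffun rect l l -> B}).

(** Islands are disjoint, so positions in their cores are distinct positions of the window. *)
Lemma sum_islands x (G : Z2 -> R) : (forall v, 0 <= G v) ->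
  \sum_(p in islands x) \sum_(i < e - l) \sum_(j < e - l) G (pos i j + (site p + (r%:Z, r%:Z)))
    <= \sum_(i < N - l) \sum_(j < N - l) G (pos i j).
Proof.
move=> G0.
have [N0|] := posnP (N - l).
  rewrite big1 => [|p /islandsP[p1 _ _]]; first by apply: sumr_ge0 => i _; apply: sumr_ge0.
  by apply: big1 => i; have := ltn_ord i; rewrite /e; have := ltn_ord p.1; lia.
move NM : (N - l)%N => M'; case: M' NM => // M NM _.
rewrite pair_bigA /=.
under eq_bigr do rewrite pair_bigA /=.
rewrite pair_big_dep /=.
pose c (t : ('I_N * 'I_N) * ('I_(e - l) * 'I_(e - l))) : 'I_M.+1 * 'I_M.+1 :=
  (inord (t.1.1 + 1 + r + t.2.1), inord (t.1.2 + 1 + r + t.2.2)).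
pose P : {set ('I_N * 'I_N) * ('I_(e - l) * 'I_(e - l))} := [set t | t.1 \in islands x]%SET.
have cv t : t \in P -> (t.1.1 + 1 + r + t.2.1 < M.+1)%N /\ (t.1.2 + 1 + r + t.2.2 < M.+1)%N.
  case: t => [[a b] [i j]]; rewrite inE /= => /islandsP[/= p1 p2 _].
  have := ltn_ord i; have := ltn_ord j; rewrite /e; lia.
have ci : {in P &, injective c}.
  move=> t t' tP t'P; have [t1 t2] := cv t tP; have [t1' t2'] := cv t' t'P.
  rewrite /c => -[/(congr1 val) /=]; rewrite !inordK // => h1 /(congr1 val) /=.
  rewrite !inordK // => h2.
  move: tP t'P; rewrite [t \in P]inE [t' \in P]inE.
  case: t t' h1 h2 {t1 t2 t1' t2'} => [p [i j]] [p' [i' j']] /= h1 h2 tP t'P.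
  have ei := ltn_ord i; have ej := ltn_ord j; have ei' := ltn_ord i'; have ej' := ltn_ord j'.
  have pp : p = p'.
    apply: (islands_disjoint (a := (r%:Z + i%:Z, r%:Z + j%:Z)) (a' := (r%:Z + i'%:Z, r%:Z + j'%:Z)) tP t'P);
      rewrite /= ?/site; try by have eE : e = (d - 2 * r - 2)%N by []; lia.
    by congr (_, _) => /=; lia.
  by rewrite -pp in h1 h2 *; congr (_, (_, _)); apply: val_inj => /=; lia.
have := sum_inj_le ci (fun k => G0 (pos k.1 k.2)); apply: le_trans.
have eP t : (t.1 \in islands x) && true = (t \in P) by rewrite [RHS]inE andbT.
rewrite (eq_bigl _ _ eP); apply: ler_sum => t tP.
have [t1 t2] := cv t tP; rewrite /c /pos /site /= !inordK //.
rewrite le_eqVlt; apply/orP; left; apply/eqP; congr G.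
by congr (_, _) => /=; lia.
Qed.

Lemma occ_content (p : Z2) (y : config B) : occ R u e (shift (p + (r%:Z, r%:Z)) y) =
  occ R u e (fun v => if insub v is Some s then content p y s else point).
Proof.
apply: occ_eq; apply/restrP => v vS.
by rewrite insubT /= ffunE.
Qed.

Definition hits (c : {ffun rect e e -> B}) : R :=
  occ R u e (fun v => if insub v is Some s then c s else point).

Let core : R := ((e - l) ^ 2)%:R.

Let occ_sum M (y : config B) : \sum_(i < M - l) \sum_(j < M - l) (1 - hit R u (shift (pos i j) y)) =
  ((M - l) ^ 2)%:R - occ R u M y.
Proof.
under eq_bigr do rewrite sumrB sumr_const card_ord.
by rewrite sumrB sumr_const card_ord -mulrnA mulnn.
Qed.

Let sum_core (A : {set 'I_N * 'I_N}) : \sum_(p in A) core = #|A|%:R * core.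
Proof. by rewrite sumr_const mulr_natl. Qed.

(** Both bounds come from [sum_islands], applied to [hit] and to [1 - hit]; their gap is the number
    of positions outside the cores. *)
Lemma occ_bounds x S : S = \sum_(p in islands x) hits (content (site p) (phi x)) ->
  S <= occ R u N (phi x) <= S + ((N - l) ^ 2)%:R - #|islands x|%:R * core.
Proof.
move=> ->; set S' := \sum_(p in _) _.
have eS : S' = \sum_(p in islands x) occ R u e (shift (site p + (r%:Z, r%:Z)) (phi x)).
  by apply: eq_bigr => p _; rewrite occ_content.
apply/andP; split.
  have := @sum_islands x (fun v => hit R u (shift v (phi x))) (fun _ => hit_ge0 _ _ _).
  rewrite eS; congr (_ <= _); apply: eq_bigr => p _; apply: eq_bigr => i _.
  by apply: eq_bigr => j _; rewrite shift_add.
have := @sum_islands x (fun v => 1 - hit R u (shift v (phi x))) (fun v => ltac:(rewrite subr_ge0 hit_le1 //)).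
rewrite occ_sum (eq_bigr (fun p => core - occ R u e (shift (site p + (r%:Z, r%:Z)) (phi x)))).
  by rewrite sumrB sum_core -eS; lra.
move=> p _; rewrite -occ_sum; apply: eq_bigr => i _; apply: eq_bigr => j _.
by rewrite shift_add.
Qed.

Lemma hits_bounds c : 0 <= hits c <= core.
Proof.
apply/andP; split.
  by apply: sumr_ge0 => i _; apply: sumr_ge0 => j _; exact: hit_ge0.
rewrite -subr_ge0 -occ_sum.
by apply: sumr_ge0 => i _; apply: sumr_ge0 => j _; rewrite subr_ge0 hit_le1.
Qed.

Lemma card_islands_core x : #|islands x|%:R * core <= ((N - l) ^ 2)%:R.
Proof. by have := occ_bounds (erefl (\sum_(p in islands x) hits (content (site p) (phi x)))); lra. Qed.

(** In the bounds below every position of the window is charged [|t|]. Subtracting [|t| * core]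
    refunds the positions in the core, so that for either sign of [t] only those outside the cores
    are paid for. *)
Definition weight (t : R) c : R := expR (t * hits c - `|t| * core).
Definition partition_sum (t : R) : R := \sum_(c in contents) weight t c.

Definition lift_point (y : config B) : config (letter q) := xget point [set x | X x /\ phi x = y].
Lemma lift_pointP (y : config B) : Y y -> X (lift_point y) /\ phi (lift_point y) = y.
Proof.
have [_ _ _ _ <-] := phi_factor => -[x Xx e0].
exact: (@xgetPex _ point [set x | X x /\ phi x = y] (ex_intro _ x (conj Xx e0))).
Qed.

(** * Pressure of a window *)

Section Code.
Variables (C : finType) (cd : plane -> C).
Hypothesis cd_inj : forall s s', valid s -> valid s' -> cd s = cd s' ->
  forall a b, 0 <= a < (N + 2 * r)%N%:Z -> 0 <= b < (N + 2 * r)%N%:Z -> s a b = s' a b.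
Variable K : nat.
Hypothesis K_max : forall x, X x -> (#|islands x| <= K)%N.

Let L := language Y (rect N N).
Let pre (w : {ffun rect N N -> B}) := lift_point (rep Y w).
Let skel (w : {ffun rect N N -> B}) :=
  (cd (translate (tiles (pre w)) (1 - r%:Z) (1 - r%:Z)), band (pre w)).
(** The islands are a function of the tiles, hence of the skeleton; a value that is not a skeleton
    is given none. *)
Let isl (k : C * {ffun border -> 'I_q.+1}) : {set 'I_N * 'I_N} :=
  if [pick w in L | skel w == k] is Some w then islands (pre w) else finset.set0.
(** Off the islands only the default content counts, so the sum over all fillings is a product over
    all sites, with factor [partition_sum t] on the islands and [1] elsewhere. *)
Let factor t (k : C * {ffun border -> 'I_q.+1}) p c : R :=
  if p \in isl k then (if c \in contents then weight t c else 0)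
  else (c == [ffun=> point])%:R.
Let bound (t : R)
    (kf : (C * {ffun border -> 'I_q.+1}) * {ffun 'I_N * 'I_N -> {ffun rect e e -> B}}) : R :=
  expR (`|t| * ((N - l) ^ 2)%:R) * \prod_p factor t kf.1 p (kf.2 p).

Let preP w : w \in L -> X (pre w) /\ restr (rect N N) (phi (pre w)) = w.
Proof. by move=> /repP[Yw ew]; have [Xw fw] := lift_pointP Yw; rewrite fw. Qed.

Let skel_tiles w w' : w \in L -> w' \in L -> skel w = skel w' ->
  forall a b, 1 - r%:Z <= a <= N%:Z + r%:Z -> 1 - r%:Z <= b <= N%:Z + r%:Z ->
    tiles (pre w) a b = tiles (pre w') a b.
Proof.
move=> /preP[/systemP[vw _] _] /preP[/systemP[vw' _] _] [ec _] a b ha hb.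
have := @cd_inj _ _ (translate_valid _ _ vw) (translate_valid _ _ vw') ec (a - 1 + r%:Z) (b - 1 + r%:Z).
rewrite /translate.
have -> : a - 1 + r%:Z + (1 - r%:Z) = a by lia.
have -> : b - 1 + r%:Z + (1 - r%:Z) = b by lia.
by apply; lia.
Qed.

Let isl_skel w : w \in L -> isl (skel w) = islands (pre w).
Proof.
move=> wL; rewrite /isl; case: pickP => [w' /andP[w'L /eqP ew]|/(_ w)]; last by rewrite wL eqxx.
by apply: islands_eq => a b ha hb; apply: (skel_tiles w'L wL ew); lia.
Qed.

Let isl_card k : (#|isl k| <= K)%N.
Proof.
rewrite /isl; case: pickP => [w /andP[/preP[Xw _] _]|_]; first exact: K_max.
by rewrite cards0.
Qed.

Let bound_ge0 t kf : 0 <= bound t kf.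
Proof.
rewrite mulr_ge0 ?expR_ge0 //; apply: prodr_ge0 => p _; rewrite /factor.
by case: ifP => // _; case: ifP => // _; exact: expR_ge0.
Qed.

Let bound_code t w : w \in L -> bound t (skel w, filling (pre w)) =
  expR (`|t| * ((N - l) ^ 2)%:R +
        \sum_(p in islands (pre w)) (t * hits (content (site p) (phi (pre w))) - `|t| * core)).
Proof.
move=> wL; have [Xw _] := preP wL.
rewrite expRD expR_sum /bound; congr (_ * _); rewrite [RHS]big_mkcond /=.
apply: eq_bigr => p _; rewrite /factor /= isl_skel // ffunE.
case: ifPn => pI; last by rewrite (negbTE pI) eqxx.
by rewrite pI mem_contents //; case/islandsP: pI.
Qed.

(** For [t >= 0] this is the upper bound of [occ_bounds]; for [t < 0] it is the lower one, together
    with the fact that the number of positions outside the cores is nonnegative. *)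
Lemma occ_le_bound t w : w \in L ->
  t * occ R u N (rep Y w) <= ln (bound t (skel w, filling (pre w))).
Proof.
move=> wL; rewrite bound_code // expRK.
have [_ <-] := lift_pointP (proj1 (repP wL)); rewrite -/(pre w).
have := occ_bounds (erefl (\sum_(p in islands (pre w)) hits (content (site p) (phi (pre w))))).
set S := \sum_(p in _) _ => /andP[h1 h2].
rewrite sumrB -mulr_sumr -/S sumr_const -[X in _ - X]mulr_natl.
have [t0|t0] := leP 0 t.
  by have := ler_wpM2l t0 h2; rewrite (ger0_norm t0); lra.
have h3 : S <= S + ((N - l) ^ 2)%:R - #|islands (pre w)|%:R * core by exact: le_trans h1 h2.
have := ler_wnM2l (ltW t0) h1; rewrite (ltr0_norm t0) => h4.
have := ler_wnM2l (ltW t0) h3; lra.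
Qed.

Lemma sum_bound t : 1 <= partition_sum t ->
  \sum_(w in L) bound t (skel w, filling (pre w)) <=
  #|C|%:R * #|{ffun border -> 'I_q.+1}|%:R * expR (`|t| * ((N - l) ^ 2)%:R) * partition_sum t ^+ K.
Proof.
move=> Z1.
have inj : {in L &, injective (fun w => (skel w, filling (pre w)))}.
  move=> w w' wL w'L [ec eb ef]; have [Xw <-] := preP wL; have [Xw' <-] := preP w'L.
  apply: code_window => //; apply: skel_tiles => //; by rewrite /skel ec eb.
apply: (le_trans (sum_inj_le inj (bound_ge0 t))).
rewrite -(pair_bigA _ (fun k f => bound t (k, f))) /=.
apply: (@le_trans _ _ (\sum_(k : C * {ffun border -> 'I_q.+1}) expR (`|t| * ((N - l) ^ 2)%:R) * partition_sum t ^+ K)).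
  apply: ler_sum => k _; rewrite -mulr_sumr ler_wpM2l ?expR_ge0 //.
  rewrite -(bigA_distr_bigA (fun p c => factor t k p c)) /=.
  (* [1 <= partition_sum t] allows raising the number of islands to the uniform exponent [K]. *)
  apply: (@le_trans _ _ (partition_sum t ^+ #|isl k|)); last exact: ler_weXn2l.
  rewrite -prodr_const [leRHS]big_mkcond /=; apply: ler_prod => p _.
  have -> : \sum_c factor t k p c = if p \in isl k then partition_sum t else 1.
    rewrite /factor; case: ifP => _; first by rewrite -big_mkcond.
    by rewrite (bigD1 [ffun=> point]) //= eqxx big1 ?addr0 // => c /negbTE ->.
  by rewrite lexx andbT; case: ifP => // _; exact: le_trans Z1.
by rewrite sumr_const card_prod -[leLHS]mulr_natl [X in X * _]natrM mulrA.
Qed.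

(* The windows with a given skeleton (tiles and symbols near the border) are
   parametrized by the contents of their inner squares, and summing the weights of
   these independent contents gives a power of [partition_sum t]. *)
Lemma pressure_bound (nu : probability (borel_config B) R) t :
  invariant_on Y nu -> 1 <= partition_sum t ->
  shannon Y nu N + t * (((N - l) ^ 2)%:R * prob nu [set y | restr (rect l l) y = u]) <=
  ln #|C|%:R + ln #|{ffun border -> 'I_q.+1}|%:R + `|t| * ((N - l) ^ 2)%:R + K%:R * ln (partition_sum t).
Proof.
move=> inv Z1; have [_ sY _ _ _] := phi_factor.
pose P w := prob nu [set y | restr (rect N N) y = w].
have a0 w : w \in L -> 0 < bound t (skel w, filling (pre w)).
  by move=> wL; rewrite bound_code // expR_gt0.
have := @gibbs R _ L P (fun w => bound t (skel w, filling (pre w))) (fun w _ => prob_ge0 _ _)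
  (prob_sum sY inv _) a0.
have C0 : (0 < #|C|)%N by apply/card_gt0P; exists (cd model).
have D0 : (0 < #|{ffun border -> 'I_q.+1}|)%N by apply/card_gt0P; exists [ffun=> ord0].
have Z0 : 0 < partition_sum t by exact: lt_le_trans Z1.
have -> : ln #|C|%:R + ln #|{ffun border -> 'I_q.+1}|%:R + `|t| * ((N - l) ^ 2)%:R + K%:R * ln (partition_sum t)
  = ln (#|C|%:R * #|{ffun border -> 'I_q.+1}|%:R * expR (`|t| * ((N - l) ^ 2)%:R) * partition_sum t ^+ K).
  rewrite !lnM ?posrE ?mulr_gt0 ?expR_gt0 ?exprn_gt0 ?ltr0n // expRK lnXn // mulr_natl //.
have Lne : exists w, w \in L.
  have h := prob_sum sY inv (rect N N); apply/existsP; apply: contraT => /existsPn nL.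
  by move: h; rewrite big_pred0 ?(negbTE (oner_neq0 _)) // => [/eqP|w]; [rewrite eq_sym oner_eq0|exact/negbTE/nL].
move=> h; apply: (@le_trans _ _ (ln (\sum_(w in L) bound t (skel w, filling (pre w))))).
  apply: le_trans h; rewrite -(expected_occ u N sY inv) shannon_prob // mulr_sumr -big_split /=.
  apply: ler_sum => w wL; rewrite addrC lerD2r mulrCA ler_wpM2l ?prob_ge0 //.
  exact: occ_le_bound.
rewrite ler_ln ?posrE ?mulr_gt0 ?expR_gt0 ?exprn_gt0 ?ltr0n //; first exact: sum_bound.
case: Lne => w wL; rewrite (bigD1 w) //= ltr_pwDl ?a0 //.
by apply: sumr_ge0 => i _; exact: bound_ge0.
Qed.
End Code.

(* All contents occur independently in the inner squares of [x]: copy the symbols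
   of a witness into each square. *)
Lemma card_contents_le x : X x ->
  (#|contents| ^ #|islands x| <= #|language Y (rect N N)|)%N.
Proof.
move=> Xx; have [vx _] := proj1 (systemP x) Xx.
have [_ _ _ _ imY] := phi_factor.
pose Z c := [set z | (X z /\ island z (0, 0)) /\ content (0, 0) (phi z) = c].
have ZP c : c \in contents -> Z c (xget point (Z c)).
  by move=> /contentsP[z hz ez]; apply: (@xgetPex _ point (Z c)); exists z.
pose inner (p : 'I_N * 'I_N) (v : Z2) :=
  (0 < v.1 - (site p).1 < d%:Z - 1) && (0 < v.2 - (site p).2 < d%:Z - 1).
pose sym (f : {ffun 'I_N * 'I_N -> {ffun rect e e -> B}}) (v : Z2) : 'I_q.+1 :=
  if [pick p in islands x | inner p v] is Some p
  then symbol (xget point (Z (f p))) (v - site p) else ord0.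
pose xf f := fill (tiles x) (sym f).
have Xf f : X (xf f) by exact: fill_system.
pose D := [set f in pffun_on [ffun=> point] (mem (islands x)) (mem contents)]%SET.
have key f p : f \in D -> p \in islands x -> content (site p) (phi (xf f)) = f p.
  rewrite inE => /pffun_onP[_ fI] pI.
  have fpC : f p \in contents by apply: fI; apply: map_f; rewrite mem_enum.
  have [[Xz [c' hz]] ez] := ZP _ fpC.
  rewrite -[RHS]ez; have /islandsP[_ _ [c hc]] := pI.
  apply: content_eq => //; [by exists c|by exists c'|move=> a a1 a2].
  have et : tiles x ((site p).1 + a.1) ((site p).2 + a.2) = tiles (xget point (Z (f p))) (0 + a.1) (0 + a.2).
    by apply: square_eq_inner hc hz _ _; rewrite -d_side.
  have [_ sz] := proj1 (systemP _) Xz.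
  have ea : (0, 0) + a = a :> Z2 by rewrite add0r.
  rewrite ea {1}/symbol /xf /fill /=.
  have [hu|hu] := boolP (is_unit _); last first.
    by rewrite sz // -[a.1]add0r -[a.2]add0r -et.
  rewrite /sym; case: pickP => [p' /andP[p'I /andP[i1 i2]]|/(_ p)]; last first.
    rewrite pI /inner.
    have -> : (site p + a).1 - (site p).1 = a.1 by rewrite addrC addKr.
    have -> : (site p + a).2 - (site p).2 = a.2 by rewrite addrC addKr.
    by rewrite a1 a2.
  have -> : p' = p.
    apply: (islands_disjoint (a := site p + a - site p') (a' := a) p'I pI).
    - by move: i1; rewrite /=; lia.
    - by move: i2; rewrite /=; lia.
    - lia.
    - lia.
    - by rewrite addrC subrK.
  by rewrite addrC addKr.
suff : (#|D| <= #|language Y (rect N N)|)%N by rewrite /D cardsE card_pffun_on.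
apply: (@card_language_ge _ Y _ _ D (fun f => phi (xf f))) => [f _|f f' fD f'D /restrP eff].
  by rewrite -imY; exists (xf f).
apply/ffunP => p; have [pI|pI] := boolP (p \in islands x); last first.
  have out g : g \in D -> g p = [ffun=> point].
    rewrite [g \in D]inE => /pffun_onP[/fintype.subsetP s1 _]; apply/eqP; apply: contraT => gp.
    by case/negP: pI; apply: s1; rewrite supportE.
  by rewrite !out.
rewrite -(key f p) // -(key f' p) //; apply/restrP => -[v1 v2].
rewrite mem_rect /= => hv; rewrite !shiftE; apply: eff; rewrite mem_rect /=.
have /islandsP[p1 p2 _] := pI; have eE : e = (d - 2 * r - 2)%N by []. lia.
Qed.

Lemma islands_window m : N = sideN m -> (n <= m)%N ->
  exists2 x, X x & (4 ^ (m - n) <= #|islands x|)%N.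
Proof.
move=> Nm nm; have [s vs sq] := window_square m.
exists (fill s (fun=> ord0)); first exact: fill_system.
have [t [ut <- ht]] := subsquares sq nm.
set I := islands _.
rewrite cardE -(size_map (fun p : 'I_N * 'I_N => site p)); apply: uniq_leq_size => // -[a b] /ht /=.
move=> [[c hc] h1 h2 h3 h4]; have eN := sideNE m; rewrite -Nm in eN.
have i1 : (absz (a - 1)%R < N)%N by have := d_ge; lia.
have i2 : (absz (b - 1)%R < N)%N by have := d_ge; lia.
have e0 : site (Ordinal i1, Ordinal i2) = (a, b) by rewrite /site /=; congr (_, _); lia.
rewrite -e0 map_f // mem_enum; apply/islandsP; rewrite e0; split=> /=; [lia|lia|by exists c].
Qed.

(** The same [K] serves as an upper bound for the exponent of [partition_sum t] and as the number of
    independent contents in one point, so the maximum has to be attained. *)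
Lemma max_islands : exists2 x0, X x0 & forall x, X x -> (#|islands x| <= #|islands x0|)%N.
Proof.
pose P k := `[< exists2 x, X x & #|islands x| = k >].
have P0 : exists k, P k.
  have [x Xx] := system_nonempty q.
  by exists #|islands x|; apply/asboolP; exists x.
have Pb k : P k -> (k <= #|[set: 'I_N * 'I_N]%SET|)%N.
  by move=> /asboolP[x _ <-]; apply: subset_leq_card; exact: finset.subsetT.
case: (ex_maxnP P0 Pb) => _ /asboolP[x0 Xx0 <-] h; exists x0 => // x Xx.
by apply: h; apply/asboolP; exists x.
Qed.

Lemma partition_sum0 : partition_sum 0 = #|contents|%:R.
Proof.
by rewrite /partition_sum -sumr_const; apply: eq_bigr => c _; rewrite /weight normr0 !mul0r subr0 expR0.
Qed.

(** There are at least two contents, each of weight at least [1 / 2], since the exponent is at least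
    [- 2 * |t| * core]. *)
Lemma partition_sum_ge1 t : (1 < #|contents|)%N -> `|t| * core <= 1 / 4 -> 1 <= partition_sum t.
Proof.
move=> c1 tc; apply: (@le_trans _ _ (\sum_(c in contents) 1 / 2)).
  rewrite sumr_const -[leRHS]mulr_natl.
  have : 2 <= #|contents|%:R :> R by rewrite ler_nat.
  lra.
apply: ler_sum => c _; apply: (@le_trans _ _ (1 - 2 * (`|t| * core))); first by lra.
apply: le_trans (expR_ge1Dx _); have /andP[g0 g1] := hits_bounds c.
have : `|t * hits c| <= `|t| * core by rewrite normrM (ger0_norm g0) ler_wpM2l.
rewrite ler_norml => /andP[h1 h2]; lra.
Qed.

Lemma cosh_le (s : R) : s ^+ 2 <= 1 / 2 -> expR s + expR (- s) <= 2 + 4 * s ^+ 2.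
Proof.
move=> s2; have s1 : `|s| < 1 by rewrite -(@ltr_pXn2r _ 2) ?nnegrE // expr1n real_normK ?num_real //; lra.
move: s1; rewrite ltr_norml => /andP[h1 h2].
have a1 : expR s <= (1 - s)^-1.
  rewrite -[s]opprK expRN lef_pV2 ?posrE ?expR_gt0 ?opprK //; last by lra.
  exact: expR_ge1Dx.
have a2 : expR (- s) <= (1 + s)^-1.
  rewrite expRN lef_pV2 ?posrE ?expR_gt0 //; last by lra.
  exact: expR_ge1Dx.
apply: (le_trans (lerD a1 a2)).
have -> : (1 - s)^-1 + (1 + s)^-1 = 2 / (1 - s ^+ 2).
  by field; rewrite !gt_eqF //; [lra|lra|lra].
by rewrite ler_pdivrMr; nra.
Qed.

(** The product is a double sum of [expR (t * (hits c - hits c'))]. Adding the sum with [c] and [c']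
    exchanged produces hyperbolic cosines, so the term linear in [t] cancels. *)
Lemma partition_sum_prod t : (0 < #|contents|)%N -> `|t| * core <= 1 / 4 ->
  ln (partition_sum t) + ln (partition_sum (- t)) <=
  2 * ln #|contents|%:R - 2 * (`|t| * core) + 2 * (`|t| * core) ^+ 2.
Proof.
move=> c0 tc; set b := `|t| * core in tc *.
have core0 : 0 <= core by [].
have b0 : 0 <= b by rewrite mulr_ge0.
have cR : 0 < #|contents|%:R :> R by rewrite ltr0n.
have Z0 s : 0 < partition_sum s.
  case/card_gt0P: c0 => c cC; rewrite /partition_sum (bigD1 c) //= ltr_pwDl ?expR_gt0 //.
  by apply: sumr_ge0 => i _; exact: expR_ge0.
have e1 : partition_sum t * partition_sum (- t) = expR (- (2 * b)) *
   \sum_(c in contents) \sum_(c' in contents) expR (t * hits c - t * hits c').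
  rewrite /partition_sum mulr_suml mulr_sumr; apply: eq_bigr => c _.
  rewrite [LHS]mulr_sumr [RHS]mulr_sumr; apply: eq_bigr => c' _; rewrite /weight normrN -!expRD -/b.
  by congr expR; rewrite /b; ring.
set S := \sum_(c in _) _ in e1.
have S2 : S + S <= #|contents|%:R ^+ 2 * (2 + 4 * b ^+ 2).
  rewrite {2}/S exchange_big /= -big_split /=.
  apply: (@le_trans _ _ (\sum_(c in contents) \sum_(c' in contents) (2 + 4 * b ^+ 2))); last first.
    by rewrite !sumr_const -mulrnA -[leLHS]mulr_natl natrM expr2.
  apply: ler_sum => c _; rewrite -big_split /=; apply: ler_sum => c' _.
  rewrite -[t * hits c' - _]opprB; set s := t * hits c - t * hits c'.
  have sb : s ^+ 2 <= b ^+ 2.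
    rewrite -[s ^+ 2]real_normK ?num_real // ler_pXn2r ?nnegrE //.
    rewrite /s -mulrBr normrM ler_wpM2l // ler_norml.
    by have /andP[? ?] := hits_bounds c; have /andP[? ?] := hits_bounds c'; apply/andP; split; lra.
  have b2 : b ^+ 2 <= 1 / 2 by nra.
  by apply: le_trans (cosh_le (le_trans sb b2)) _; lra.
have S0 : 0 < S.
  by rewrite -(pmulr_rgt0 _ (expR_gt0 (- (2 * b)))) -e1 mulr_gt0.
rewrite -lnM ?posrE // e1 lnM ?posrE ?expR_gt0 // expRK.
have : ln S <= ln (#|contents|%:R ^+ 2 * (1 + 2 * b ^+ 2)).
  by rewrite ler_ln ?posrE // ?mulr_gt0 ?exprn_gt0 //; nra.
have b3 : 0 < 1 + 2 * b ^+ 2 by nra.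
rewrite lnM ?posrE ?exprn_gt0 // lnXn // -mulr_natl.
have : ln (1 + 2 * b ^+ 2) <= 2 * b ^+ 2 by apply: le_ln1Dx; nra.
lra.
Qed.

(** Sum of [pressure_bound] for [nu] at [t] and for [nu'] at [- t]. The terms [K * ln #|contents|]
    are absorbed by [lnL]. What is left of the first order is [(N - l) ^ 2 - K * core], which
    decreases in [K], so any point [x1] with many islands bounds it. *)
Lemma comparison (C : finType) (cd : plane -> C) (nu nu' : probability (borel_config B) R) t x1 :
  (forall s s', valid s -> valid s' -> cd s = cd s' ->
  forall a b, 0 <= a < (N + 2 * r)%N%:Z -> 0 <= b < (N + 2 * r)%N%:Z -> s a b = s' a b) ->
  invariant_on Y nu -> invariant_on Y nu' -> (1 < #|contents|)%N -> 0 < t -> t * core <= 1 / 4 ->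
  X x1 ->
  t * (((N - l) ^ 2)%:R * (prob nu [set y | restr (rect l l) y = u] -
                           prob nu' [set y | restr (rect l l) y = u])) <=
  2 * lnL R Y N N - shannon Y nu N - shannon Y nu' N +
  2 * (ln #|C|%:R + ln #|{ffun border -> 'I_q.+1}|%:R) +
  2 * t * (((N - l) ^ 2)%:R - #|islands x1|%:R * core) + 2 * t ^+ 2 * core * ((N - l) ^ 2)%:R.
Proof.
move=> hcd inv inv' c1 t0 tc Xx1; have [x0 Xx0 x0max] := max_islands.
have nt : `|t| = t by exact: gtr0_norm.
have ntc : `|t| * core <= 1 / 4 by rewrite nt.
have ntc' : `|- t| * core <= 1 / 4 by rewrite normrN nt.
have h1 := @pressure_bound C cd hcd _ x0max nu t inv (partition_sum_ge1 c1 ntc).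
have h2 := @pressure_bound C cd hcd _ x0max nu' (- t) inv' (partition_sum_ge1 c1 ntc').
have h3 := partition_sum_prod (ltnW c1) ntc; rewrite normrN nt in h2; rewrite nt in h1 h3.
set K : R := #|islands x0|%:R in h1 h2; have K0 : 0 <= K by [].
have h4 := ler_wpM2l K0 h3; rewrite mulrDr in h4.
have core0 : 0 <= core by [].
have h5 : K * ln #|contents|%:R <= lnL R Y N N.
  rewrite /K mulr_natl -lnXn ?ltr0n ?(ltnW c1) // -natrX ler_ln ?posrE ?ltr0n.
  - by rewrite ler_nat; exact: card_contents_le.
  - by rewrite expn_gt0 (ltnW c1).
  - by apply: leq_trans (card_contents_le Xx0); rewrite expn_gt0 (ltnW c1).
have h6 : #|islands x1|%:R * core <= K * core by rewrite ler_wpM2r // ler_nat; exact: x0max.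
have h7 : K * core <= ((N - l) ^ 2)%:R by exact: card_islands_core.
have h8 : K * (2 * (t * core) ^+ 2) <= 2 * t ^+ 2 * core * ((N - l) ^ 2)%:R.
  rewrite (_ : K * _ = 2 * t ^+ 2 * core * (K * core)); last by ring.
  by rewrite ler_wpM2l // !mulr_ge0 // ltW.
have h9 : 2 * t * (((N - l) ^ 2)%:R - K * core) <= 2 * t * (((N - l) ^ 2)%:R - #|islands x1|%:R * core).
  by rewrite ler_pM2l ?mulr_gt0 // lerD2l lerN2.
move: h1 h2 h4 h5 h8 h9; move: ((N - l) ^ 2)%:R => M.
move: (ln (partition_sum t)) (ln (partition_sum (- t))) (ln #|contents|%:R) => a1 a2 a3; lra.
Qed.

Lemma trivial_contents (C : finType) (cd : plane -> C) (nu : probability (borel_config B) R) :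
  (forall s s', valid s -> valid s' -> cd s = cd s' ->
  forall a b, 0 <= a < (N + 2 * r)%N%:Z -> 0 <= b < (N + 2 * r)%N%:Z -> s a b = s' a b) ->
  invariant_on Y nu -> #|contents| = 1%N ->
  shannon Y nu N <= ln #|C|%:R + ln #|{ffun border -> 'I_q.+1}|%:R.
Proof.
move=> hcd inv c1; have [x0 Xx0 x0max] := max_islands.
have := @pressure_bound C cd hcd _ x0max nu 0 inv.
by rewrite partition_sum0 c1 lexx normr0 !mul0r !addr0 ln1 mulr0 addr0; apply.
Qed.
End Islands.

(** * Uniqueness of the measure of maximal entropy *)

Section LocalAgreement.
Context (R : realType) (B : alphabetType) (Y : set (config B)).
Variables (mu nu : probability (borel_config B) R).
Hypotheses (mu_inv : invariant_on Y mu) (nu_inv : invariant_on Y nu).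

(** Translating the centre to [(k + 1, k + 1)] makes a local set of radius [k] a disjoint union of
    cylinders over the square of side [2 * k + 1]. *)
Lemma windows_determine :
  (forall l (u : {ffun rect l l -> B}),
     prob mu [set y | restr (rect l l) y = u] = prob nu [set y | restr (rect l l) y = u]) ->
  forall E : set (borel_config B), measurable E -> mu E = nu E.
Proof.
move=> h; apply: borel_unique.
  exact: (le_lt_trans (probability_le1 mu measurableT) (ltry _)).
move=> k U lU; have mU := local_measurable lU.
suff e : prob mu U = prob nu U.
  by apply: (etrans (mu_fin mu mU)); rewrite e; apply: esym; exact: mu_fin.
pose t : Z2 := (k%:Z + 1, k%:Z + 1); pose l := (2 * k + 1)%N.
have mV : measurable (shift t @^-1` U : set (borel_config B)).
  exact: local_measurable (local_shift (t := t) lU).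
rewrite -(prob_shift mu_inv t mU) -(prob_shift nu_inv t mU).
rewrite (prob_partition mu (rect l l) mV) (prob_partition nu (rect l l) mV).
apply: eq_bigr => w _.
have hU (y z : config B) : restr (rect l l) y = restr (rect l l) z -> U (shift t y) -> U (shift t z).
  move=> /restrP yz; apply: lU => -[v1 v2] /= h1 h2; rewrite !shiftE; apply: yz.
  by rewrite mem_rect /l /=; lia.
have [[y [Uy yw]]|nU] := pselect (exists y, U (shift t y) /\ restr (rect l l) y = w).
  have -> : shift t @^-1` U `&` [set y | restr (rect l l) y = w] = [set y | restr (rect l l) y = w].
    by apply/seteqP; split=> [z []//|z /= zw]; split=> //=; apply: hU Uy; rewrite yw zw.
  exact: h.
have -> : shift t @^-1` U `&` [set y | restr (rect l l) y = w] = set0.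
  by apply/seteqP; split=> // z [/= Uz zw]; apply: nU; exists z.
by rewrite /prob !measure0.
Qed.
End LocalAgreement.

Section Uniqueness.
Context (R : realType) (q : nat) (B : alphabetType) (Y : set (config B)).
Variable phi : config (letter q) -> config B.
Local Notation X := (@system q).
Hypotheses (phi_factor : factor_map X Y phi) (hY : 0 < entropy R Y).
Variable r : nat.
Hypothesis phi_range : forall x y, X x -> X y -> agree r x y -> phi x (0, 0) = phi y (0, 0).

Lemma small_code n (d : R) : 0 < d -> exists N0, forall N, (N0 <= N)%N ->
  exists (C : finType) (cd : plane -> C),
    (forall s s', valid s -> valid s' -> cd s = cd s' ->
     forall a b, 0 <= a < (N + 2 * r)%N%:Z -> 0 <= b < (N + 2 * r)%N%:Z -> s a b = s' a b) /\
    ln #|C|%:R + ln #|{ffun border r n N -> 'I_q.+1}|%:R <= d * N%:R ^+ 2.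
Proof.
move=> d0; have [N0 h0] := @tile_code_small R (d / 8) ltac:(by rewrite divr_gt0).
pose c : R := 8 * (sideN n + r)%:R * ln q.+1%:R.
exists (maxn N0 (maxn (2 * r) (Num.truncn (2 * c / d)).+1)) => N.
rewrite !geq_max => /and3P[N1 N2 N3].
have [C [cd h1 h2]] := h0 (N + 2 * r)%N (leq_trans N1 (leq_addr _ _)).
exists C, cd; split=> //.
have NR : (N + 2 * r)%:R <= 2 * N%:R :> R by rewrite -natrM ler_nat; lia.
have h3 : ln #|C|%:R <= d / 2 * N%:R ^+ 2.
  apply: (le_trans h2); apply: (@le_trans _ _ (d / 8 * (2 * N%:R) ^+ 2)); last by lra.
  by rewrite ler_pM2l ?divr_gt0 // ler_pXn2r ?nnegrE ?mulr_ge0.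
have h4 : ln #|{ffun border r n N -> 'I_q.+1}|%:R <= c * N%:R.
  rewrite card_ffun !card_prod card_bool !card_ord natrX lnXn ?ltr0n // -[leLHS]mulr_natl.
  rewrite (_ : c * N%:R = 4 * (sideN n + r)%:R * (2 * N%:R) * ln q.+1%:R); last by rewrite /c; ring.
  rewrite ler_wpM2r ?ln_ge0 ?ler1n //.
  rewrite (_ : (_ * _ * 2)%:R = 4 * (sideN n + r)%:R * (N + 2 * r)%:R :> R); last by rewrite !natrM; ring.
  by rewrite ler_wpM2l.
have h5 : 2 * c / d <= N%:R.
  by apply: (@le_trans _ _ (Num.truncn (2 * c / d)).+1%:R); [exact/ltW/truncnS_gt|rewrite ler_nat].
rewrite ler_pdivrMr // in h5.
have : 2 * c * N%:R <= N%:R * d * N%:R by rewrite ler_wpM2r.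
by rewrite expr2 in h3 *; lra.
Qed.

(** [measure_entropy] is a [lim], equal to the default [0] on a divergent sequence; positivity of
    the entropy excludes that case. *)
Lemma shannon_cvg (nu : probability (borel_config B) R) : max_entropy_measure Y nu ->
  (fun N : nat => (N%:R ^+ 2)^-1 * shannon Y nu N) @ \oo --> entropy R Y.
Proof.
move=> [_ e]; have [c|dv] := pselect (cvgn (fun N : nat => (N%:R ^+ 2)^-1 * shannon Y nu N)).
  by rewrite -e; exact: c.
by move: hY; rewrite -e /measure_entropy (dvgP dv) ltxx.
Qed.

Let Y_subshift : is_subshift Y. Proof. by case: phi_factor. Qed.
Let Y_nonempty : Y !=set0.
Proof.
have [_ _ _ _ <-] := phi_factor; have [x Xx] := system_nonempty q.
by exists (phi x), x.
Qed.

(** With a single content, the code of the tiles and the border would bound [shannon Y nu N] by half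
    of [entropy R Y * N ^ 2]. *)
Lemma contents_gt1 n (nu : probability (borel_config B) R) : (2 * r + 2 <= n)%N ->
  max_entropy_measure Y nu -> (1 < #|contents phi r n|)%N.
Proof.
move=> hn hnu; have := contents_gt0 phi_factor hn.
rewrite leq_eqVlt => /orP[/eqP c1|//]; exfalso.
have [N0 h0] := @small_code n (entropy R Y / 2) ltac:(by rewrite divr_gt0).
have h2 : entropy R Y / 2 < entropy R Y by move: hY; lra.
have [N1 _ h1] := cvgr_gt _ (shannon_cvg hnu) _ h2.
pose N := (maxn N0 N1).+1.
have [C [cd [hcd hC]]] := h0 N (leqW (leq_maxl _ _)).
have := h1 N (leqW (leq_maxr _ _)); rewrite /= [ltRHS]mulrC ltr_pdivlMr ?exprn_gt0 ?ltr0n //.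
have := trivial_contents phi_factor phi_range hn ([ffun=> point] : {ffun rect 0 0 -> B}) hcd (proj1 hnu) (esym c1).
by rewrite ltNge => a /negP; apply; exact: le_trans a hC.
Qed.

(** The positions in a core form a square of side [3 * 2 ^ n - c] with [c] independent of [n]. *)
Lemma core_large l (d : R) : 0 < d -> exists n, (2 * r + 2 <= n)%N /\
  9 * 4 ^+ n * (1 - d) <= ((sideN n - 2 * r - 2 - l) ^ 2)%:R.
Proof.
move=> d0; pose c := (2 * r + 4 + l)%N.
exists (maxn c (Num.truncn (2 * c%:R / d)).+1); set n := maxn _ _.
have nc : (c <= n)%N by rewrite leq_maxl.
split; first by rewrite /c in nc; lia.
have sn := side_ge n.
have e0 : (sideN n - 2 * r - 2 - l)%:R = 3 * 2 ^+ n - c%:R :> R.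
  have : (sideN n - 2 * r - 2 - l + c = sideN n + 2)%N.
    by rewrite -sideNE in sn; rewrite /c in nc *; lia.
  move=> /(congr1 (fun k : nat => k%:R : R)); rewrite !natrD side_real; lra.
rewrite natrX e0 (_ : 9 * 4 ^+ n = (3 * 2 ^+ n) ^+ 2); last first.
  by rewrite exprMn -exprM mulnC exprM; congr (_ * _ ^+ n); ring.
have D0 : 0 < 3 * 2 ^+ n :> R by rewrite mulr_gt0 ?exprn_gt0.
have h : 2 * c%:R / d <= 3 * 2 ^+ n.
  apply: (@le_trans _ _ n%:R).
    apply: (@le_trans _ _ (Num.truncn (2 * c%:R / d)).+1%:R); first exact/ltW/truncnS_gt.
    by rewrite ler_nat leq_maxr.
  rewrite -natrX -natrM ler_nat; have := ltn_expl n (isT : (1 < 2)%N); lia.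
rewrite ler_pdivrMr // in h; move: (3 * 2 ^+ n) D0 h => D D0 h.
have := ler_wpM2r (ltW D0) h; have := sqr_ge0 (c%:R : R); lra.
Qed.

Lemma window_prob_le (mu nu : probability (borel_config B) R) l (u : {ffun rect l l -> B}) :
  max_entropy_measure Y mu -> max_entropy_measure Y nu ->
  prob mu [set y | restr (rect l l) y = u] <= prob nu [set y | restr (rect l l) y = u].
Proof.
move=> hmu hnu; apply/ler_addgt0Pr => eps eps0.
(* The errors add up to [13 * t * d * N ^ 2]: [1] from the entropies, [2] from the codes, [8] from
   the positions outside the cores, [2] from the quadratic term. Passing from [(N - l) ^ 2] to
   [N ^ 2] doubles this. *)
have [d d0 dE] : exists2 d, 0 < d & eps = 26 * d.
  by exists (eps / 26); [rewrite divr_gt0|field].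
have [n [hn hcore]] := core_large l d0.
set core : R := ((_ - l) ^ 2)%:R in hcore; have core0 : 0 <= core by [].
(* [d] controls the quadratic term, and [1 / 4] is the range of the estimates of [partition_sum];
   [core + 1] avoids a division by zero. *)
have [t [t0 tcd tc4]] : exists t, [/\ 0 < t, t * core <= d & t * core <= 1 / 4].
  exists (Num.min d (1 / 4) / (core + 1)); move: (core) core0 => k k0.
  have m0 : 0 < Num.min d (1 / 4) by rewrite lt_min d0 divr_gt0.
  have : Num.min d (1 / 4) / (k + 1) * k <= Num.min d (1 / 4).
    by rewrite -mulrA ler_piMr ?(ltW m0) // mulrC ler_pdivrMr; lra.
  by rewrite le_min => /andP[? ?]; split=> //; rewrite divr_gt0 //; lra.
have td0 : 0 < t * d by rewrite mulr_gt0.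
(* The tolerance is [t * d] because the final inequality is divided by [t * N ^ 2]. *)
have [N0 h0] := small_code n td0.
have hdiff : (fun N : nat => 2 * ((N%:R ^+ 2)^-1 * lnL R Y N N) -
    (N%:R ^+ 2)^-1 * shannon Y mu N - (N%:R ^+ 2)^-1 * shannon Y nu N) @ \oo --> (0 : R).
  rewrite (_ : 0 = 2 * entropy R Y - entropy R Y - entropy R Y); last by ring.
  apply: cvgB; last exact: shannon_cvg.
  apply: cvgB; last exact: shannon_cvg.
  by apply: cvgM; [exact: cvg_cst|exact: entropy_square].
have [N1 _ h1] := cvgr_lt _ hdiff _ td0.
(* For [N = sideN m] some point has [4 ^ (m - n)] islands in the window. From [4 * l <= m <= N]
   follows [N - l >= 3 * N / 4], hence [N ^ 2 <= 2 * (N - l) ^ 2]. *)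
have [m [mn mN0 mN1 ml m1]] : exists m, [/\ n <= m, N0 <= m, N1 <= m, 4 * l <= m & 0 < m]%N.
  by exists (n + N0 + N1 + 4 * l + 1)%N; clear; split; lia.
have [N NE] : exists N, N = sideN m by eexists.
have mN : (m <= N)%N by rewrite NE; have := side_ge m; rewrite -sideNE; clear; lia.
have N_gt0 : 0 < N%:R :> R by rewrite ltr0n (leq_trans m1).
have N2 : 0 < N%:R ^+ 2 :> R by rewrite exprn_gt0.
have [C [cd [hcd hC]]] := h0 N (leq_trans mN0 mN).
have hS := h1 N (leq_trans mN1 mN).
have [x1 Xx1 hx1] := islands_window q hn NE mn.
have := comparison phi_factor phi_range hn u hcd (proj1 hmu) (proj1 hnu).
move=> /(_ t x1 (contents_gt1 hn hmu) t0 tc4 Xx1); rewrite -/core.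
have {}hS : 2 * lnL R Y N N - shannon Y mu N - shannon Y nu N <= t * d * N%:R ^+ 2.
  rewrite -ler_pdivrMr //; apply: le_trans (ltW hS); rewrite le_eqVlt; apply/orP; left; apply/eqP.
  by field; rewrite gt_eqF.
have h4m : 9 * 4 ^+ m = (3 * 2 ^+ m) ^+ 2 :> R.
  by rewrite exprMn -exprM mulnC exprM; congr (_ * _ ^+ m); ring.
have Nm : N%:R = 3 * 2 ^+ m - 2 :> R by rewrite NE side_real.
have m2 : 2 <= 2 ^+ m :> R.
  by rewrite -[leLHS]expr1 ler_weXn2l ?ler1n.
have hI : (1 - d) * (9 * 4 ^+ m) <= #|islands n N x1|%:R * core.
  apply: (@le_trans _ _ ((4 ^ (m - n))%:R * core)); last by rewrite ler_wpM2r // ler_nat.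
  rewrite natrX (_ : 4 ^+ m = 4 ^+ (m - n) * 4 ^+ n); last by rewrite -exprD subnK.
  rewrite (_ : (1 - d) * _ = 4 ^+ (m - n) * (9 * 4 ^+ n * (1 - d))); last by ring.
  by rewrite ler_wpM2l ?exprn_ge0.
have hNl : ((N - l) ^ 2)%:R <= N%:R ^+ 2 :> R by rewrite -natrX ler_nat leq_sqr leq_subr.
have hNl2 : N%:R ^+ 2 <= 2 * ((N - l) ^ 2)%:R :> R.
  rewrite -natrX -natrM ler_nat; have : (3 * N <= 4 * (N - l))%N by clear -ml mN; lia.
  by move: (N - l)%N => k; clear; nia.
have hrest : ((N - l) ^ 2)%:R - #|islands n N x1|%:R * core <= 4 * d * N%:R ^+ 2.
  apply: (@le_trans _ _ (N%:R ^+ 2 - (1 - d) * (9 * 4 ^+ m))); first by lra.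
  have : (3 * 2 ^+ m) ^+ 2 <= (2 * N%:R) ^+ 2 :> R by rewrite ler_pXn2r ?nnegrE ?mulr_ge0 // Nm; lra.
  have : N%:R ^+ 2 <= (3 * 2 ^+ m) ^+ 2 :> R by rewrite ler_pXn2r ?nnegrE ?mulr_ge0 // Nm; lra.
  rewrite h4m; move: ((3 * 2 ^+ m) ^+ 2) => D a b.
  have : d * D <= d * (2 * N%:R) ^+ 2 by rewrite ler_wpM2l // ltW.
  by rewrite exprMn; lra.
set p := prob mu _; set p' := prob nu _; set W : R := ((N - l) ^ 2)%:R in hNl hNl2 hrest *.
set Q := ln #|C|%:R + _ in hC * => hcmp.
rewrite -lerBlDl; have [pp|pp] := leP (p - p') 0; first by apply: le_trans pp _; exact: ltW.
have a1 : 2 * t * (W - #|islands n N x1|%:R * core) <= 2 * t * (4 * d * N%:R ^+ 2).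
  by rewrite ler_pM2l // mulr_gt0.
have W0 : 0 <= W by [].
have a2 : 2 * t ^+ 2 * core * W <= 2 * t * d * N%:R ^+ 2.
  rewrite (_ : 2 * t ^+ 2 * core * W = 2 * t * (t * core) * W); last by ring.
  by rewrite ler_pM // ?mulr_ge0 ?(ltW t0) // ler_wpM2l // mulr_ge0 // ltW.
have a3 : t * (N%:R ^+ 2 * (p - p')) <= t * (2 * W * (p - p')).
  by rewrite ler_pM2l // ler_pM2r.
have : t * N%:R ^+ 2 * (p - p') <= t * N%:R ^+ 2 * eps.
  by rewrite dE; lra.
by rewrite ler_pM2l // mulr_gt0.
Qed.

Lemma factor_intrinsically_ergodic : intrinsically_ergodic R Y.
Proof.
have [mu hmu] := exists_max_entropy_measure R Y_subshift Y_nonempty.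
exists mu => // nu hnu; apply: windows_determine (proj1 hnu) (proj1 hmu) _ => l u.
by apply: le_anti; rewrite !window_prob_le.
Qed.
End Uniqueness.

Theorem theorem1p2 (R : realType) (M : R) :
  exists (A : alphabetType) (X : set (config A)),
    [/\ is_sft X,
        M < entropy R X &
        forall (B : alphabetType) (Y : set (config B))
               (phi : config A -> config B),
          factor_map X Y phi -> 0 < entropy R Y -> intrinsically_ergodic R Y].
Proof.
have [q hq] := large_entropy M.
exists (letter q), (@system q); split=> //; first exact: system_sft.
move=> B Y phi phi_factor hY; have [[cX _] _ phi_cont _ _] := phi_factor.
have [r phi_range] := block_map cX phi_cont.
exact (@factor_intrinsically_ergodic R q B Y phi phi_factor hY r phi_range).
Qed.
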